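(* Let $(V,Y^{O},\mathbf{1},D)$ be a grading-restricted open-string vertex algebra, with formal vertex operator map $\mathcal{Y}^{f}$, let $C_{0}(V)\subset V$ be its meromorphic center, and let $\mathcal{Y}^{f}|_{C_{0}(V)}$ be the map $C_{0}(V)\otimes C_{0}(V)\to V[[x,x^{-1}]]$ induced by $\mathcal{Y}^{f}$. Then the image of $C_{0}(V)\otimes C_{0}(V)$ under $\mathcal{Y}^{f}|_{C_{0}(V)}$ is in $C_{0}(V)[[x,x^{-1}]]$, and the image of $C_{0}(V)$ under $D$ is in $C_{0}(V)$. Moreover, $$(C_{0}(V),\ \mathcal{Y}^{f}|_{C_{0}(V)},\ \mathbf{1},\ D)$$ is a grading-restricted vertex algebra, $V$ is a $C_{0}(V)$-module (with vertex operators $\mathcal{Y}^{f}(u,x)$, $u\in C_{0}(V)$), and $\mathcal{Y}^{f}$ is an intertwining operator of type $\binom{V}{VV}$ for the vertex algebra $C_{0}(V)$.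
   Context: All vector spaces are over $\mathbb{C}$. $\mathbb{R}_{+}$ is the set of positive reals. For an $\mathbb{R}$-graded space $V=\coprod_{n\in\mathbb{R}}V_{(n)}$ (direct sum), $\overline{V}=\prod_{n}V_{(n)}$, $V'=\coprod_{n}V_{(n)}^{*}$, $P_{n}$ is the projection onto $V_{(n)}$, and $\mathrm{wt}\,u=n$ for $u\in V_{(n)}$. An operator has weight $m$ if it maps $V_{(n)}$ to $V_{(n+m)}$ for all $n$. Limits and derivatives in $\overline V$ or $\mathrm{Hom}(V,\overline V)$ are taken weakly, i.e. after pairing with all $v'\in V'$ (and applying to all $v\in V$). Open-string vertex algebra: an $\mathbb{R}$-graded space $V$ with a vertex map $Y^{O}:(V\otimes V)\times\mathbb{R}_{+}\to\overline{V}$, $(u\otimes v,r)\mapsto Y^{O}(u,r)v$, linear in $u\otimes v$, a vacuum $\mathbf{1}\in V$ and $D\in\mathrm{End}\,V$ of weight $1$, such that: (1) for $n_{1},n_{2}\in\mathbb{R}$ there is a finite set $N(n_{1},n_{2})\subset\mathbb{R}$ such that $Y^{O}$ maps $\big(\coprod_{n\in n_{1}+\mathbb{Z}}V_{(n)}\otimes\coprod_{n\in n_{2}+\mathbb{Z}}V_{(n)}\big)\times\mathbb{R}_{+}$ into $\prod_{n\in N(n_{1},n_{2})+\mathbb{Z}}V_{(n)}$; (2) $Y^{O}(\mathbf{1},r)=\mathrm{id}_{V}$ for $r\in \mathbb{R}_+$, and $\lim_{r\to0}Y^{O}(u,r)\mathbf{1}$ exists and equals $u$; (3) for every $v'\in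 V'$ there is $k\in\mathbb{Z}_{+}$ with $(D')^{k}v'=0$, $D'$ the adjoint of $D$; (4) for $v_{1},\dots,v_{n},v\in V$, $v'\in V'$, the series $\sum_{m_{1},\dots,m_{n-1}\in\mathbb{R}}\langle v',Y^{O}(v_{1},r_{1})P_{m_{1}}Y^{O}(v_{2},r_{2})\cdots P_{m_{n-1}}Y^{O}(v_{n},r_{n})v\rangle$ (denoted $\langle v',Y^{O}(v_{1},r_{1})\cdots Y^{O}(v_{n},r_{n})v\rangle$) converges absolutely when $r_{1}>\cdots>r_{n}>0$, and $\langle v',Y^{O}(Y^{O}(v_{1},r_{0})v_{2},r_{2})v\rangle=\sum_{m}\langle v',Y^{O}(P_{m}Y^{O}(v_{1},r_{0})v_{2},r_{2})v\rangle$ converges absolutely when $r_{2}>r_{0}>0$; (5) $\langle v',Y^{O}(v_{1},r_{1})Y^{O}(v_{2},r_{2})v\rangle=\langle v',Y^{O}(Y^{O}(v_{1},r_{1}-r_{2})v_{2},r_{2})v\rangle$ for $r_{1}>r_{2}>r_{1}-r_{2}>0$; (6) $[\mathbf{d},Y^{O}(u,r)]=Y^{O}(\mathbf{d}u,r)+r\frac{d}{dr}Y^{O}(u,r)$, where $\mathbf{d}u=mu$ for $u\in V_{(m)}$; (7) $Y^{O}(u,r)$ is differentiable in $r$ and $\frac{d}{dr}Y^{O}(u,r)=[D,Y^{O}(u,r)]=Y^{O}(Du,r)$. It is grading-restricted if $\dim V_{(n)}<\infty$ for all $n\in \mathbb{R}$ and $V_{(n)}=0$ for $n$ sufficiently negative.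 Formal vertex operators: for $u\in V$ there are $u_{n}^{+}\in\mathrm{End}\,V$ ($n\in\mathbb{R}$), linear in $u$ and of weight $\mathrm{wt}\,u-n-1$ for homogeneous $u$, with $Y^{O}(u,r)=\sum_{n\in\mathbb{R}}u_{n}^{+}r^{-n-1}$ for $r\in\mathbb{R}_{+}$. Put $\mathcal{Y}^{f}(u,x)=\sum_{n\in\mathbb{R}}u_{n}^{+}x^{-n-1}$ with $x$ a formal variable. $\mathcal{Y}^{f}(v,-x)u$ means $\mathcal{Y}^{f}(v,y)u|_{y^{n}=e^{n\pi i}x^{n},\,n\in\mathbb{R}}$. Meromorphic center: $C_{0}(V)=\{u\in\coprod_{n\in\mathbb{Z}}V_{(n)}\mid \mathcal{Y}^{f}(u,x)\in(\mathrm{End}\,V)[[x,x^{-1}]],\ \mathcal{Y}^{f}(v,x)u=e^{xD}\mathcal{Y}^{f}(u,-x)v\ \forall v\in V\}$. A grading-restricted vertex algebra is a $\mathbb{Z}$-graded vertex algebra $(U,Y,\mathbf 1,D)$ (identity and creation properties, $D$-derivative property, compatibility with the grading, and Jacobi identity, equivalently rationality, commutativity and associativity) with finite-dimensional homogeneous subspaces which vanish in sufficiently negative degree. A $U$-module here is an $\mathbb{R}$-graded space with an operator $D$ and vertex operators satisfying the same axioms that make sense. An intertwining operator of type $\binom{W_{3}}{W_{1}W_{2}}$ is a linear map $W_{1}\otimes W_{2}\to W_{3}\{x\}$ (formal series in real powers of $x$), $w_1\otimes w_2\mapsto \mathcal{Y}(w_1,x)w_2$, satisfying lower truncation, the Jacobi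 identity with vertex operators for elements of $U$, and the $D$-derivative property $\frac{d}{dx}\mathcal{Y}(w_1,x)=\mathcal{Y}(Dw_1,x)$. *)

(* Defs.v *)
From HB Require Import structures.
From mathcomp Require Import all_boot all_order all_algebra.
From mathcomp Require Import archimedean finmap.
From mathcomp Require Import all_classical all_reals.
From mathcomp Require Import topology normedtype derive esum exp trigo.
From mathcomp Require Import summability.
From mathcomp Require Import complex.

Set Implicit Arguments.
Unset Strict Implicit.
Unset Printing Implicit Defensive.

Import Order.TTheory GRing.Theory Num.Theory.
Import numFieldNormedType.Exports.

Local Open Scope classical_set_scope.
Local Open Scope ring_scope.
Local Open Scope complex_scope.

(* Sums [\sum_(i \in A) F i] over possibly infinite [A] are the finite-support
   sums of fsbigop: wherever they occur below, only finitely many terms are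
   nonzero, by the gradings or by lower truncation. *)

(* A space with a decomposition V = \coprod_(n : I) V_(n), given by its
   projections P_n = [gproj n]. *)
Record graded_space (C : fieldType) (I : choiceType) := GradedSpace {
  gs_sort :> lmodType C;
  gproj : I -> {linear gs_sort -> gs_sort};
  gprojE : forall m n v, gproj m (gproj n v) = if m == n then gproj n v else 0;
  gproj_fin : forall v, finite_set [set n | gproj n v != 0];
  gproj_sum : forall v, v = \sum_(n \in [set: I]) gproj n v }.

(* The component V_(n). *)
Definition homog (C : fieldType) (I : choiceType) (V : graded_space C I)
    (n : I) : set V :=
  [set v | gproj V n v = v].

Definition has_weight (C : fieldType) (I : realDomainType)
    (V : graded_space C I) (T : V -> V) (m : I) : Prop :=
  forall n v, homog n v -> homog (n + m) (T v).

Definition grading_restricted (C : fieldType) (I : realDomainType)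
    (V : graded_space C I) : Prop :=
  (forall n : I, exists s : seq V, forall v : V, homog n v ->
     exists c : nat -> C, v = \sum_(i < size s) c i *: s`_i) /\
  (exists N : I, forall n, n < N -> forall v : V, homog n v -> v = 0).

Section Completion.
Variables (R : realType) (V : graded_space R[i] R).

(* The completion \prod_n V_(n), realised inside the functions R -> V. *)
Definition completion : set (R -> V) := [set f | forall n, homog n (f n)].

Definition to_completion (v : V) : R -> V := fun n => gproj V n v.

(* V' = \coprod_n V_(n)^*: the linear forms on V that vanish on all but
   finitely many of the V_(n). *)
Definition graded_dual : set {scalar V} :=
  [set v' | finite_set [set n | exists v, v' (gproj V n v) != 0]].

Definition pairing (v' : {scalar V}) (f : R -> V) : R[i] :=
  \sum_(n \in [set: R]) v' (f n).

Definition weak_right_limit (f : R -> R -> V) (a : R) (g : R -> V) : Prop :=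
  forall v', graded_dual v' ->
    (pairing v' (f r) : R[i]^o) @[r --> a^'+] --> (pairing v' g : R[i]^o).

Definition weak_derivative (f : R -> R -> V) (r : R) (g : R -> V) : Prop :=
  forall v', graded_dual v' ->
    (((h^-1)%:C * (pairing v' (f (r + h)) - pairing v' (f r))) : R[i]^o)
      @[h --> (0 : R)^'] --> (pairing v' g : R[i]^o).

(* The operator d: multiplication by n on V_(n). *)
Definition dop (v : V) : V := \sum_(n \in [set: R]) n%:C *: gproj V n v.

(* The extensions to the completion of d and of an operator D of weight 1. *)
Definition dop_bar (f : R -> V) : R -> V := fun n => n%:C *: f n.

Definition D_bar (D : V -> V) (f : R -> V) : R -> V := fun n => D (f (n - 1)).

Definition in_coset (a : R) (n : R) : Prop := n - a \is a Num.int.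

Definition supported_in_coset (a : R) (v : V) : Prop :=
  forall n, gproj V n v != 0 -> in_coset a n.

End Completion.

Definition abs_convergent (R : realType) (I : choiceType) (f : I -> R[i]) :
    Prop :=
  (\esum_(i in [set: I]) (complex.Re `|f i|)%:E < +oo)%E.

(* Convergence along the net of finite partial sums. *)
Definition has_sum (R : realType) (I : choiceType) (f : I -> R[i]) (s : R[i]) :
    Prop :=
  partial_sum (f : I -> R[i]^o) @ totally --> (s : R[i]^o).

Section VertexMap.
Variables (R : realType) (V : graded_space R[i] R).
Variable Y : V -> R -> V -> (R -> V).

(* Y(u,r) P_(m_1) Y(u_1,r_1) P_(m_2) Y(u_2,r_2) ... P_(m_k) Y(u_k,r_k) v, where
   [us] lists the (u_i, r_i) and [ms] the m_i; P_m of an element f of the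
   completion is f m. *)
Definition product_term (u : V) (r : R) (us : seq (V * R)) (ms : seq R)
    (v : V) : R -> V :=
  Y u r (foldr (fun x w => Y x.2.1 x.2.2 w x.1) v (zip ms us)).

(* Y(P_m Y(u,r0) v, r2) w. *)
Definition iterate_term (u : V) (r0 : R) (v : V) (r2 : R) (m : R) (w : V) :
    R -> V :=
  Y (Y u r0 v m) r2 w.

End VertexMap.

(* [os_Y] is meaningful only at positive reals; nothing is assumed elsewhere. *)
Record open_string_vertex_algebra (R : realType) := OpenStringVertexAlgebra {
  os_space :> graded_space R[i] R;
  os_Y : os_space -> R -> os_space -> (R -> os_space);
  os_one : os_space;
  os_D : {linear os_space -> os_space};
  os_Y_completion : forall u r v, 0 < r -> completion (os_Y u r v);
  os_Y_linearl : forall r v n, 0 < r -> linear (fun u => os_Y u r v n);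
  os_Y_linearr : forall u r n, 0 < r -> linear (fun v => os_Y u r v n);
  os_D_weight : has_weight os_D 1;
  os_weights : forall n1 n2 : R, exists N : seq R,
    forall u v r, supported_in_coset n1 u -> supported_in_coset n2 v -> 0 < r ->
    forall n, os_Y u r v n != 0 -> exists2 a, a \in N & in_coset a n;
  os_identity : forall r v, 0 < r -> os_Y os_one r v = to_completion v;
  os_creation : forall u,
    weak_right_limit (fun r => os_Y u r os_one) 0 (to_completion u);
  os_D_locally_nilpotent : forall v' : {scalar os_space}, graded_dual v' ->
    exists2 k : nat, (0 < k)%N & forall v, v' (iter k os_D v) = 0;
  os_products_cvg : forall (v' : {scalar os_space}) (u : os_space) (r : R)
      (us : seq (os_space * R)) (v : os_space),
    graded_dual v' ->
    path (fun a b => b < a) r [seq x.2 | x <- us] ->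
    all (fun a => 0 < a) (r :: [seq x.2 | x <- us]) ->
    abs_convergent (fun ms : (size us).-tuple R =>
      pairing v' (product_term os_Y u r us ms v));
  os_iterates_cvg : forall (v' : {scalar os_space}) u v w (r0 r2 : R),
    graded_dual v' -> 0 < r0 -> r0 < r2 ->
    abs_convergent (fun m : R => pairing v' (iterate_term os_Y u r0 v r2 m w));
  os_associativity : forall (v' : {scalar os_space}) u v w (r1 r2 : R),
    graded_dual v' -> r2 < r1 -> r1 - r2 < r2 ->
    exists2 s,
      has_sum (fun m : R =>
        pairing v' (product_term os_Y u r1 [:: (v, r2)] [:: m] w)) s &
      has_sum (fun m : R =>
        pairing v' (iterate_term os_Y u (r1 - r2) v r2 m w)) s;
  os_d_bracket : forall u v r, 0 < r ->
    exists g : R -> os_space,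
      [/\ completion g, weak_derivative (fun s => os_Y u s v) r g &
          forall n, dop_bar (os_Y u r v) n - os_Y u r (dop v) n =
                    os_Y (dop u) r v n + r%:C *: g n];
  os_D_derivative : forall u v r, 0 < r ->
    weak_derivative (fun s => os_Y u s v) r (os_Y (os_D u) r v);
  os_D_bracket : forall u v r n, 0 < r ->
    D_bar os_D (os_Y u r v) n - os_Y u r (os_D v) n = os_Y (os_D u) r v n }.

(* [Yf u n] is u_n^+, the coefficient of x^(-n-1) in Y^f(u,x). *)
Record formal_vertex_operators (R : realType)
    (V : open_string_vertex_algebra R) (Yf : V -> R -> V -> V) : Prop := {
  fv_linearl : forall n v, linear (fun u => Yf u n v);
  fv_linearr : forall u n, linear (Yf u n);
  fv_weight : forall p u n, homog p u -> has_weight (Yf u n) (p - n - 1);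
  fv_expansion : forall (v' : {scalar V}) u v r, graded_dual v' -> 0 < r ->
    pairing v' (os_Y u r v) =
      \sum_(n \in [set: R]) v' (Yf u n v) * (r `^ (- n - 1))%:C }.

(* e^(t pi i) *)
Definition expipi (R : realType) (t : R) : R[i] := cos (t * pi) +i* sin (t * pi).

(* The coefficient of x^(-n-1) in e^(xD) Y^f(u,-x) v. *)
Definition skew_coef (R : realType) (V : open_string_vertex_algebra R)
    (Yf : V -> R -> V -> V) (u v : V) (n : R) : V :=
  \sum_(k \in [set: nat])
    (k`!%:R^-1 * expipi (- (n + k%:R) - 1)) *:
      iter k (os_D V) (Yf u (n + k%:R) v).

Definition meromorphic_center (R : realType) (V : open_string_vertex_algebra R)
    (Yf : V -> R -> V -> V) : set V :=
  [set u | [/\ forall n, n \isn't a Num.int -> gproj V n u = 0,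
               forall n v, n \isn't a Num.int -> Yf u n v = 0 &
               forall v n, Yf v n u = skew_coef Yf u v n]].

(* As above, a vertex operator Y(u,x) = \sum_n u_n x^(-n-1) is given by its
   modes [Y u n] = u_n. Exponents lie in [J], which is [int] for vertex
   operators and the reals for general intertwining operators. *)

Definition bilinear_modes (K : fieldType) (J : Type) (W1 W2 W3 : lmodType K)
    (Y : W1 -> J -> W2 -> W3) : Prop :=
  (forall n v, linear (fun u => Y u n v)) /\ (forall u n, linear (Y u n)).

Definition lower_truncated (K : fieldType) (J : realDomainType)
    (W1 W2 W3 : lmodType K) (Y : W1 -> J -> W2 -> W3) : Prop :=
  forall u v, exists N, forall n, N <= n -> Y u n v = 0.

Definition cbinom (K : fieldType) (a : int) (i : nat) : K :=
  (\prod_(j < i) (a%:~R - j%:R)) / i`!%:R.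

(* Y(D u,x) = d/dx Y(u,x) *)
Definition D_derivative (K : fieldType) (J : realDomainType)
    (W1 W2 W3 : lmodType K) (ofJ : J -> K) (D : W1 -> W1)
    (Y : W1 -> J -> W2 -> W3) : Prop :=
  forall u n v, Y (D u) n v = - ofJ n *: Y u (n - 1) v.

(* [D, Y(u,x)] = d/dx Y(u,x) *)
Definition D_bracket (K : fieldType) (J : realDomainType)
    (W1 W2 : lmodType K) (ofJ : J -> K) (D : W2 -> W2)
    (Y : W1 -> J -> W2 -> W2) : Prop :=
  forall u n v, D (Y u n v) - Y u n (D v) = - ofJ n *: Y u (n - 1) v.

(* The Jacobi identity
     x0^-1 delta((x1-x2)/x0) Y3(u,x1) I(w1,x2) w2
     - x0^-1 delta((x2-x1)/(-x0)) I(w1,x2) Y2(u,x1) w2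
     = x2^-1 delta((x1-x0)/x2) I(Y1(u,x0) w1, x2) w2,
   with delta(z) = \sum_(l in Z) z^l and (a-b)^l expanded in nonnegative powers
   of b. The three definitions are the coefficients of
   x0^(-l-1) x1^(-m-1) x2^(-n-1) in its three terms. In the last one the power
   of x1 - x0 that contributes x0^i x1^(-m-1+i) is i-m-1, with coefficient
   (-1)^i binom(i-m-1,i) = binom(m,i). *)
Section Jacobi.
Variables (K : fieldType) (J : realDomainType) (U W1 W2 W3 : lmodType K).
Variables (Y1 : U -> int -> W1 -> W1) (Y2 : U -> int -> W2 -> W2).
Variables (Y3 : U -> int -> W3 -> W3) (I : W1 -> J -> W2 -> W3).

Definition jacobi_product (u : U) (w1 : W1) (w2 : W2) (l m : int) (n : J) : W3 :=
  \sum_(i \in [set: nat]) ((-1) ^+ i * cbinom K l i) *: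
    Y3 u (m + l - i%:Z) (I w1 (n + i%:R) w2).

Definition jacobi_opposite (u : U) (w1 : W1) (w2 : W2) (l m : int) (n : J) :
    W3 :=
  \sum_(i \in [set: nat]) ((-1) ^ l * (-1) ^+ i * cbinom K l i) *:
    I w1 (n + l%:~R - i%:R) (Y2 u (m + i%:Z) w2).

Definition jacobi_iterate (u : U) (w1 : W1) (w2 : W2) (l m : int) (n : J) : W3 :=
  \sum_(i \in [set: nat]) cbinom K m i *:
    I (Y1 u (l + i%:Z) w1) (m%:~R + n - i%:R) w2.

Definition jacobi_identity : Prop :=
  forall u w1 w2 l m n,
    jacobi_product u w1 w2 l m n - jacobi_opposite u w1 w2 l m n =
    jacobi_iterate u w1 w2 l m n.

End Jacobi.

Record vertex_algebra (R : realType) := VertexAlgebra {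
  va_space :> graded_space R[i] int;
  va_Y : va_space -> int -> va_space -> va_space;
  va_one : va_space;
  va_D : {linear va_space -> va_space};
  va_bilinear : bilinear_modes va_Y;
  va_lower_truncated : lower_truncated va_Y;
  va_weight : forall p u n, homog p u -> has_weight (va_Y u n) (p - n - 1);
  va_one_weight : homog 0 va_one;
  va_D_weight : has_weight va_D 1;
  va_identity : forall n v, va_Y va_one n v = if n == -1 then v else 0;
  va_creation : forall u,
    va_Y u (-1) va_one = u /\ (forall n, 0 <= n -> va_Y u n va_one = 0);
  va_D_derivative : D_derivative intr va_D va_Y;
  va_D_bracket : D_bracket intr va_D va_Y;
  va_jacobi : jacobi_identity va_Y va_Y va_Y va_Y }.

Record is_va_module (R : realType) (U : vertex_algebra R)
    (W : graded_space R[i] R) (Y : U -> int -> W -> W) (D : {linear W -> W}) :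
    Prop := {
  vm_bilinear : bilinear_modes Y;
  vm_lower_truncated : lower_truncated Y;
  vm_weight : forall p u n, homog p u -> has_weight (Y u n) (p - n - 1)%:~R;
  vm_D_weight : has_weight D 1;
  vm_identity : forall n w, Y (va_one U) n w = if n == -1 then w else 0;
  vm_D_derivative : D_derivative intr (va_D U) Y;
  vm_D_bracket : D_bracket intr D Y;
  vm_jacobi : jacobi_identity (@va_Y R U) Y Y Y;
  vm_grading_restricted : grading_restricted W }.

Record va_module (R : realType) (U : vertex_algebra R) := VAModule {
  vm_space :> graded_space R[i] R;
  vm_Y : U -> int -> vm_space -> vm_space;
  vm_D : {linear vm_space -> vm_space};
  vm_axioms : is_va_module vm_Y vm_D }.

Record intertwining_operator (R : realType) (U : vertex_algebra R)
    (W1 W2 W3 : va_module U) (I : W1 -> R -> W2 -> W3) : Prop := {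
  io_bilinear : bilinear_modes I;
  io_lower_truncated : lower_truncated I;
  io_jacobi : jacobi_identity (@vm_Y R U W1) (@vm_Y R U W2) (@vm_Y R U W3) I;
  io_D_derivative : D_derivative (real_complex R) (vm_D W1) I }.

(* Main.v *)
Require Import Defs.
From HB Require Import structures.
From mathcomp Require Import all_boot all_order all_algebra.
From mathcomp Require Import archimedean finmap.
From mathcomp Require Import all_classical all_reals.
From mathcomp Require Import topology normedtype sequences derive esum exp trigo realfun.
From mathcomp Require Import summability.
From mathcomp Require Import complex.
From mathcomp Require Import ring lra zify.

Set Implicit Arguments.
Unset Strict Implicit.
Unset Printing Implicit Defensive.

Import Order.TTheory GRing.Theory Num.Theory.
Import numFieldNormedType.Exports.
Import ComplexField ComplexField.Normc.

Local Open Scope classical_set_scope.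
Local Open Scope ring_scope.
Local Open Scope complex_scope.

(* Let u be in C_0(V), w1, w2 in V and v' in V'. Up to powers of r2, the matrix
   coefficients of Y(u,r1)Y(w1,r2)w2, Y(w1,r2)Y(u,r1)w2 and Y(Y(u,r1-r2)w1,r2)w2
   are Laurent series a(z), b(z), c(z-1) in z = r1/r2, because u has integral
   modes; they converge for |z| > 1, 0 < |z| < 1 and 0 < |z-1| < 1. Associativity
   gives a(z) = c(z-1) for real z slightly larger than 1, and associativity for
   (w1,u) together with the skew-symmetry of u gives b(z) = c(z-1) for z slightly
   smaller than 1. Multiplying by powers of z and z-1 we may assume that b and c
   are power series. To see that b extends beyond the unit circle, write
   Y(w2,r)1 = e^{rD}w2: the convergence of Y(w1,1+r)Y(u,y)Y(w2,r)1 for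
   r < y < 1+r, with r = 1/4, says that b, re-expanded at -1/4, converges in the
   disc of radius 5/4. This holds for v' replaced by e^{rD'}v', and an induction
   on the nilpotency order of D' on v' deals with the difference. The discs of
   radius 5/4 about -1/4 and of radius 1 about 1 cover the closed unit disc; so b
   converges in a larger disc and equals a there, both are polynomials, and the
   Jacobi identity becomes an identity between coefficients of polynomials.

   The Jacobi identities for (u; w, v) and (u; v, w) give the skew-symmetry of
   u_k v for u, v in C_0(V), so that C_0(V) is closed under its modes. *)

(** * Unordered sums of complex numbers *)

(** The obstacle: associativity concerns real radii only, so a, b and c are compared on short real
    segments next to z = 1. This says nothing about the rest of the unit circle, where b might be
    singular. A third vertex operator removes the difficulty: since Y(w1,1+r)Y(u,y)e^{rD}w2 =
    e^{rD}Y(w1,1)Y(u,y-r)w2, the variable of b is z = y-r, and y < 1+r becomes the disc |z+r| < 1+r.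
    On |z| = 1 this inequality is equivalent to Re z < 1, so it fails only at z = 1, exactly where c
    takes over. As D' is nilpotent on v', e^{rD'}v' is a finite sum of r^Q v'D^Q/Q!, with v' itself
    as the term Q = 0.

    No holomorphic function appears: a function is its sequence of coefficients, continuation is the
    rearrangement of an absolutely convergent double series, and Cauchy's estimates are averages
    over roots of unity of order a power of 2. Agreement on a real segment suffices everywhere,
    because a power series vanishing there has zero coefficients. *)

Section Sums.
Variable R : realType.
Local Notation K := R[i].

Lemma normC_normc (z : K) : `|z| = (normc z)%:C.
Proof. by case: z. Qed.

Lemma normc_ge0 (z : K) : 0 <= normc z.
Proof. by case: z => a b; rewrite sqrtr_ge0. Qed.

Lemma normc_real (x : R) : normc x%:C = `|x|.
Proof. by rewrite /normc /= expr0n /= addr0 sqrtr_sqr. Qed.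

Lemma normcB (x y z : K) : normc (x - z) <= normc (x - y) + normc (y - z).
Proof. by apply: le_trans (le_normcD _ _); rewrite addrA subrK. Qed.

Lemma normc_distC (x y : K) : normc (x - y) = normc (y - x).
Proof. by rewrite -opprB normcN. Qed.

Lemma normcX (x : K) n : normc (x ^+ n) = normc x ^+ n.
Proof.
by elim: n => [|n IH]; rewrite ?expr0 ?normc1 // !exprS normcM IH.
Qed.

Lemma normc_eq0 (x : K) : (normc x == 0) = (x == 0).
Proof.
by apply/eqP/eqP => [/eq0_normc //|->]; rewrite normc0.
Qed.

Lemma normc_sum (I : Type) (r : seq I) (f : I -> K) :
  normc (\sum_(i <- r) f i) <= \sum_(i <- r) normc (f i).
Proof.
elim/big_rec2: _ => [|i y x _ h]; first by rewrite normc0.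
by apply: le_trans (le_normcD _ _) _; rewrite lerD2l.
Qed.

Lemma has_sumP (I : choiceType) (f : I -> K) (s : K) :
  has_sum f s <-> forall e : R, 0 < e -> exists A : {fset I},
    forall B : {fset I}, (A `<=` B)%fset -> normc (\sum_(i <- B) f i - s) < e.
Proof.
have E (B : {fset I}) : partial_sum (f : I -> K^o) B = \sum_(i <- B) f i.
  by rewrite /partial_sum big_seq_fsetE.
split.
  move=> /(@cvgrPdist_lt _ _ _ _ totally_filter) h e e0.
  have e0' : 0 < e%:C by rewrite ltcR.
  have [A _ hA] := h _ e0'.
  exists A => B AB; have := hA B AB; rewrite /= E normC_normc ltcR.
  by rewrite normc_distC.
move=> h; apply/(@cvgrPdist_lt _ _ _ _ totally_filter) => e e0.
have [r r0 ->] : exists2 r : R, 0 < r & e = r%:C.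
  case: e e0 => a b; rewrite ltcE /= => /andP[/eqP -> a0]; by exists a.
have [A hA] := h r r0.
exists A => // B AB; rewrite /= E normC_normc ltcR normc_distC.
exact: hA.
Qed.

Lemma eq_has_sum (I : choiceType) (f g : I -> K) (s : K) :
  f =1 g -> has_sum f s -> has_sum g s.
Proof. by move=> /funext ->. Qed.

#[local] Opaque has_sum.

Lemma has_sum_unique (I : choiceType) (f : I -> K) (s t : K) :
  has_sum f s -> has_sum f t -> s = t.
Proof.
move=> /has_sumP hs /has_sumP ht; apply/eqP; rewrite -subr_eq0 -normc_eq0.
rewrite eq_le normc_ge0 andbT leNgt; apply/negP => d0.
have [A hA] := hs _ (divr_gt0 d0 (ltr0n R 2)).
have [B hB] := ht _ (divr_gt0 d0 (ltr0n R 2)).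
have h1 := hA (A `|` B)%fset (fsubsetUl _ _).
have h2 := hB (A `|` B)%fset (fsubsetUr _ _).
have := normcB s (\sum_(i <- (A `|` B)%fset) f i) t.
by rewrite normc_distC in h1; lra.
Qed.

Lemma has_sumD (I : choiceType) (f g : I -> K) (s t : K) :
  has_sum f s -> has_sum g t -> has_sum (fun i => f i + g i) (s + t).
Proof.
move=> /has_sumP hs /has_sumP ht; apply/has_sumP => e e0.
have [A hA] := hs _ (divr_gt0 e0 (ltr0n R 2)).
have [B hB] := ht _ (divr_gt0 e0 (ltr0n R 2)).
exists (A `|` B)%fset => C; rewrite fsubUset => /andP[AC BC].
have h1 := hA _ AC; have h2 := hB _ BC.
rewrite big_split /= opprD addrACA.
by have := le_normcD (\sum_(i <- C) f i - s) (\sum_(i <- C) g i - t); lra.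
Qed.

Lemma has_sumZ (I : choiceType) (f : I -> K) (s c : K) :
  has_sum f s -> has_sum (fun i => c * f i) (c * s).
Proof.
move=> /has_sumP hs; apply/has_sumP => e e0.
have c0 : 0 < normc c + 1 by rewrite ltr_wpDl ?normc_ge0.
have [A hA] := hs _ (divr_gt0 e0 c0).
exists A => B /hA; rewrite ltr_pdivlMr // => h.
rewrite -mulr_sumr -mulrBr normcM.
apply: le_lt_trans h; rewrite mulrC ler_wpM2l ?normc_ge0 //.
by rewrite lerDl.
Qed.
Arguments has_sumZ {I f s} c _.

Lemma has_sumN (I : choiceType) (f : I -> K) (s : K) :
  has_sum f s -> has_sum (fun i => - f i) (- s).
Proof.
by move=> /(has_sumZ (-1)); rewrite mulN1r; under eq_fun do rewrite mulN1r.
Qed.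

Lemma has_sumB (I : choiceType) (f g : I -> K) (s t : K) :
  has_sum f s -> has_sum g t -> has_sum (fun i => f i - g i) (s - t).
Proof. by move=> fs gt; apply: has_sumD fs (has_sumN gt). Qed.

Lemma has_sum_supp (I : choiceType) (f : I -> K) (A : {fset I}) :
  (forall i, i \notin A -> f i = 0) -> has_sum f (\sum_(i <- A) f i).
Proof.
move=> f0; apply/has_sumP => e e0; exists A => B AB.
rewrite (big_fset_incl _ AB) ?subrr ?normc0 // => i _; exact: f0.
Qed.

Lemma has_sum0 (I : choiceType) : has_sum (fun _ : I => 0 : K) 0.
Proof.
have := @has_sum_supp I (fun=> 0) fset0 (fun _ _ => erefl).
by rewrite big_seq_fset0.
Qed.

Lemma has_sum_bigsum (I : choiceType) (J : Type) (r : seq J)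
    (f : J -> I -> K) (s : J -> K) :
  (forall j, has_sum (f j) (s j)) ->
  has_sum (fun i => \sum_(j <- r) f j i) (\sum_(j <- r) s j).
Proof.
move=> h; elim: r => [|j r IH].
  by rewrite big_nil; under eq_fun do rewrite big_nil; exact: has_sum0.
rewrite big_cons; apply: eq_has_sum (has_sumD (h j) IH) => i.
by rewrite big_cons.
Qed.

Lemma has_sum_reindex (I J : choiceType) (e : I -> J) (f : J -> K) (s : K) :
  injective e -> (forall j, (forall i, j <> e i) -> f j = 0) ->
  has_sum f s <-> has_sum (fun i => f (e i)) s.
Proof.
move=> einj f0.
have sumE (B : {fset I}) : \sum_(j <- [fset e i | i in B]%fset) f j =
    \sum_(i <- B) f (e i).
  by rewrite big_imfset //= => i j _ _; exact: einj.
have pre (B : {fset J}) : exists C : {fset I},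
    (forall i, (i \in C) = (e i \in B)) /\
    \sum_(j <- B) f j = \sum_(i <- C) f (e i).
  have fin : finite_set [set i | e i \in B].
    apply: (@sub_finite_set _ _ (e @^-1` [set` B])); first by move=> i.
    by apply: finite_preimage => // i j _ _; exact: einj.
  exists (fset_set [set i | e i \in B]); split => [i|].
    by rewrite in_fset_set // mem_setE.
  rewrite -sumE; apply/esym/big_fset_incl.
    by apply/fsubsetP => j /imfsetP[i /=]; rewrite in_fset_set // mem_setE => iB ->.
  move=> j jB; apply: contraNeq => fj0.
  apply/imfsetP; have [[i ji]|ne] := pselect (exists i, j = e i); last first.
    by move: fj0; rewrite f0 ?eqxx // => i ji; apply: ne; exists i.
  by exists i => //=; rewrite in_fset_set //; apply/mem_set; rewrite /= -ji.
split => /has_sumP h; apply/has_sumP => d d0; have [A hA] := h d d0.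
  have [C [CA _]] := pre A; exists C => B CB; rewrite -sumE.
  have -> : \sum_(j <- [fset e i | i in B]%fset) f j =
      \sum_(j <- (A `|` [fset e i | i in B])%fset) f j.
    apply: big_fset_incl; first exact: fsubsetUr.
    move=> j; rewrite in_fsetU => jAB jB; apply: f0 => i ji.
    move: jAB; rewrite (negbTE jB) orbF => jA.
    have : i \in B by apply: (fsubsetP CB); rewrite CA -ji.
    by move=> iB; move/negP: jB; apply; apply/imfsetP; exists i.
  by apply: hA; exact: fsubsetUl.
exists [fset e i | i in A]%fset => B AB; have [C [CB ->]] := pre B.
apply: hA; apply/fsubsetP => i iA; rewrite CB; apply: (fsubsetP AB).
by apply/imfsetP; exists i.
Qed.

Lemma ler_sum_fsubset (I : choiceType) (g : I -> R) (A B : {fset I}) :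
  (forall i, 0 <= g i) -> (A `<=` B)%fset ->
  \sum_(i <- A) g i <= \sum_(i <- B) g i.
Proof.
move=> g0 AB; rewrite (big_fsetID _ (mem A) B) /=.
have -> : [fset x in B | x \in A]%fset = A.
  apply/fsetP => x; rewrite !inE /=; have [xA|] := boolP (x \in A).
    by rewrite (fsubsetP AB).
  by rewrite andbF.
by rewrite lerDl sumr_ge0.
Qed.

Lemma sum_fsetM (S : nmodType) (I J : choiceType) (F : I * J -> S) (A : {fset I})
    (B : {fset J}) :
  \sum_(p <- (A `*` B)%fset) F p = \sum_(i <- A) \sum_(j <- B) F (i, j).
Proof.
by rewrite big_imfset2 //= => -[? ?] [? ?] _ _ /= [-> ->].
Qed.

(** Absolute convergence in quantitative form: the constant M is what the estimates for double
    series pass from rows to the whole. *)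
Definition bounded_sums (I : choiceType) (g : I -> R) (M : R) :=
  forall B : {fset I}, \sum_(i <- B) g i <= M.

Lemma bounded_sums_ge0 (I : choiceType) (g : I -> R) M :
  bounded_sums g M -> 0 <= M.
Proof. by move=> /(_ fset0); rewrite big_seq_fset0. Qed.

Lemma bounded_sums_term (I : choiceType) (g : I -> R) M i :
  bounded_sums g M -> g i <= M.
Proof. by move=> /(_ [fset i]%fset); rewrite big_seq_fset1. Qed.

Lemma bounded_sums_le (I : choiceType) (f g : I -> R) M :
  (forall i, f i <= g i) -> bounded_sums g M -> bounded_sums f M.
Proof. by move=> fg gM B; apply: le_trans (gM B); apply: ler_sum. Qed.

Lemma bounded_sumsZ (I : choiceType) (g : I -> R) M c : 0 <= c ->
  bounded_sums g M -> bounded_sums (fun i => c * g i) (c * M).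
Proof. by move=> c0 gM B; rewrite -mulr_sumr ler_wpM2l. Qed.

Lemma bounded_sumsD (I : choiceType) (f g : I -> R) M N :
  bounded_sums f M -> bounded_sums g N ->
  bounded_sums (fun i => f i + g i) (M + N).
Proof. by move=> fM gN B; rewrite big_split lerD. Qed.

Lemma bounded_sums_inj (I J : choiceType) (e : I -> J) (g : J -> R) M :
  injective e -> bounded_sums g M -> bounded_sums (fun i => g (e i)) M.
Proof.
move=> einj gM B; have := gM [fset e i | i in B]%fset.
by rewrite big_imfset //= => i j _ _; exact: einj.
Qed.

Lemma has_sum_ge0 (I : choiceType) (g : I -> R) M :
  (forall i, 0 <= g i) -> bounded_sums g M ->
  exists s, has_sum (fun i => (g i)%:C) s%:C.
Proof.
move=> g0 gM; pose S := [set \sum_(i <- B) g i | B in [set: {fset I}]].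
have hS : has_sup S.
  split; first by exists 0, fset0; rewrite ?big_seq_fset0.
  by exists M => _ [B _ <-].
exists (sup S); apply/has_sumP => e e0.
have [_ [A _ <-] hA] := sup_adherent e0 hS.
exists A => B AB.
rewrite -rmorph_sum -rmorphB normc_real.
have hB : \sum_(i <- B) g i <= sup S by apply: ub_le_sup; [exact: hS.2|exists B].
rewrite ler0_norm ?subr_le0 // opprB ltrBlDr -ltrBlDl.
apply: lt_le_trans hA _; exact: ler_sum_fsubset.
Qed.

(** If h is the real or the imaginary part, then |h z| <= [normc z], so h + [normc] is non-negative
    with bounded sums. Subtracting the sum of the norms leaves the sum of h. *)
Lemma bounded_has_sum (I : choiceType) (f : I -> K) M :
  bounded_sums (fun i => normc (f i)) M -> exists s, has_sum f s.
Proof.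
move=> fM.
have le1 z : `|complex.Re z| <= normc z :> R.
  by rewrite -lecR -normC_normc normc_ge_Re.
have le2 z : `|complex.Im z| <= normc z :> R.
  have := le1 (z * 'i%C); rewrite ReiNIm normrN normcM.
  by rewrite /normc /= expr0n expr1n /= add0r sqrtr1 mulr1.
have [s hs] : exists s : R, has_sum (fun i => (normc (f i))%:C) s%:C.
  by apply: has_sum_ge0 fM => i; exact: normc_ge0.
have key (h : K -> R) : (forall z, `|h z| <= normc z) ->
    exists s, has_sum (fun i => (h (f i))%:C) s.
  move=> hn; have [t ht] : exists t : R,
      has_sum (fun i => (h (f i) + normc (f i))%:C) t%:C.
    apply: (@has_sum_ge0 _ _ (2 * M)) => [i|].
      by have := hn (f i); rewrite ler_norml => /andP[h1 _]; lra.
    apply: bounded_sums_le (bounded_sumsZ _ fM) => // i.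
    by have := hn (f i); rewrite ler_norml => /andP[_ h1]; lra.
  exists (t%:C - s%:C).
  have := has_sumB ht hs.
  by under eq_fun => i do rewrite -rmorphB addrK.
have [a ha] := key _ le1; have [b hb] := key _ le2.
exists (a + 'i%C * b); apply: eq_has_sum (has_sumD ha (has_sumZ 'i%C hb)) => i.
by rewrite -complexE.
Qed.

Lemma has_sum_normc_le (I : choiceType) (f : I -> K) s M :
  has_sum f s -> bounded_sums (fun i => normc (f i)) M -> normc s <= M.
Proof.
move=> /has_sumP hs fM; apply/ler_addgt0Pr => e e0.
have [A hA] := hs e e0; have := hA A (fsubset_refl _).
have := fM A; have := normc_sum A f.
have := le_normcD (\sum_(i <- A) f i) (s - \sum_(i <- A) f i).
by rewrite addrC subrK normc_distC; lra.
Qed.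

Lemma bounded_sums_has_sum (I : choiceType) (g : I -> R) (s : K) :
  (forall i, 0 <= g i) -> has_sum (fun i => (g i)%:C) s ->
  bounded_sums g (normc s).
Proof.
move=> g0 /has_sumP hs B; apply/ler_addgt0Pr => e e0.
have [A hA] := hs e e0; have := hA (A `|` B)%fset (fsubsetUl _ _).
have := ler_sum_fsubset g0 (fsubsetUr A B).
have := le_normcD (\sum_(i <- (A `|` B)%fset) (g i)%:C - s) s.
by rewrite subrK -rmorph_sum normc_real ger0_norm ?sumr_ge0 //; lra.
Qed.

Lemma bounded_sums_pair (I J : choiceType) (F : I * J -> R) (G : I -> R) M :
  (forall p, 0 <= F p) ->
  (forall i, bounded_sums (fun j => F (i, j)) (G i)) -> bounded_sums G M ->
  bounded_sums F M.
Proof.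
move=> F0 FG GM B.
pose B1 := [fset p.1 | p in B]%fset; pose B2 := [fset p.2 | p in B]%fset.
apply: le_trans (GM B1).
apply: (@le_trans _ _ (\sum_(i <- B1) \sum_(j <- B2) F (i, j))); last first.
  by apply: ler_sum => i _; exact: FG.
rewrite -sum_fsetM; apply: ler_sum_fsubset => //.
apply/fsubsetP => p pB; rewrite in_fsetM; apply/andP; split; apply/imfsetP;
  by exists p.
Qed.

(** For a finite set C of rows containing those of a good finite set A, take so many columns that
    the rectangle contains A and the sum of the rows in C is reached up to e/2. The rectangle is
    then close both to S and to the sum of g over C. *)
Lemma has_sum_rows (I J : choiceType) (F : I * J -> K) (g : I -> K) (S : K) :
  has_sum F S -> (forall i, has_sum (fun j => F (i, j)) (g i)) -> has_sum g S.
Proof.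
move=> /has_sumP hF hg; apply/has_sumP => e e0.
have e2 : 0 < e / 2 by lra.
have [A hA] := hF _ e2.
exists [fset p.1 | p in A]%fset => C AC.
have /has_sumP/(_ _ e2)[D hD] := @has_sum_bigsum _ _ C _ _ hg.
pose D' := (D `|` [fset p.2 | p in A])%fset.
have h1 := hD D' (fsubsetUl _ _).
have : (A `<=` C `*` D')%fset.
  apply/fsubsetP => p pA; rewrite in_fsetM in_fsetU; apply/andP; split.
    by apply: (fsubsetP AC); apply/imfsetP; exists p.
  by apply/orP; right; apply/imfsetP; exists p.
move=> /hA; rewrite sum_fsetM exchange_big /= => h2.
rewrite normc_distC in h1.
have := normcB (\sum_(i <- C) g i) (\sum_(j <- D') \sum_(i <- C) F (i, j)) S.
by lra.
Qed.

Lemma has_sum_cols (I J : choiceType) (F : I * J -> K) (g : J -> K) (S : K) :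
  has_sum F S -> (forall j, has_sum (fun i => F (i, j)) (g j)) -> has_sum g S.
Proof.
move=> hF hg; pose sw (p : J * I) := (p.2, p.1).
apply: (@has_sum_rows _ _ (fun p => F (sw p))) => //.
by apply/(has_sum_reindex _ (f := F) (e := sw)) => //;
  [move=> [? ?] [? ?] [-> ->] | move=> [i j] /(_ (j, i))].
Qed.

Lemma bounded_sums_geometric (r : R) : 0 <= r < 1 ->
  bounded_sums (fun n => r ^+ n) (1 - r)^-1.
Proof.
move=> /andP[r0 r1] B.
have [N hN] : exists N, forall i, i \in B -> (i < N)%N.
  exists (\max_(i <- B) i).+1 => i iB; rewrite ltnS.
  exact: (@leq_bigmax_seq _ _ xpredT id).
have r1' : 0 < 1 - r by rewrite subr_gt0.
apply: (@le_trans _ _ (\sum_(i <- [fset i in iota 0 N]%fset) r ^+ i)).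
  apply: ler_sum_fsubset => [i|]; first exact: exprn_ge0.
  apply/fsubsetP => i iB; apply/imfsetP; exists i => //=.
  by rewrite mem_iota add0n hN.
have -> : \sum_(i <- [fset i in iota 0 N]%fset) r ^+ i = \sum_(i < N) r ^+ i.
  rewrite big_imfset //= -(big_mkord xpredT (fun i => r ^+ i)).
  by rewrite /index_iota subn0 undup_id ?iota_uniq.
rewrite -[leRHS]mul1r ler_pdivlMr //.
have := subrX1 r N; have := exprn_ge0 N r0.
by move: (\sum_(i < N) _) (r ^+ N) => S p; lra.
Qed.

Lemma abs_convergent_bounded (I : choiceType) (f : I -> K) :
  abs_convergent f -> exists M, bounded_sums (fun i => normc (f i)) M.
Proof.
rewrite /abs_convergent; set E := (\esum_(i in _) _)%E => Eoo.
have hE (B : {fset I}) : ((\sum_(i <- B) normc (f i))%:E <= E)%E.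
  rewrite -sumEFin.
  have -> : (\sum_(i <- B) (normc (f i))%:E)%E =
      (\sum_(i \in [set` B]) (complex.Re `|f i|)%:E)%E.
    rewrite -(fsbig_seq _ _ (fset_uniq B)); apply: eq_bigr => i _.
    by rewrite normC_normc.
  by apply: esum_ge; exists [set` B] => //; split.
exists (fine E) => B; have := hE B.
by case: E Eoo hE => [r| |] //= _ _; rewrite lee_fin.
Qed.

End Sums.

Arguments has_sumZ {R I f s} c _.

(** * Power series *)

Section PowerSeries.
Variable R : realType.
Local Notation K := R[i].
Implicit Types (a b g : nat -> K) (w y : K) (r s rho : R).

Lemma normc_exp_real (r : R) n : 0 <= r -> normc (r%:C ^+ n) = r ^+ n.
Proof. by move=> r0; rewrite normcX normc_real ger0_norm. Qed.

Lemma normc_nat n : normc (n%:R : K) = n%:R.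
Proof. by rewrite -(rmorph_nat (real_complex R)) normc_real ger0_norm. Qed.

Lemma has_sum_nat_fin (f : nat -> K) N :
  (forall k, (N <= k)%N -> f k = 0) -> has_sum f (\sum_(k < N) f k).
Proof.
move=> f0.
have -> : \sum_(k < N) f k = \sum_(k <- [fset i in iota 0 N]%fset) f k.
  rewrite big_imfset //= -(big_mkord xpredT f).
  by rewrite /index_iota subn0 undup_id ?iota_uniq.
apply: has_sum_supp => i; apply: contraNeq => fi.
apply/imfsetP; exists i => //=; rewrite mem_iota add0n.
by rewrite ltnNge; apply: contra fi => /f0 ->.
Qed.

(** Abel's criterion: boundedness of the terms at every r < rho already gives absolute convergence
    there, by comparison with a geometric series from a slightly larger radius. *)
Definition radius_ge a rho :=
  forall r, 0 <= r < rho -> exists M, forall n, normc (a n) * r ^+ n <= M.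

Lemma radius_ge_bounded a rho r : radius_ge a rho -> 0 <= r < rho ->
  exists M, bounded_sums (fun n => normc (a n) * r ^+ n) M.
Proof.
move=> ra /andP[r0 rr]; pose t := (r + rho) / 2.
have t0 : 0 < t by rewrite /t; lra.
have /ra[M hM] : 0 <= t < rho by rewrite /t; lra.
have M0 : 0 <= M by apply: le_trans (hM 0%N); rewrite expr0 mulr1 normc_ge0.
have rt : 0 <= r / t < 1 by rewrite divr_ge0 ?(ltW t0) //= ltr_pdivrMr // /t; lra.
exists (M * (1 - r / t)^-1).
apply: bounded_sums_le (bounded_sumsZ M0 (bounded_sums_geometric rt)) => n.
apply: le_trans (ler_wpM2r _ (hM n)); last by rewrite exprn_ge0 //; case/andP: rt.
by rewrite -mulrA -exprMn mulrC (mulrC t) divfK ?gt_eqF // mulrC.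
Qed.

Section Reexpansion.
Variables (I : choiceType) (d : I -> K) (beta : I -> nat -> K) (s M : R).
Variable (bd : I -> R).
Hypothesis beta_bd : forall i,
  bounded_sums (fun k => normc (beta i k) * s ^+ k) (bd i).
Hypothesis d_bd : bounded_sums (fun i => normc (d i) * bd i) M.

(** The setting is a series of d_i phi_i(y) with phi_i(y) expanded in powers of y by [beta i]. It is
    used with phi_n(y) = (w+y)^n for Taylor shifts, and with phi_k(y) = (1+y)^k, k an integer, for
    Laurent series near 1. *)
Lemma reexpand_coef_bound k :
  0 <= s -> bounded_sums (fun i => normc (d i * beta i k) * s ^+ k) M.
Proof.
move=> s0; apply: bounded_sums_le d_bd => i.
rewrite normcM -mulrA ler_wpM2l ?normc_ge0 //.
exact: (bounded_sums_term (g := fun k => normc (beta i k) * s ^+ k)).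
Qed.

Lemma reexpand_coef_ex : 0 < s ->
  exists g, forall k, has_sum (fun i => d i * beta i k) (g k).
Proof.
move=> s0; have H k : {g : K | has_sum (fun i => d i * beta i k) g}.
  apply: cid; apply: (@bounded_has_sum _ _ _ ((s ^+ k)^-1 * M)).
  apply: bounded_sums_le (bounded_sumsZ _ (reexpand_coef_bound k (ltW s0))).
    by move=> i; rewrite [leRHS]mulrC mulfK // expf_eq0 gt_eqF ?andbF.
  by rewrite invr_ge0 exprn_ge0 // ltW.
by exists (fun k => sval (H k)) => k; exact: svalP.
Qed.

Lemma reexpand_coef_le g k : 0 < s ->
  has_sum (fun i => d i * beta i k) (g k) -> normc (g k) * s ^+ k <= M.
Proof.
move=> s0 hg; have sk : 0 < s ^+ k by rewrite exprn_gt0.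
rewrite -ler_pdivlMr //; apply: has_sum_normc_le hg _.
rewrite mulrC.
apply: bounded_sums_le (bounded_sumsZ _ (reexpand_coef_bound k (ltW s0))).
  by move=> i; rewrite [leRHS]mulrC mulfK // gt_eqF.
by rewrite invr_ge0 ltW.
Qed.

Lemma reexpand_has_sum g (phi : I -> K) y : normc y <= s ->
  (forall i, has_sum (fun k => beta i k * y ^+ k) (phi i)) ->
  (forall k, has_sum (fun i => d i * beta i k) (g k)) ->
  exists S, has_sum (fun i => d i * phi i) S /\ has_sum (fun k => g k * y ^+ k) S.
Proof.
move=> ys hphi hg; pose F (p : I * nat) := d p.1 * (beta p.1 p.2 * y ^+ p.2).
have [S hS] : exists S, has_sum F S.
  apply: (@bounded_has_sum _ _ _ M).
  apply: (bounded_sums_pair (G := fun i => normc (d i) * bd i)) d_bd => [p|i].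
    exact: normc_ge0.
  apply: bounded_sums_le (bounded_sumsZ (normc_ge0 (d i)) (beta_bd i)) => k.
  rewrite /F /= !normcM ler_wpM2l ?normc_ge0 // ler_wpM2l ?normc_ge0 //.
  by rewrite normcX lerXn2r ?nnegrE ?normc_ge0 // (le_trans _ ys) ?normc_ge0.
exists S; split.
  by apply: has_sum_rows hS _ => i; exact: (has_sumZ (d i) (hphi i)).
apply: has_sum_cols hS _ => k; rewrite mulrC.
by apply: eq_has_sum (has_sumZ (y ^+ k) (hg k)) => i; rewrite /F /=; ring.
Qed.

End Reexpansion.

(** The column sums of the double series obtained by expanding each (w+y)^n; a relation between
    sequences, so that no derivative or analytic function is needed. *)
Definition taylor_at a w g :=
  forall k, has_sum (fun n => a n * ('C(n, k)%:R * w ^+ (n - k))) (g k).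

Lemma has_sum_binomial w y n :
  has_sum (fun k => ('C(n, k)%:R * w ^+ (n - k)) * y ^+ k) ((w + y) ^+ n).
Proof.
rewrite exprDn; under eq_bigr => i _ do rewrite -mulr_natl mulrA.
apply: (has_sum_nat_fin (f := fun k => 'C(n, k)%:R * w ^+ (n - k) * y ^+ k)).
by move=> k nk; rewrite bin_small // !mul0r.
Qed.

Lemma bounded_sums_binomial w s n : 0 <= s ->
  bounded_sums (fun k => normc ('C(n, k)%:R * w ^+ (n - k)) * s ^+ k)
    ((normc w + s) ^+ n).
Proof.
move=> s0; have ws : 0 <= normc w + s by rewrite addr_ge0 ?normc_ge0.
rewrite -(normc_exp_real n ws); apply: bounded_sums_has_sum.
  by move=> k; rewrite mulr_ge0 ?normc_ge0 // exprn_ge0.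
have := @has_sum_binomial (normc w)%:C s%:C n; rewrite -rmorphD; apply: eq_has_sum => k.
by rewrite normcM normc_nat normcX !rmorphM !rmorphXn rmorph_nat.
Qed.

Section Taylor.
Variables (a : nat -> K) (rho : R).
Hypothesis a_rho : radius_ge a rho.

Let bd w s : 0 <= s -> normc w + s < rho -> exists M,
  bounded_sums (fun n => normc (a n) * (normc w + s) ^+ n) M.
Proof.
move=> s0 h; apply: (radius_ge_bounded a_rho).
by rewrite h addr_ge0 ?normc_ge0.
Qed.

Lemma taylor_ex w : normc w < rho -> exists g, taylor_at a w g.
Proof.
move=> wr; pose s := (rho - normc w) / 2.
have s0 : 0 < s by rewrite /s; lra.
have [M hM] : exists M,
    bounded_sums (fun n => normc (a n) * (normc w + s) ^+ n) M.
  by apply: bd; rewrite ?ltW // /s; lra.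
exact: reexpand_coef_ex (fun n => bounded_sums_binomial w n (ltW s0)) hM s0.
Qed.

Lemma taylor_radius w g : normc w < rho -> taylor_at a w g ->
  radius_ge g (rho - normc w).
Proof.
move=> wr wg r /andP[r0 rr]; pose s := (r + (rho - normc w)) / 2.
have s0 : 0 < s by rewrite /s; lra.
have [M hM] : exists M,
    bounded_sums (fun n => normc (a n) * (normc w + s) ^+ n) M.
  by apply: bd; rewrite ?ltW // /s; lra.
exists M => k.
apply: le_trans (reexpand_coef_le (fun n => bounded_sums_binomial w n (ltW s0))
  hM s0 (wg k)).
rewrite ler_wpM2l ?normc_ge0 // lerXn2r ?nnegrE //; first exact: ltW.
by rewrite /s; lra.
Qed.

Lemma taylor_has_sum w g y : taylor_at a w g -> normc w + normc y < rho ->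
  exists S, has_sum (fun n => a n * (w + y) ^+ n) S /\
            has_sum (fun k => g k * y ^+ k) S.
Proof.
move=> wg h; have [M hM] := bd (normc_ge0 y) h.
exact: (reexpand_has_sum (phi := fun n => (w + y) ^+ n)
  (fun n => bounded_sums_binomial w n (normc_ge0 y)) hM (lexx _)
  (fun n => @has_sum_binomial w y n) wg).
Qed.

End Taylor.

(** If all earlier coefficients vanish, then a_n y^n equals minus the tail, which is at most C
    y^(n+1); hence |a_n| <= C y for all small y. Only positive real y are used, as associativity
    gives no others. *)
Lemma powerseries_eq0 a rho e : 0 < rho -> radius_ge a rho -> 0 < e ->
  (forall y : R, 0 < y < e -> has_sum (fun n => a n * y%:C ^+ n) 0) ->
  forall n, a n = 0.
Proof.
move=> rho0 ra e0 h; elim/ltn_ind => n IH.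
pose t := rho / 2; have t0 : 0 < t by rewrite /t; lra.
have [M hM] : exists M, bounded_sums (fun k => normc (a k) * t ^+ k) M.
  by apply: (radius_ge_bounded ra); rewrite /t; lra.
have M0 := bounded_sums_ge0 hM.
apply/eqP; rewrite -normc_eq0 eq_le normc_ge0 andbT leNgt; apply/negP => an.
pose C := M / t ^+ n.+1.
have C0 : 0 <= C by rewrite divr_ge0 // exprn_ge0 // ltW.
have key (y : R) : 0 < y < e -> y < t -> normc (a n) <= y * C.
  move=> ye yt; have y0 : 0 < y by case/andP: ye.
  have hn : has_sum (fun k => if k == n then a n * y%:C ^+ n else 0)
      (a n * y%:C ^+ n).
    have := @has_sum_supp R nat (fun k => if k == n then a n * y%:C ^+ n else 0)
      [fset n]%fset; rewrite big_seq_fset1 eqxx; apply.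
    by move=> i; rewrite !inE => /negbTE ->.
  have := has_sumB (h y ye) hn; rewrite sub0r => hs.
  have := has_sum_normc_le hs (M := y ^+ n.+1 * C).
  rewrite normcN normcM normc_exp_real ?(ltW y0) // => hC.
  rewrite -(ler_pM2r (exprn_gt0 n y0)) mulrAC -exprS; apply: hC.
  have -> : y ^+ n.+1 * C = y ^+ n.+1 / t ^+ n.+1 * M by rewrite /C; ring.
  apply: bounded_sums_le (bounded_sumsZ _ hM); last first.
    by rewrite divr_ge0 ?exprn_ge0 // ltW.
  move=> k; case: ltngtP => [kn|nk|->].
  - rewrite IH // mul0r subr0 normc0 mul0r mulr0 //.
  - rewrite subr0 normcM normc_exp_real ?(ltW y0) //.
    rewrite mulrCA ler_wpM2l ?normc_ge0 //.
    rewrite -[in leLHS](subnKC nk) -[in leRHS](subnKC nk) !exprD.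
    rewrite mulrA divfK ?expf_neq0 ?gt_eqF //.
    rewrite ler_wpM2l ?exprn_ge0 ?(ltW y0) // lerXn2r ?nnegrE ?ltW //.
  - by rewrite subrr normc0 mulr_ge0 // ?mulr_ge0 ?invr_ge0 ?exprn_ge0 ?normc_ge0 ?ltW.
(* The last entry gives 2 (C+1) y <= |a_n|, which is incompatible with |a_n| <= C y. *)
pose y := Num.min (Num.min (e / 2) (t / 2)) (normc (a n) / (2 * (C + 1))).
have y0 : 0 < y by rewrite /y !lt_min !divr_gt0 //= mulr_gt0 // ltr_wpDl.
have ye : y < e by rewrite /y !gt_min (_ : e / 2 < e) //; lra.
have yt : y < t by rewrite /y !gt_min (_ : t / 2 < t) ?orbT //; lra.
have := key y; rewrite y0 ye yt => /(_ isT isT).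
have : y * (2 * (C + 1)) <= normc (a n).
  rewrite -ler_pdivlMr ?mulr_gt0 // ?ltr_wpDl //.
  by rewrite /y ge_min lexx orbT.
by nra.
Qed.

(** The identity theorem for two series with different centres: the difference of the re-expansions
    vanishes on a short real segment. *)
Lemma taylor_ident a b rho rho' w w' g g' e :
  radius_ge a rho -> radius_ge b rho' -> normc w < rho -> normc w' < rho' ->
  taylor_at a w g -> taylor_at b w' g' -> 0 < e ->
  (forall y : R, 0 < y < e -> exists S,
     has_sum (fun n => a n * (w + y%:C) ^+ n) S /\
     has_sum (fun n => b n * (w' + y%:C) ^+ n) S) ->
  g =1 g'.
Proof.
move=> ra rb wr wr' ag bg e0 h.
pose d k := g k - g' k.
pose m := Num.min (rho - normc w) (rho' - normc w').
have m0 : 0 < m by rewrite /m lt_min !subr_gt0 wr.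
have rd : radius_ge d m.
  move=> r /andP[r0 rm].
  have [|M hM] := taylor_radius ra wr ag (r := r).
    by rewrite r0 /= (lt_le_trans rm) // /m ge_min lexx.
  have [|M' hM'] := taylor_radius rb wr' bg (r := r).
    by rewrite r0 /= (lt_le_trans rm) // /m ge_min lexx orbT.
  exists (M + M') => n; apply: le_trans (lerD (hM n) (hM' n)).
  rewrite -mulrDl ler_wpM2r ?exprn_ge0 //.
  by apply: le_trans (le_normcD _ _) _; rewrite normcN.
move=> k; apply/eqP; rewrite -subr_eq0; apply/eqP.
apply: (powerseries_eq0 (e := Num.min e m) m0 rd) => [|y].
  by rewrite lt_min e0.
rewrite lt_min => /and3P[y0 ye ym].
have [|S [S1 S2]] := h y; first by rewrite y0.
have ny : normc (y%:C : K) = y by rewrite normc_real gtr0_norm.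
have [|T [T1 T2]] := taylor_has_sum ra ag (y := y%:C).
  by rewrite ny -ltrBrDl (lt_le_trans ym) // /m ge_min lexx.
have [|U [U1 U2]] := taylor_has_sum rb bg (y := y%:C).
  by rewrite ny -ltrBrDl (lt_le_trans ym) // /m ge_min lexx orbT.
have ST := has_sum_unique S1 T1; have SU := has_sum_unique S2 U1.
rewrite -ST in T2; rewrite -SU in U2.
have := has_sumB T2 U2; rewrite subrr.
by apply: eq_has_sum => n; rewrite /d mulrBl.
Qed.

(** Both sequences expand the same function about w + w', so the identity theorem replaces a
    computation with binomial coefficients. The condition |w| + |w'| < rho keeps the intermediate
    disc inside the original one. *)
Lemma taylor_comp a rho w w' g g' g'' :
  radius_ge a rho -> normc w + normc w' < rho ->
  taylor_at a w g -> taylor_at g w' g' -> taylor_at a (w + w') g'' -> g' =1 g''.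
Proof.
move=> ra ww ag gg' ag''.
have wr : normc w < rho by apply: le_lt_trans ww; rewrite lerDl normc_ge0.
have rg := taylor_radius ra wr ag.
have wr' : normc w' < rho - normc w by rewrite ltrBrDl.
have wwr : normc (w + w') < rho by apply: le_lt_trans ww; exact: le_normcD.
apply: (taylor_ident (e := rho - normc w - normc w') rg ra wr' wwr gg' ag'').
  by rewrite subr_gt0.
move=> y /andP[y0 yr].
have [|S [S1 S2]] := taylor_has_sum ra ag (y := w' + y%:C).
  have := le_normcD w' y%:C; rewrite normc_real gtr0_norm //; lra.
by exists S; split; [exact: S2 | rewrite -addrA; exact: S1].
Qed.

End PowerSeries.

(** * Binomial series *)

Section Binomial.
Variable R : realType.
Local Notation K := R[i].

Lemma bounded_has_sum_real (I : choiceType) (u : I -> R) M :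
  bounded_sums (fun i => `|u i|) M -> exists s : R, has_sum (fun i => (u i)%:C) s%:C.
Proof.
move=> uM; have [s hs] := has_sum_ge0 (fun i => normr_ge0 (u i)) uM.
have [||t ht] := @has_sum_ge0 R I (fun i => u i + `|u i|) (2 * M).
- by move=> i; have := ler_norm (- u i); rewrite normrN; lra.
- apply: bounded_sums_le (bounded_sumsZ (ler0n _ 2) uM) => i.
  by have := ler_norm (u i); lra.
exists (t - s); rewrite rmorphB; apply: eq_has_sum (has_sumB ht hs) => i.
by rewrite -rmorphB addrK.
Qed.

Lemma has_sum_series (u : nat -> R) (s : R) :
  has_sum (fun i => (u i)%:C) s%:C -> series u @ \oo --> s.
Proof.
move=> /has_sumP h; apply/cvgrPdist_lt => e e0.
have [A hA] := h e e0.
exists (\max_(i <- A) i).+1 => // N /= hN.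
have := hA [fset i in iota 0 N]%fset; rewrite big_imfset //= undup_id ?iota_uniq //.
have -> : iota 0 N = index_iota 0 N by rewrite /index_iota subn0.
rewrite -rmorph_sum -rmorphB normc_real distrC; apply.
apply/fsubsetP => i iA; apply/imfsetP; exists i => //=.
rewrite mem_index_iota /=; apply: leq_trans hN; rewrite ltnS.
exact: (@leq_bigmax_seq _ _ xpredT id).
Qed.

Definition rbinom (x : R) (i : nat) : R := (\prod_(j < i) (x - j%:R)) / i`!%:R.

Lemma rbinom0 x : rbinom x 0 = 1.
Proof. by rewrite /rbinom big_ord0 fact0 invr1 mulr1. Qed.

Lemma rbinomS x i : i.+1%:R * rbinom x i.+1 = (x - i%:R) * rbinom x i.
Proof.
rewrite /rbinom big_ord_recr /= factS natrM invfM.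
have h1 : i.+1%:R != 0 :> R by rewrite pnatr_eq0.
have h2 : i`!%:R != 0 :> R by rewrite pnatr_eq0 -lt0n fact_gt0.
move: (i.+1%:R : R) (i`!%:R : R) h1 h2 => p q h1 h2.
by field; rewrite h1 h2.
Qed.

Lemma rbinom_pascal x i : rbinom (x + 1) i.+1 = rbinom x i.+1 + rbinom x i.
Proof.
elim: i => [|i IH].
  have := rbinomS x 0; have := rbinomS (x + 1) 0.
  by rewrite !rbinom0; lra.
have h : i.+2%:R != 0 :> R by rewrite pnatr_eq0.
apply: (mulfI h); rewrite rbinomS IH [RHS]mulrDr (rbinomS x i.+1).
have E1 : i.+1%:R = i%:R + 1 :> R by rewrite -addn1 natrD.
have E2 : i.+2%:R = i%:R + 2 :> R by rewrite -addn2 natrD.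
have := rbinomS x i; rewrite E1 E2.
by move: (rbinom x i) (rbinom x i.+1) => p q e; lra.
Qed.

Lemma rbinom_radius x : radius_ge (fun i => (rbinom x i)%:C) 1.
Proof.
move=> t; rewrite le_eqVlt => /andP[/predU1P[<- _|t0 t1]].
  exists `|rbinom x 0| => n; rewrite normc_real expr0n.
  by case: n => [|n]; rewrite ?mulr1 // mulr0.
pose u n := `|rbinom x n| * t ^+ n.
have [i0 hi0] : exists i0 : nat, forall i, (i0 <= i)%N -> u i.+1 <= u i.
  (* Beyond z the terms decrease: i > z means |x| t < i (1-t), so |x-i| t <= (|x|+i) t < i+1. *)
  pose z := `|x| * t / (1 - t).
  have z0 : 0 <= z by rewrite divr_ge0 ?mulr_ge0 ?subr_ge0 // ltW.
  exists (Num.bound z) => i hi.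
  have zi : z < i%:R.
    by apply: lt_le_trans (archi_boundP z0) _; rewrite ler_nat.
  rewrite /u exprS mulrA.
  rewrite ler_wpM2r ?exprn_ge0 ?(ltW t0) //.
  have i1 : 0 < i.+1%:R :> R by rewrite ltr0n.
  rewrite -(ler_pM2l i1) mulrA -{1}(gtr0_norm i1) -normrM rbinomS normrM.
  rewrite mulrAC; apply: ler_wpM2r => //.
  have : `|x - i%:R| <= `|x| + i%:R.
    by apply: le_trans (ler_normB _ _) _; rewrite (ger0_norm (ler0n _ i)).
  move: zi; rewrite /z ltr_pdivrMr ?subr_gt0 // -addn1 natrD => zi le1.
  have := ler_wpM2r (ltW t0) le1; lra.
pose M := \sum_(i < i0.+1) u i.
have u0 i : 0 <= u i by rewrite mulr_ge0 ?exprn_ge0 // ltW.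
exists M => n; rewrite normc_real -/(u n).
have small i : (i <= i0)%N -> u i <= M.
  move=> ii; rewrite /M (bigD1 (Ordinal (ii : (i < i0.+1)%N))) //=.
  by rewrite lerDl sumr_ge0.
have [/small //|ni] := leqP n i0.
elim: n ni => // n IH; rewrite ltnS leq_eqVlt => /predU1P[<-|ni].
  by apply: le_trans (hi0 _ (leqnn _)) _; exact: small.
by apply: le_trans (hi0 _ (ltnW ni)) (IH ni).
Qed.

(** Differentiation costs nothing: (n+1) r^n (t-r) <= t^(n+1) - r^(n+1) for r < t, so the factor n+1
    is absorbed by moving to a radius t below rho. *)
Lemma radius_ge_shift (a : nat -> K) rho : 0 < rho -> radius_ge a rho ->
  radius_ge (fun i => i.+1%:R * a i.+1) rho.
Proof.
move=> rho0 ra r /andP[r0 rr].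
pose t := (r + rho) / 2.
have rt : r < t by rewrite /t; lra.
have tr : t < rho by rewrite /t; lra.
have t0 : 0 < t by lra.
have [|M hM] := ra t; first by rewrite ltW.
have M0 : 0 <= M by apply: le_trans (hM 0%N); rewrite expr0 mulr1 normc_ge0.
exists (M / (t - r)) => n; rewrite normcM normc_nat.
rewrite ler_pdivlMr ?subr_gt0 //.
suff h : n.+1%:R * r ^+ n * (t - r) <= t ^+ n.+1.
  apply: le_trans (hM n.+1).
  have := ler_wpM2l (normc_ge0 (a n.+1)) h; rewrite mulrA; lra.
have : n.+1%:R * r ^+ n * (t - r) <= t ^+ n.+1 - r ^+ n.+1.
  rewrite subrXX mulrC ler_wpM2l ?subr_ge0 ?(ltW rt) //.
  rewrite -[n.+1 in leLHS]card_ord -sum1_card natr_sum mulr_suml.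
  apply: ler_sum => i _; rewrite mul1r /=.
  rewrite -[in leLHS](subnK (ltn_ord i : (i <= n)%N)) exprD.
  rewrite ler_wpM2r ?exprn_ge0 // lerXn2r ?nnegrE // ltW //.
by move/le_trans; apply; rewrite lerBlDr lerDl exprn_ge0.
Qed.

Lemma powerseries_limn (c : nat -> R) (x : R) :
  radius_ge (fun i => (c i)%:C) 1 -> `|x| < 1 ->
  has_sum (fun i => (c i * x ^+ i)%:C) (limn (pseries c x))%:C /\
  cvgn (pseries c x).
Proof.
move=> cr x1; have [|M hM] := radius_ge_bounded cr (r := `|x|).
  by rewrite normr_ge0.
have [|s hs] := @bounded_has_sum_real _ (fun i => c i * x ^+ i) M.
  by apply: bounded_sums_le hM => i; rewrite normrM normrX normc_real.
have cs : pseries c x @ \oo --> s by exact: has_sum_series hs.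
by rewrite (cvg_lim _ cs) //; split => //; apply/cvg_ex; exists s.
Qed.

Lemma radius_ge_diffs (c : nat -> R) :
  radius_ge (fun i => (c i)%:C) 1 -> radius_ge (fun i => (pseries_diffs c i)%:C) 1.
Proof.
move=> /(radius_ge_shift ltr01) h r /h[M hM]; exists M => n.
by rewrite /pseries_diffs rmorphM rmorph_nat.
Qed.

Lemma zero_derive_const (h : R -> R) (x : R) :
  (forall y : R, `|y| < 1 -> is_derive y 1 h 0) -> `|x| < 1 -> h x = h 0.
Proof.
move=> dh x1.
have key a b : a <= b -> `|a| < 1 -> `|b| < 1 -> h a = h b.
  move=> ab; rewrite !ltr_norml => /andP[a1 a2] /andP[b1 b2].
  have in1 y : y \in `[a, b] -> `|y| < 1.
    rewrite in_itv /= => /andP[ay yb]; rewrite ltr_norml.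
    by rewrite (lt_le_trans a1 ay) (le_lt_trans yb b2).
  have [||y _ /eqP] := @MVT_segment R h (fun=> 0) a b ab.
  - move=> y yab; apply: dh; apply: in1.
    by move: yab; rewrite !in_itv /= => /andP[/ltW -> /ltW ->].
  - by apply: derivable_within_continuous => y /in1 /dh [].
  by rewrite mul0r subr_eq0 => /eqP.
have n0 : `|0 : R| < 1 by rewrite normr0.
by case: (leP x 0) => [x0|/ltW x0]; [|symmetry]; exact: key.
Qed.

(** The sum f of the series satisfies (1+z) f' = x f, by the recursion of the coefficients. So f(z)
    (1+z)^(-x) has derivative 0 and keeps its value 1 at z = 0. Real exponents are needed because
    weights are real. *)
Lemma binomial_series (x y : R) : `|y| < 1 ->
  has_sum (fun i => (rbinom x i * y ^+ i)%:C) ((1 + y) `^ x)%:C.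
Proof.
pose c := rbinom x; pose f := fun z => limn (pseries c z).
pose df := fun z => limn (pseries (pseries_diffs c) z).
have rc : radius_ge (fun i => (c i)%:C) 1 by exact: rbinom_radius.
have rd := radius_ge_diffs rc; have rdd := radius_ge_diffs rd.
have dfE (z : R) : `|z| < 1 -> is_derive z 1 f (df z).
  move=> z1; pose t := (1 + `|z|) / 2.
  have [t1 zt] : `|t| < 1 /\ `|z| < `|t|.
    have z0 := normr_ge0 z; have t0 : 0 <= t by rewrite /t; lra.
    by rewrite (ger0_norm t0) /t; lra.
  apply: (@pseries_snd_diffs R c t z) => //.
  - exact: (powerseries_limn rc t1).2.
  - exact: (powerseries_limn rd t1).2.
  - exact: (powerseries_limn rdd t1).2.
have ode (z : R) : `|z| < 1 -> (1 + z) * df z = x * f z.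
  move=> z1.
  have [h1 _] := powerseries_limn rc z1; have [h2 _] := powerseries_limn rd z1.
  have h3 : has_sum (fun i => (i%:R * c i * z ^+ i)%:C) (z * df z)%:C.
    apply/(@has_sum_reindex _ _ _ succn) => [i j [] //|j jn|].
      case: j jn => [|j] jn; first by rewrite !mul0r.
      by have := jn j.
    rewrite rmorphM; apply: eq_has_sum (has_sumZ z%:C h2) => i.
    by rewrite -rmorphM /pseries_diffs exprS; congr real_complex_def; ring.
  have h4 := has_sumD h2 h3.
  have h5 := has_sumZ x%:C h1.
  apply/complexI; rewrite mulrDl mul1r rmorphD [RHS]rmorphM.
  apply: has_sum_unique h4 _; apply: eq_has_sum h5 => i.
  rewrite -rmorphM -rmorphD; congr real_complex_def.
  by rewrite /pseries_diffs /c rbinomS; ring.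
pose h := fun z => f z * (1 + z) `^ (- x).
have dh (z : R) : `|z| < 1 -> is_derive z 1 h 0.
  move=> z1.
  have z0 : 0 < 1 + z by move: z1; rewrite ltr_norml; lra.
  have d1 := dfE z z1.
  have d2 : is_derive z 1 (fun t => (1 + t) `^ (- x)) (- x * (1 + z) `^ (- x - 1)).
    have d3 : is_derive z 1 (fun t : R => 1 + t) 1.
      have := is_deriveD (is_derive_cst (1 : R) z (1:R)) (is_derive_id z (1:R)).
      by rewrite add0r.
    have d4 := is_derive1_powR (- x) z0.
    have := is_derive1_comp d4 d3.
    by rewrite mulr1.
  have := is_deriveM d1 d2.
  rewrite (_ : _ + _ = 0) //.
  rewrite /GRing.scale /=.
  have -> : (1 + z) `^ (- x) = (1 + z) * (1 + z) `^ (- x - 1).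
    rewrite -[X in X * _]powRr1 ?(ltW z0) // -powRD; last by apply/implyP => _; rewrite gt_eqF.
    by congr (_ `^ _); ring.
  have e := ode z z1.
  transitivity ((1 + z) `^ (- x - 1) * ((1 + z) * df z - x * f z)); first by ring.
  by rewrite e subrr mulr0.
move=> y1; have [h1 _] := powerseries_limn rc y1.
rewrite (_ : (1 + y) `^ x = f y) //.
have := zero_derive_const dh y1.
rewrite /h.
have -> : f 0 = 1.
  have [|h0 _] := @powerseries_limn c 0 rc; first by rewrite normr0.
  apply/complexI; apply: has_sum_unique h0 _.
  have := @has_sum_nat_fin _ (fun i => (c i * 0 ^+ i)%:C) 1.
  rewrite big_ord_recl big_ord0 /= expr0 /c rbinom0 mulr1 addr0; apply.
  by case=> // k _; rewrite expr0n mulr0.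
rewrite addr0 powR1 mulr1 powRN => e.
have p0 : (1 + y) `^ x != 0.
  by rewrite gt_eqF // powR_gt0 //; move: y1; rewrite ltr_norml; lra.
by apply: (mulIf (invr_neq0 p0)); rewrite e divff.
Qed.

End Binomial.

(** * Laurent series *)

Section Laurent.
Variable R : realType.
Local Notation K := R[i].

Lemma cbinomE (a : int) i : cbinom K a i = (rbinom (a%:~R : R) i)%:C.
Proof.
rewrite /cbinom /rbinom rmorphM rmorph_prod fmorphV rmorph_nat.
by congr (_ * _); apply: eq_bigr => j _; rewrite rmorphB rmorph_int rmorph_nat.
Qed.

Lemma cbinom_nat (n i : nat) : cbinom K n i = 'C(n, i)%:R.
Proof.
rewrite cbinomE -(rmorph_nat (real_complex R)); congr real_complex_def.
elim: n i => [|n IH] [|i]; rewrite ?rbinom0 ?bin0 //.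
  rewrite bin_small // /rbinom big_ord_recl /= subrr !mul0r //.
by rewrite binS natrD -!IH -rbinom_pascal -[n.+1]addn1 PoszD rmorphD.
Qed.

Lemma cbinom0 a : cbinom K a 0 = 1.
Proof. by rewrite cbinomE rbinom0. Qed.

Lemma cbinom_pascal a i : cbinom K (a + 1) i.+1 = cbinom K a i.+1 + cbinom K a i.
Proof. by rewrite !cbinomE -rmorphD -rbinom_pascal rmorphD. Qed.

Lemma normr_rbinom_le0 (x : R) i : x <= 0 -> `|rbinom x i| = (-1) ^+ i * rbinom x i.
Proof.
move=> x0; rewrite /rbinom mulrA normrM.
have -> : (-1) ^+ i * \prod_(j < i) (x - j%:R) = \prod_(j < i) (j%:R - x).
  rewrite -[i in (-1) ^+ i]card_ord -prodr_const -big_split /=.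
  by apply: eq_bigr => j _; rewrite mulN1r opprB.
have p0 : 0 <= \prod_(j < i) (j%:R - x).
  by apply: prodr_ge0 => j _; have : 0 <= (j : nat)%:R :> R by []; lra.
rewrite normfV normr_prod (ger0_norm (ler0n _ _)); congr (_ / _).
apply: eq_bigr => j _; rewrite -normrN opprB ger0_norm //.
by have : 0 <= (j : nat)%:R :> R by []; lra.
Qed.

(** For x <= 0 the i-th coefficient has sign (-1)^i, so the series of absolute values at s is the
    binomial series at -s. *)
Lemma bounded_sums_rbinom_le0 (x s : R) : x <= 0 -> 0 <= s < 1 ->
  bounded_sums (fun i => `|rbinom x i| * s ^+ i) ((1 - s) `^ x).
Proof.
move=> x0 /andP[s0 s1].
have := @bounded_sums_has_sum _ _ (fun i => `|rbinom x i| * s ^+ i)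
  ((1 - s) `^ x)%:C.
rewrite normc_real ger0_norm ?powR_ge0 //; apply=> [i|].
  by rewrite mulr_ge0 // exprn_ge0.
have := @binomial_series _ x (- s); rewrite normrN ger0_norm // => /(_ s1).
apply: eq_has_sum => i; rewrite normr_rbinom_le0 // [(- s) ^+ i]exprNn.
by congr real_complex_def; ring.
Qed.

(** The first summand majorises the expansion of (1+y)^a for a >= 0, the second for a < 0. The sum
    serves both and matches the two boundary radii of an annulus. *)
Definition binom_bound (a : int) (s : R) := (1 + s) ^ a + (1 - s) ^ a.

Lemma bounded_sums_cbinom (a : int) (s : R) : 0 <= s < 1 ->
  bounded_sums (fun i => normc (cbinom K a i) * s ^+ i) (binom_bound a s).
Proof.
move=> /andP[s0 s1]; have [h1 h2] : 0 <= 1 + s /\ 0 <= 1 - s by lra.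
case: a => n; rewrite /binom_bound.
  have := @bounded_sums_binomial _ (1 : K) s n s0; rewrite normc1.
  have h B : \sum_(k <- B) normc ('C(n, k)%:R * 1 ^+ (n - k) : K) * s ^+ k =
     \sum_(k <- B) normc (cbinom K n k) * s ^+ k.
    by apply: eq_bigr => k _; rewrite expr1n mulr1 cbinom_nat.
  move=> hb B; rewrite -h; apply: le_trans (hb B) _.
  by rewrite -exprnP lerDl exprn_ge0.
have n0 : (Negz n)%:~R <= 0 :> R by rewrite lerz0.
have s01 : 0 <= s < 1 by rewrite s0.
move=> B; apply: le_trans (_ : (1 - s) `^ (Negz n)%:~R <= _).
  apply: le_trans (bounded_sums_rbinom_le0 n0 s01 B).
  by apply: ler_sum => i _; rewrite cbinomE normc_real.
by rewrite powR_intmul // lerDr exprz_ge0.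
Qed.

Lemma has_sum_cbinomS (a : int) (y s : K) :
  has_sum (fun i => cbinom K a i * y ^+ i) s ->
  has_sum (fun i => cbinom K (a + 1) i * y ^+ i) ((1 + y) * s).
Proof.
move=> hs; rewrite mulrDl mul1r.
pose f i := if i is j.+1 then cbinom K a j * y ^+ i else 0.
have hf : has_sum f (y * s).
  apply/(@has_sum_reindex _ _ _ succn) => [i j [] //|[|j] jn //|].
    by have := jn j.
  by apply: eq_has_sum (has_sumZ y hs) => i; rewrite /f exprS; ring.
apply: eq_has_sum (has_sumD hs hf) => -[|i]; rewrite /f.
  by rewrite !cbinom0 addr0.
by rewrite cbinom_pascal mulrDl.
Qed.

(** For negative a the series converges to some s. Multiplying by 1+y raises the exponent by one
    (Pascal's rule), so enough factors lead to exponent 0 and sum 1, which determines s. *)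
Lemma has_sum_cbinom (a : int) (y : K) : normc y < 1 ->
  has_sum (fun i => cbinom K a i * y ^+ i) ((1 + y) ^ a).
Proof.
move=> y1.
have h0 : has_sum (fun i => cbinom K 0 i * y ^+ i) 1.
  have := @has_sum_nat_fin _ (fun i => cbinom K 0 i * y ^+ i) 1.
  rewrite big_ord_recl big_ord0 addr0 cbinom0 mul1r; apply.
  by case=> // k _; rewrite (cbinom_nat 0) bin0n mul0r.
have hn n b s : has_sum (fun i => cbinom K b i * y ^+ i) s ->
    has_sum (fun i => cbinom K (b + n%:Z) i * y ^+ i) ((1 + y) ^+ n * s).
  move=> hs; elim: n => [|n IH]; first by rewrite addr0 expr0 mul1r.
  rewrite -[n.+1]addn1 PoszD addrA addn1 exprS -mulrA.
  exact: has_sum_cbinomS.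
case: a => n; first by have := hn n _ _ h0; rewrite add0r mulr1.
have [|s hs] := @bounded_has_sum _ _ (fun i => cbinom K (Negz n) i * y ^+ i)
    (binom_bound (Negz n) (normc y)).
  move=> B; have := @bounded_sums_cbinom (Negz n) (normc y).
  rewrite normc_ge0 y1 => /(_ isT B); apply: le_trans.
  by apply: ler_sum => i _; rewrite normcM normcX.
have := hn n.+1 _ _ hs; rewrite NegzE addNr => h1.
have := has_sum_unique h0 h1 => e.
have y0 : 1 + y != 0.
  apply/negP => /eqP y0; have := normcN y.
  by have -> : - y = 1 by [apply/eqP; rewrite -subr_eq0 -opprD oppr_eq0 addrC y0]; rewrite normc1; lra.
rewrite -exprnN.
have -> : (1 + y) ^- n.+1 = s.
  apply: (mulfI (expf_neq0 n.+1 y0)); rewrite -e divff //.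
  exact: expf_neq0.
rewrite -NegzE; exact: hs.
Qed.

Lemma sqrtc_Re_ge0 (z : K) : 0 <= complex.Re (sqrtc z).
Proof. by case: z => a b /=; rewrite sqrtr_ge0. Qed.

(** Iterated principal square roots of -1. The power 2^m of this number is -1, which makes it a
    primitive root of order 2^(m+1); the non-negative real part of each square root makes the
    sequence tend to 1. *)
Fixpoint dyadic_root (m : nat) : K :=
  if m is m'.+1 then sqrtc (dyadic_root m') else -1.

Lemma dyadic_rootX m : dyadic_root m ^+ (2 ^ m) = -1.
Proof.
elim: m => [|m IH]; first by rewrite expn0 expr1.
by rewrite expnS exprM /= sqr_sqrtc.
Qed.

Lemma dyadic_root_primitive m : (2 ^ m.+1).-primitive_root (dyadic_root m).
Proof.
have e : dyadic_root m ^+ (2 ^ m.+1) = 1.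
  by rewrite expnSr exprM dyadic_rootX sqrrN expr1n.
have n0 : (0 < 2 ^ m.+1)%N by rewrite expn_gt0.
have [d dp /dvdn_pfactor] := prim_order_exists n0 e.
case=> // k; rewrite leq_eqVlt => /predU1P[-> <- //|km dk].
have : dyadic_root m ^+ (2 ^ m) = 1.
  by rewrite (expr_dvd (prim_expr_order dp)) // dk dvdn_exp2l.
rewrite dyadic_rootX => /eqP; rewrite -subr_eq0 -opprD oppr_eq0.
by rewrite -(natrD _ 1 1) pnatr_eq0.
Qed.

Lemma normc_root1 (z : K) n : (0 < n)%N -> z ^+ n = 1 -> normc z = 1.
Proof.
move=> n0 zn; apply/eqP.
by rewrite -(@pexpr_eq1 _ _ n) ?normc_ge0 // -normcX zn normc1.
Qed.

Lemma normc_dyadic_root m : normc (dyadic_root m) = 1.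
Proof.
apply: (normc_root1 (n := 2 ^ m.+1)); first by rewrite expn_gt0.
exact: prim_expr_order (dyadic_root_primitive m).
Qed.

Lemma normc_sqr (z : K) :
  normc z ^+ 2 = complex.Re z ^+ 2 + complex.Im z ^+ 2.
Proof. by case: z => a b /=; rewrite sqr_sqrtr // addr_ge0 ?sqr_ge0. Qed.

(** If |w| = 1 and Re w >= 0, then |w+1|^2 = 2 + 2 Re w >= 2. So |w-1|^2 is at most half of
    |w^2-1|^2, and each square root halves the squared distance to 1. *)
Lemma dyadic_root_dist m : normc (dyadic_root m - 1) ^+ 2 * 2 ^+ m <= 4.
Proof.
elim: m => [|m IH].
  by rewrite expr0 mulr1 normc_sqr /= subr0 oppr0 expr0n addr0; lra.
apply: le_trans IH; rewrite [in 2 ^+ m.+1]exprS mulrA ler_wpM2r ?exprn_ge0 //.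
have E : dyadic_root m = dyadic_root m.+1 ^+ 2 by rewrite /= sqr_sqrtc.
rewrite [in leRHS]E.
have := normc_dyadic_root m.+1; have := sqrtc_Re_ge0 (dyadic_root m).
rewrite -/(dyadic_root m.+1).
move: (dyadic_root m.+1) {E} => w Re0 w1.
rewrite subr_sqr_1 normcM exprMn ler_wpM2l ?exprn_ge0 ?normc_ge0 //.
have := normc_sqr w; rewrite w1 normc_sqr.
case: w Re0 {w1} => a b /= a0 e.
have -> : (a + 1) ^+ 2 + (b + 0) ^+ 2 = (a ^+ 2 + b ^+ 2) + 2 * a + 1 by ring.
by rewrite -e; lra.
Qed.

Lemma dyadic_root_near1 (e : R) : 0 < e ->
  exists m0, forall m, (m0 <= m)%N -> normc (dyadic_root m - 1) < e.
Proof.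
move=> e0; exists (Num.bound (4 / e ^+ 2)) => m hm.
have e2 : 0 < e ^+ 2 by rewrite exprn_gt0.
have h : 4 < 2 ^+ m * e ^+ 2.
  rewrite -ltr_pdivrMr //; apply: lt_le_trans (archi_boundP _) _.
    by rewrite divr_ge0 // ltW.
  apply: le_trans (_ : m%:R <= _); first by rewrite ler_nat.
  by rewrite -natrX ler_nat ltnW // ltn_expl.
have := le_lt_trans (dyadic_root_dist m) h.
rewrite mulrC ltr_pM2l ?exprn_gt0 // ltr_pXn2r ?nnegrE ?normc_ge0 //.
exact: ltW.
Qed.

Lemma sum_root_powers (q : K) (N : nat) : q ^+ N = 1 ->
  \sum_(j < N) q ^+ j = if q == 1 then N%:R else 0.
Proof.
move=> qN; case: eqP => [->|/eqP q1].
  by under eq_bigr do rewrite expr1n; rewrite sumr_const card_ord.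
apply: (mulfI (x := q - 1)); first by rewrite subr_eq0.
by rewrite -subrX1 qN subrr mulr0.
Qed.

(* Averaging over the N-th roots of unity isolates the coefficients whose index
   is congruent to [n] modulo N; those other than [d n] are negligible for
   large N. *)
Lemma discrete_cauchy (d : int -> K) (M C : R) (n : int) : 0 <= C ->
  bounded_sums (fun k => normc (d k)) M ->
  (forall N0, exists N w, [/\ (N0 <= N)%N, N.-primitive_root w &
     forall j : nat, exists S, has_sum (fun k => d k * (w ^+ j) ^ k) S /\
                               normc S <= C]) ->
  normc (d n) <= C.
Proof.
move=> C0 dM H; apply/ler_addgt0Pr => e e0.
have [s hs] := has_sum_ge0 (fun k => normc_ge0 (d k)) dM.
have /has_sumP/(_ _ e0)[A hA] := hs.
pose g k := if k \in A then 0 else normc (d k).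
have gM : bounded_sums g e.
  have hg : has_sum (fun k => (g k)%:C) (s%:C - \sum_(k <- A) (normc (d k))%:C).
    pose f k := if k \in A then (normc (d k))%:C else 0.
    have hf : has_sum f (\sum_(k <- A) f k).
      by apply: has_sum_supp => k; rewrite /f => /negbTE ->.
    have -> : \sum_(k <- A) (normc (d k))%:C = \sum_(k <- A) f k.
      by rewrite big_seq [RHS]big_seq; apply: eq_bigr => k kA; rewrite /f kA.
    apply: eq_has_sum (has_sumB hs hf) => k; rewrite /f /g.
    by case: ifP => _; rewrite ?subrr ?subr0.
  move=> B; apply: le_trans (bounded_sums_has_sum _ hg B) _.
    by move=> k; rewrite /g; case: ifP => // _; exact: normc_ge0.
  by rewrite normc_distC ltW //; exact: hA.
(* For N >= N0 no element of [A] other than n is congruent to n modulo N; the indices outside [A]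
   contribute at most e in total. *)
have [N0 hN0] : exists N0, forall k, k \in A -> (`|k - n| < N0)%N.
  exists (\max_(k <- A) `|k - n|%N).+1 => k kA; rewrite ltnS.
  exact: (@leq_bigmax_seq _ _ xpredT (fun k => `|k - n|%N)).
have [N [w [NN wN hw]]] := H N0.
have N_gt0 := prim_order_gt0 wN.
have w1 : normc w = 1 := normc_root1 N_gt0 (prim_expr_order wN).
have w0 : w != 0 by rewrite -normc_eq0 w1 oner_eq0.
have [S hS] : {S : nat -> K | forall j,
    has_sum (fun k => d k * (w ^+ j) ^ k) (S j) /\ normc (S j) <= C}.
  by exists (fun j => sval (cid (hw j))) => j; exact: (svalP (cid (hw j))).
pose T := \sum_(j < N) (w ^+ j) ^ (- n) * S j.
have hT : has_sum (fun k => d k * (if w ^ (k - n) == 1 then N%:R else 0)) T.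
  have := @has_sum_bigsum _ _ _ (index_enum 'I_N)
    (fun j k => (w ^+ (j : 'I_N)) ^ (- n) * (d k * (w ^+ j) ^ k))
    (fun j => (w ^+ (j : 'I_N)) ^ (- n) * S j)
    (fun j => has_sumZ ((w ^+ j) ^ (- n)) (hS j).1).
  apply: eq_has_sum => k; rewrite -sum_root_powers; last first.
    by rewrite exprnP exprzAC -exprnP (prim_expr_order wN) exp1rz.
  rewrite mulr_sumr; apply: eq_bigr => j _.
  rewrite mulrCA; congr (_ * _).
  by rewrite -expfzDr ?expf_neq0 // addrC !exprnP exprzAC.
have TC : normc T <= N%:R * C.
  apply: le_trans (normc_sum _ _) _.
  rewrite -[N in N%:R]card_ord -sum1_card natr_sum mulr_suml.
  apply: ler_sum => j _; rewrite mul1r normcM.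
  rewrite (_ : normc ((w ^+ j) ^ (- n)) = 1) ?mul1r; first exact: (hS j).2.
  apply: (normc_root1 N_gt0).
  by rewrite [LHS]exprnP exprzAC -exprnP exprAC (prim_expr_order wN) expr1n exp1rz.
have N0' : (N%:R : R) != 0 by rewrite pnatr_eq0 -lt0n.
have hn : has_sum (fun k => if k == n then N%:R * d n else 0) (N%:R * d n).
  have := @has_sum_supp R int (fun k => if k == n then N%:R * d n else 0)
    [fset n]%fset; rewrite big_seq_fset1 eqxx; apply.
  by move=> i; rewrite !inE => /negbTE ->.
have hd := has_sumB hT hn.
have := @has_sum_normc_le _ _ _ _ (N%:R * e) hd.
have bd : bounded_sums (fun k => normc (d k * (if w ^ (k - n) == 1 then N%:R else 0) -
    (if k == n then N%:R * d n else 0))) (N%:R * e).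
  apply: bounded_sums_le (bounded_sumsZ (ler0n _ N) gM) => k.
  have [->|kn] := eqVneq k n.
    rewrite subrr expr0z eqxx mulrC subrr normc0 mulr_ge0 //.
    by rewrite /g; case: ifP => // _; exact: normc_ge0.
  rewrite subr0 /g; case: (boolP (k \in A)) => [kA|_]; last first.
    by case: ifP => _; rewrite ?mulr0 ?normc0 ?mulr_ge0 ?normc_ge0 // normcM
      normc_nat mulrC.
  suff -> : (w ^ (k - n) == 1) = false by rewrite !mulr0 normc0.
  apply/negP => /eqP wkn.
  have : w ^+ `|k - n|%N = 1.
    case: (k - n) wkn => m; first by rewrite -exprnP absz_nat.
    by rewrite NegzE -exprnN abszN => /eqP; rewrite invr_eq1 => /eqP.
  move=> /eqP; rewrite -[1](expr0 w) (eq_prim_root_expr wN) mod0n.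
  rewrite modn_small; first by rewrite absz_eq0 subr_eq0 (negbTE kn).
  exact: leq_trans (hN0 k kA) NN.
move=> /(_ bd) h.
have Np : 0 < N%:R :> R by rewrite ltr0n.
rewrite -(ler_pM2l Np) -{1}(normc_nat R N) -normcM mulrDr.
have := le_normcD (N%:R * d n - T) T; rewrite subrK normc_distC.
lra.
Qed.

End Laurent.

(** * Uniqueness of Laurent expansions from a real segment *)

Section LaurentUnique.
Variable R : realType.
Local Notation K := R[i].

(** Each (1+y)^k is expanded in powers of y. The resulting power series vanishes on a real segment,
    hence identically, and so does the Laurent series on the whole disc |y| <= s. *)
Lemma laurent_local_zero (D : int -> K) (s M e : R) : 0 < s < 1 -> 0 < e ->
  bounded_sums (fun k => normc (D k) * binom_bound k s) M ->
  (forall y : R, 0 < y < e -> has_sum (fun k => D k * (1 + y%:C) ^ k) 0) ->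
  forall y : K, normc y <= s -> has_sum (fun k => D k * (1 + y) ^ k) 0.
Proof.
move=> /andP[s0 s1] e0 DM h y ys.
have s01 : 0 <= s < 1 by rewrite (ltW s0).
have cb k := bounded_sums_cbinom k s01.
have [g hg] := reexpand_coef_ex cb DM s0.
have ev (z : K) : normc z <= s ->
    exists S, has_sum (fun k => D k * (1 + z) ^ k) S /\
              has_sum (fun i => g i * z ^+ i) S.
  move=> zs; apply: (reexpand_has_sum (phi := fun k => (1 + z) ^ k) cb DM zs _ hg).
  by move=> k; apply: has_sum_cbinom; exact: le_lt_trans s1.
have g0 : forall i, g i = 0.
  apply: (@powerseries_eq0 _ g s (Num.min e s) s0) => [r /andP[r0 rs]||z].
  - exists M => n; apply: le_trans (reexpand_coef_le cb DM s0 (hg n)).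
    by rewrite ler_wpM2l ?normc_ge0 // lerXn2r ?nnegrE // ltW.
  - by rewrite lt_min e0.
  - rewrite lt_min => /and3P[z0 ze zs].
    have [|S [S1 S2]] := ev z%:C; first by rewrite normc_real gtr0_norm // ltW.
    have -> : 0 = S by apply: has_sum_unique (h z _) S1; rewrite z0.
    exact: S2.
have [S [S1 S2]] := ev y ys.
suff -> : 0 = S by exact: S1.
apply: has_sum_unique S2; apply: eq_has_sum (@has_sum0 R nat) => i.
by rewrite g0 mul0r.
Qed.

(** Vanishing spreads from the real axis around the circle |z| = x0 through a chain of overlapping
    discs, whose centres differ by a dyadic root of unity close to 1. The discrete Cauchy estimate
    with bound 0 then kills every coefficient. *)
Lemma laurent_eq0 (d : int -> K) (x1 x2 M1 M2 : R) : 0 < x1 -> x1 < x2 ->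
  bounded_sums (fun k => normc (d k) * x1 ^ k) M1 ->
  bounded_sums (fun k => normc (d k) * x2 ^ k) M2 ->
  (forall x : R, x1 < x < x2 -> has_sum (fun k => d k * x%:C ^ k) 0) ->
  forall k, d k = 0.
Proof.
move=> x10 x12 b1 b2 h.
(* The disc x0 xi (1+y), |y| <= s, just fits the annulus, as x0 (1-s) = x1 and x0 (1+s) = x2. *)
pose x0 := (x1 + x2) / 2; pose s := (x2 - x1) / (x1 + x2).
have x00 : 0 < x0 by rewrite /x0; lra.
have p0 : 0 < x1 + x2 by lra.
have s0 : 0 < s < 1 by rewrite divr_gt0 ?subr_gt0 //= ltr_pdivrMr //; lra.
have e2 : x0 * (1 + s) = x2 by rewrite /x0 /s; field; rewrite gt_eqF.
have e1 : x0 * (1 - s) = x1 by rewrite /x0 /s; field; rewrite gt_eqF.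
pose D (xi : K) k := d k * (x0%:C * xi) ^ k.
have nexp (z : K) (k : int) : normc (z ^ k) = normc z ^ k.
  by case: k => n; [exact: normcX | rewrite NegzE -!exprnN normcV normcX].
have DM xi : normc xi = 1 ->
    bounded_sums (fun k => normc (D xi k) * binom_bound k s) (M2 + M1).
  move=> xi1; apply: bounded_sums_le (bounded_sumsD b2 b1) => k.
  rewrite /D normcM nexp normcM xi1 mulr1 normc_real gtr0_norm // /binom_bound.
  by rewrite -mulrA mulrDr -!expfzMl e1 e2 mulrDr.
have x0C : x0%:C != 0 :> K by rewrite -normc_eq0 normc_real normr_eq0 gt_eqF.
pose V (xi : K) := forall y : K, normc y <= s ->
  has_sum (fun k => D xi k * (1 + y) ^ k) 0.
have V1 : V 1.
  apply: (laurent_local_zero (e := s) s0 _ (DM 1 (normc1 _))).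
    by case/andP: s0.
  move=> y /andP[y0 ys]; apply: eq_has_sum (h (x0 * (1 + y)) _) => [k|].
    by rewrite /D mulr1 -mulrA -expfzMl rmorphM rmorphD.
  by rewrite -e2 -e1 !ltr_pM2l //; lra.
(* A short radial segment about the new centre x0 xi w lies in the old disc, because w (1+y) - 1 =
   (w-1) + w y has norm at most |w-1| + y. *)
have step (xi w : K) : normc xi = 1 -> normc w = 1 -> normc (w - 1) < s ->
    V xi -> V (xi * w).
  move=> xi1 w1 ws Vxi.
  apply: (laurent_local_zero (e := s - normc (w - 1)) s0 _ (DM _ _)).
  - by rewrite subr_gt0.
  - by rewrite normcM xi1 w1 mulr1.
  move=> y /andP[y0 ys].
  apply: eq_has_sum (Vxi (w * (1 + y%:C) - 1) _) => [k|].
    rewrite /D -!mulrA -!expfzMl; have -> : 1 + (w * (1 + y%:C) - 1) = w * (1 + y%:C) by ring.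
    by rewrite !mulrA.
  have -> : w * (1 + y%:C) - 1 = (w - 1) + w * y%:C by ring.
  apply: le_trans (le_normcD _ _) _.
  by rewrite normcM w1 normc_real gtr0_norm //; lra.
have s0' : 0 < s by case/andP: s0.
have [m0 hm0] := dyadic_root_near1 s0'.
have bD1 : bounded_sums (fun k => normc (D 1 k)) (M2 + M1).
  apply: bounded_sums_le (DM 1 (normc1 _)) => k.
  rewrite ler_peMr ?normc_ge0 // /binom_bound.
  have /andP[t0 t1] := s0; have [u0 v0] : 0 < 1 + s /\ 0 < 1 - s by lra.
  case: k => n.
    apply: (@le_trans _ _ ((1 + s) ^ n)); last by rewrite lerDl exprz_ge0 // ltW.
    by rewrite -exprnP exprn_ege1 // lerDl ltW.
  apply: (@le_trans _ _ ((1 - s) ^ (Negz n))).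
    rewrite NegzE -exprnN invf_ge1 ?exprn_gt0 //.
    by rewrite exprn_ile1 //; lra.
  by rewrite lerDr exprz_ge0 // ltW.
have zero k : D 1 k = 0.
  apply/eqP; rewrite -normc_eq0 eq_le normc_ge0 andbT.
  apply: (@discrete_cauchy R (D 1) (M2 + M1) 0 k (lexx _) bD1) => N0.
  pose m := maxn m0 N0; exists (2 ^ m.+1)%N, (dyadic_root R m); split.
  - apply: leq_trans (leq_maxr m0 N0) _; apply: ltnW; apply: ltnW.
    exact: ltn_expl.
  - exact: dyadic_root_primitive.
  move=> j; exists 0; split; last by rewrite normc0.
  have nj i : normc (dyadic_root R m ^+ i) = 1.
    by rewrite normcX normc_dyadic_root expr1n.
  have : V (dyadic_root R m ^+ j).
    elim: j => [|j IH]; first by rewrite expr0.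
    rewrite exprSr; apply: step => //; first exact: normc_dyadic_root.
    by apply: hm0; exact: leq_maxl.
  move=> /(_ 0); rewrite normc0 => /(_ (ltW s0')).
  by apply: eq_has_sum => i; rewrite /D addr0 exp1rz mulr1 mulr1 expfzMl mulrA.
move=> k; apply/eqP; have := zero k; rewrite /D mulr1 => /eqP.
by rewrite mulf_eq0 expfz_eq0 (negbTE x0C) andbF orbF.
Qed.

End LaurentUnique.

(** * Continuation across the unit circle *)

Section Continuation.
Variable R : realType.
Local Notation K := R[i].

Lemma bounded_sums_image (I J : choiceType) (e : I -> J) (f : J -> R) M :
  injective e -> (forall j, 0 <= f j) -> (forall j, (forall i, j <> e i) -> f j = 0) ->
  bounded_sums (fun i => f (e i)) M -> exists M', bounded_sums f M'.
Proof.
move=> einj f0 fz fM; have [s hs] := has_sum_ge0 (fun i => f0 (e i)) fM.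
exists (normc (s%:C : K)); apply: bounded_sums_has_sum => //.
by apply/(@has_sum_reindex _ _ _ e) => // j /fz ->.
Qed.

Lemma cauchy_estimate (a : nat -> K) (M C : R) (n : nat) : 0 <= C ->
  bounded_sums (fun k => normc (a k)) M ->
  (forall xi : K, normc xi = 1 ->
     exists S, has_sum (fun k => a k * xi ^+ k) S /\ normc S <= C) ->
  normc (a n) <= C.
Proof.
move=> C0 aM h; pose d (k : int) := if k is Posz j then a j else 0.
have dz (k : int) : (forall i : nat, k <> i) -> d k = 0.
  by case: k => // j /(_ j).
have pinj : injective Posz by move=> i j [].
have [M' dM] : exists M', bounded_sums (fun k => normc (d k)) M'.
  apply: (bounded_sums_image (e := Posz) pinj _ _ aM) => [k|k /dz ->].
    exact: normc_ge0.
  exact: normc0.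
apply: (@discrete_cauchy R d M' C n C0 dM) => N0.
exists (2 ^ N0.+1)%N, (dyadic_root R N0); split.
- by apply: ltnW; apply: ltnW; exact: ltn_expl.
- exact: dyadic_root_primitive.
move=> j; have [|S [S1 S2]] := h (dyadic_root R N0 ^+ j).
  by rewrite normcX normc_dyadic_root expr1n.
exists S; split => //; apply/(@has_sum_reindex _ _ _ Posz) => // k /dz ->.
by rewrite mul0r.
Qed.

Lemma taylor_at0 (a : nat -> K) : taylor_at a 0 a.
Proof.
move=> k; have := @has_sum_supp R nat (fun n => a n * ('C(n, k)%:R * 0 ^+ (n - k)))
  [fset k]%fset.
rewrite big_seq_fset1 binn subnn expr0 !mulr1; apply => n; rewrite !inE => nk.
have [nk'|kn] := ltnP n k; first by rewrite bin_small // mul0r mulr0.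
by rewrite expr0n subn_eq0 leqNgt ltn_neqAle eq_sym nk kn /= mulr0 mulr0.
Qed.

Lemma taylor_bound (a g : nat -> K) (w : K) (W s M : R) k : 0 < s ->
  normc w <= W -> bounded_sums (fun n => normc (a n) * (W + s) ^+ n) M ->
  taylor_at a w g -> normc (g k) * s ^+ k <= M.
Proof.
move=> s0 wW aM wg.
apply: (reexpand_coef_le (fun n => bounded_sums_binomial w n (ltW s0)) _ s0 (wg k)).
apply: bounded_sums_le aM => n; rewrite ler_wpM2l ?normc_ge0 //.
have h0 := normc_ge0 w.
by rewrite lerXn2r ?nnegrE ?lerD2r // addr_ge0 ?(ltW s0) // (le_trans h0).
Qed.

Lemma radius_geW (a : nat -> K) rho rho' :
  rho' <= rho -> radius_ge a rho -> radius_ge a rho'.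
Proof.
by move=> h ra r /andP[r0 rr]; apply: ra; rewrite r0 (lt_le_trans rr).
Qed.

(** The k-th Taylor coefficient of [h] at r xi is a power series in xi with coefficients 'C(j+k,k)
    h_(j+k) r^j. Cauchy's estimate on |xi| = 1 bounds the one with j = n-k by C / s^k. Summing over
    k <= n gives |h_n| (r+s)^n <= (n+1) C, and the factor n+1 is harmless at radii below r+s. *)
Lemma radius_of_taylor_bounds (h : nat -> K) (r s C : R) :
  radius_ge h 1 -> 0 < r < 1 -> 0 < s -> 0 <= C ->
  (forall z g, normc z = r -> taylor_at h z g ->
     forall k, normc (g k) * s ^+ k <= C) ->
  radius_ge h (r + s).
Proof.
move=> rh /andP[r0 r1] s0 C0 H.
have key n k : (k <= n)%N ->
    normc (h n) * ('C(n, k)%:R * r ^+ (n - k) * s ^+ k) <= C.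
  move=> kn; pose b j : K := h (j + k)%N * ('C(j + k, k)%:R * r%:C ^+ j).
  have sk : 0 < s ^+ k by rewrite exprn_gt0.
  have ndiv (z : K) : normc (z * r%:C ^+ (n - k)) = normc z * r ^+ (n - k).
    by rewrite normcM normc_exp_real // ltW.
  have addk_inj : injective (fun j => (j + k)%N) by move=> i j /addIn.
  pose t := (1 - r) / 2; have t0 : 0 < t by rewrite /t; lra.
  have nr : normc (r%:C : K) = r by rewrite normc_real gtr0_norm.
  have [|M hM] := radius_ge_bounded rh (r := normc (r%:C : K) + t).
    by rewrite nr /t; lra.
  have hb := reexpand_coef_bound
    (fun n => bounded_sums_binomial r%:C n (ltW t0)) hM k (ltW t0).
  have tk : 0 < t ^+ k by rewrite exprn_gt0.
  have bM : bounded_sums (fun j => normc (b j)) ((t ^+ k)^-1 * M).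
    apply: bounded_sums_le (bounded_sumsZ _ (bounded_sums_inj addk_inj hb)).
      move=> j; rewrite addnK [leRHS]mulrC mulfK ?gt_eqF //.
    by rewrite invr_ge0 ltW.
  have Cs : 0 <= C / s ^+ k by rewrite divr_ge0 // ltW.
  have := cauchy_estimate (n - k) Cs bM; rewrite /b subnK // ler_pdivlMr //.
  rewrite !normcM normc_nat normc_exp_real ?(ltW r0) // -!mulrA; apply=> xi xi1.
  have nz : normc (r%:C * xi) = r by rewrite normcM nr xi1 mulr1.
  have [|g hg] := taylor_ex rh (w := r%:C * xi); first by rewrite nz.
  exists (g k); split; last by rewrite ler_pdivlMr //; exact: H nz hg k.
  have hz i : (forall j, i <> (j + k)%N) ->
      h i * ('C(i, k)%:R * (r%:C * xi) ^+ (i - k)) = 0.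
    move=> ik; rewrite bin_small ?mul0r ?mulr0 // ltnNge; apply/negP => ki.
    by apply: (ik (i - k)%N); rewrite subnK.
  have hk := (@has_sum_reindex _ _ _ (fun j => (j + k)%N) _ (g k) addk_inj hz).1 (hg k).
  apply: eq_has_sum hk => j.
  by rewrite addnK exprMn !mulrA.
have rs0 : 0 < r + s by rewrite addr_gt0.
have sumC n : normc (h n) * (r + s) ^+ n <= n.+1%:R * C.
  rewrite exprDn mulr_sumr -[n.+1 in leRHS]card_ord -sum1_card natr_sum mulr_suml.
  apply: ler_sum => k _; rewrite mul1r -mulr_natl mulrA.
  by apply: key; rewrite -ltnS.
move=> q /andP[q0 qr].
have u01 : 0 <= q / (r + s) < 1 by rewrite divr_ge0 ?(ltW rs0) //= ltr_pdivrMr ?mul1r.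
(* The derived geometric series makes (n+1) (q/(r+s))^n bounded in n. *)
have r1' : radius_ge (fun _ : nat => 1 : K) 1.
  move=> x /andP[x0 x1]; exists 1 => n.
  by rewrite normc1 mul1r exprn_ile1 // ltW.
have [M hM] := radius_ge_shift ltr01 r1' u01.
exists (C * M) => n.
have -> : q ^+ n = (r + s) ^+ n * (q / (r + s)) ^+ n.
  by rewrite -exprMn mulrC divfK // gt_eqF.
rewrite mulrA; have un : 0 <= (q / (r + s)) ^+ n by rewrite exprn_ge0; case/andP: u01.
apply: le_trans (ler_wpM2r un (sumC n)) _.
have := ler_wpM2l C0 (hM n); rewrite normcM normc1 normc_nat mulr1.
by rewrite mulrA [C * n.+1%:R]mulrC.
Qed.

Lemma normc_le (z : K) (W : R) : 0 <= W ->
  complex.Re z ^+ 2 + complex.Im z ^+ 2 <= W ^+ 2 -> normc z <= W.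
Proof.
by move=> W0; rewrite -normc_sqr ler_pXn2r ?nnegrE ?normc_ge0.
Qed.

(* At a point z with |z| = 4/5 the Taylor coefficients of h are at most
   C (41/200)^(-k): they are computed from e if Re z is at least 96/125 and from
   gA otherwise. Cauchy estimates on |z| = 4/5 then bound
   'C(n,k) |h_n| (4/5)^(n-k) (41/200)^k, hence |h_n| (4/5 + 41/200)^n. *)
Lemma radius_gt1 (h e gA : nat -> K) :
  radius_ge h 1 -> radius_ge e 1 ->
  taylor_at h (- (1 / 4))%:C gA -> radius_ge gA (5 / 4) ->
  (forall x : R, 2 / 3 < x < 1 -> exists S,
     has_sum (fun n => h n * x%:C ^+ n) S /\
     has_sum (fun n => e n * (x - 1)%:C ^+ n) S) ->
  radius_ge h (201 / 200) /\ taylor_at h 1 e.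
Proof.
move=> rh re hA rA he.
have nreal (x : R) : normc (x%:C : K) = `|x| := normc_real x.
have n34 : normc ((3 / 4)%:C : K) = 3 / 4 by rewrite nreal ger0_norm; lra.
have nm14 : normc ((- (1 / 4))%:C : K) = 1 / 4 by rewrite nreal normrN ger0_norm; lra.
have n14 : normc ((1 / 4)%:C : K) = 1 / 4 by rewrite nreal ger0_norm; lra.
(* The point 3/4 is a relay between the discs of [h] and [e]: it lies in the segment (2/3, 1) on
   which they agree, and all z with |z| = 4/5 and Re z >= 96/125 are within 9/40 of it. *)
have [|g34 hg34] := taylor_ex rh (w := (3 / 4)%:C); first by rewrite n34; lra.
have eg34 : taylor_at e (- (1 / 4))%:C g34.
  have [|g heg] := taylor_ex re (w := (- (1 / 4))%:C); first by rewrite nm14; lra.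
  suff -> : g34 = g by [].
  apply/funext; apply: (taylor_ident (e := 1 / 4) rh re _ _ hg34 heg).
  - by rewrite n34; lra.
  - by rewrite nm14; lra.
  - by lra.
  move=> y /andP[y0 y1]; have [|S [S1 S2]] := he (3 / 4 + y); first by lra.
  exists S; split; first by rewrite -rmorphD; exact: S1.
  rewrite -rmorphD (_ : - (1 / 4) + y = 3 / 4 + y - 1); [exact: S2|lra].
have rg34 : radius_ge g34 (3 / 4).
  apply: radius_geW (taylor_radius re _ eg34); rewrite nm14; lra.
have hA' : taylor_at gA (1 / 4)%:C h.
  have [|g hg] := taylor_ex rA (w := (1 / 4)%:C); first by rewrite n14; lra.
  suff <- : g = h by [].
  have h0 : taylor_at h ((- (1 / 4))%:C + (1 / 4)%:C) h.
    by rewrite -rmorphD addNr; exact: taylor_at0.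
  apply/funext; apply: (taylor_comp rh _ hA hg h0).
  by rewrite nm14 n14; lra.
(* The radius gained is 4/5 + 41/200 = 201/200. The point z = 4/5 is at distance 21/20 from -1/4,
   and 21/20 + 41/200 > 5/4, so [gA] is insufficient there. At Re z = 96/125 both discs work: |z +
   1/4| <= 417/400 with 417/400 + 41/200 < 5/4, and |z - 1| <= 33/100 with 33/100 + 41/200 < 1. *)
have s0 : 0 < 41 / 200 :> R by lra.
have [|MA hMA] := radius_ge_bounded rA (r := 417 / 400 + 41 / 200); first by lra.
have [|MI hMI] := radius_ge_bounded re (r := 33 / 100 + 41 / 200); first by lra.
have MA0 := bounded_sums_ge0 hMA; have MI0 := bounded_sums_ge0 hMI.
have rh' : radius_ge h (201 / 200).
  have -> : 201 / 200 = 4 / 5 + 41 / 200 :> R by lra.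
  apply: (@radius_of_taylor_bounds h _ _ (MA + MI)) => //; [by lra|exact: addr_ge0|].
  move=> z g nz hzg k.
  have zsq : complex.Re z ^+ 2 + complex.Im z ^+ 2 = 16 / 25.
    by rewrite -normc_sqr nz; lra.
  have [zr|zr] := leP (96 / 125) (complex.Re z).
    have nz34 : normc (z - (3 / 4)%:C) <= 9 / 40.
      by apply: normc_le; first lra; case: (z) zsq zr => a b /=; nra.
    have [|q hq] := taylor_ex rg34 (w := z - (3 / 4)%:C); first by lra.
    have zz : (3 / 4)%:C + (z - (3 / 4)%:C) = z by rewrite addrC subrK.
    have gq : q = g.
      apply/funext; apply: (taylor_comp rh _ hg34 hq); last by rewrite zz.
      by rewrite n34; lra.
    have ez : (- (1 / 4))%:C + (z - (3 / 4)%:C) = z - 1.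
      rewrite addrCA -rmorphB; congr (_ + _).
      by rewrite (_ : _ - _ = -1) ?rmorphN ?rmorph1 //; lra.
    have nz1 : normc (z - 1) <= 33 / 100.
      by apply: normc_le; first lra; case: (z) zsq zr => a b /=; nra.
    have [|p hp] := taylor_ex re (w := z - 1); first by lra.
    have qp : q = p.
      apply/funext; apply: (taylor_comp re _ eg34 hq); last by rewrite ez.
      by rewrite nm14; lra.
    rewrite -gq qp; apply: le_trans (taylor_bound k s0 nz1 hMI hp) _.
    by rewrite lerDr.
  have nzA : normc ((1 / 4)%:C + z) <= 417 / 400.
    by apply: normc_le; first lra; case: (z) zsq zr => a b /=; nra.
  have [|q hq] := taylor_ex rA (w := (1 / 4)%:C + z); first by lra.
  have gq : g = q.
    apply/funext; apply: (taylor_comp rA _ hA' hzg hq).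
    by rewrite n14 nz; lra.
  rewrite gq; apply: le_trans (taylor_bound k s0 nzA hMA hq) _.
  by rewrite lerDl.
split; first exact: rh'.
have [|g hg] := taylor_ex rh' (w := 1); first by rewrite normc1; lra.
have [|q hq] := taylor_ex rg34 (w := (1 / 4)%:C); first by rewrite n14; lra.
have qg : q = g.
  apply/funext; apply: (taylor_comp rh' _ hg34 hq).
    by rewrite n34 n14; lra.
  rewrite -rmorphD (_ : 3 / 4 + 1 / 4 = 1); [exact: hg|lra].
have qe : q = e.
  apply/funext; apply: (taylor_comp re _ eg34 hq).
    by rewrite nm14 n14; lra.
  by rewrite -rmorphD addNr; exact: taylor_at0.
by rewrite -qe qg.
Qed.

(* The series a, b, c are sum_m a_m z^(-m-1), sum_m b_m z^(-m-1) and
   sum_k c_k (z-1)^(-k-1). *)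
Record expansions (a b c : int -> K) : Prop := Expansions {
  exp_a0 : exists N : int, forall m, m < N -> a m = 0;
  exp_b0 : exists N : int, forall m, N <= m -> b m = 0;
  exp_c0 : exists N : int, forall m, N <= m -> c m = 0;
  exp_a : forall x : R, 1 < x -> exists M, forall m, normc (a m) * x ^ (- m) <= M;
  exp_b : forall x : R, 0 < x < 1 -> exists M, forall m, normc (b m) * x ^ (- m) <= M;
  exp_c : forall x : R, 0 < x < 1 -> exists M, forall m, normc (c m) * x ^ (- m) <= M;
  exp_ac : forall t : R, 0 < t < 1 -> exists S,
    has_sum (fun m => a m * (1 + t)%:C ^ (- m - 1)) S /\
    has_sum (fun k => c k * t%:C ^ (- k - 1)) S;
  exp_bc : forall t : R, 0 < t < 1 / 3 -> exists S,
    has_sum (fun m => b m * (1 - t)%:C ^ (- m - 1)) S /\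
    has_sum (fun k => c k * (- t)%:C ^ (- k - 1)) S }.

(** Only the part of b in non-negative powers enters, z^n being the mode -n-1. Hence the condition
    survives multiplication by z and z-1, which normalises b and c later. *)
Definition taylor_extends (b : int -> K) := exists g,
  taylor_at (fun n : nat => b (- n%:Z - 1)) (- (1 / 4))%:C g /\ radius_ge g (5 / 4).

Let neg (n : nat) : int := - n%:Z - 1.

Let neg_inj : injective neg.
Proof. by move=> i j; rewrite /neg; lia. Qed.

Let neg_range (f : int -> K) : (forall m, 0 <= m -> f m = 0) ->
  forall m, (forall n, m <> neg n) -> f m = 0.
Proof.
move=> f0 m hm; apply: f0; rewrite leNgt; apply/negP => m0.
by apply: (hm (absz (m + 1))); rewrite /neg; lia.
Qed.

Let neg_sum (f : int -> K) (S : K) : (forall m, 0 <= m -> f m = 0) ->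
  has_sum f S -> has_sum (fun n => f (neg n)) S.
Proof.
by move=> f0 /(@has_sum_reindex _ _ _ neg _ _ neg_inj (neg_range f0)).
Qed.

Let neg_radius (b : int -> K) :
  (forall x : R, 0 < x < 1 -> exists M, forall m, normc (b m) * x ^ (- m) <= M) ->
  radius_ge (fun n => b (neg n)) 1.
Proof.
move=> hb r /andP[r0 r1]; pose x := (r + 1) / 2.
have x0 : 0 < x by rewrite /x; lra.
have [|M hM] := hb x; first by rewrite /x; lra.
exists (M / x) => n; rewrite ler_pdivlMr //.
apply: le_trans (hM (neg n)); rewrite -mulrA ler_wpM2l ?normc_ge0 //.
have -> : x ^ (- neg n) = x ^+ n * x.
  by rewrite -exprSr exprnP; congr (_ ^ _); rewrite /neg; lia.
rewrite ler_wpM2r ?(ltW x0) // lerXn2r ?nnegrE ?(ltW x0) //.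
by rewrite /x; lra.
Qed.

(** Only indices k = N - n, n >= 0, occur, and along them the ratio to the bounded terms at y is
    geometric with quotient y/x < 1. *)
Lemma one_sided_bounded (f : int -> K) (N : int) (x y M : R) :
  (forall k, N < k -> f k = 0) -> 0 < y -> y < x ->
  (forall k, normc (f k) * y ^ k <= M) ->
  exists M', bounded_sums (fun k => normc (f k) * x ^ k) M'.
Proof.
move=> f0 y0 yx hM; have x0 : 0 < x by apply: lt_trans yx.
pose e (n : nat) : int := N - n%:Z.
have einj : injective e by move=> i j; rewrite /e; lia.
have q01 : 0 <= y / x < 1 by rewrite divr_ge0 ?ltW //= ltr_pdivrMr // mul1r.
apply: (bounded_sums_image (e := e) einj _ _
    (M := (M * (x / y) ^ N) * (1 - y / x)^-1)).
- by move=> k; rewrite mulr_ge0 ?normc_ge0 // exprz_ge0 // ltW.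
- move=> k hk; rewrite f0 ?normc0 ?mul0r // ltNge; apply/negP => kN.
  by apply: (hk (absz (N - k))); rewrite /e; lia.
have M0 : 0 <= M.
  by apply: le_trans (hM 0); rewrite mulr_ge0 ?normc_ge0 // exprz_ge0 // ltW.
have c0 : 0 <= M * (x / y) ^ N.
  by rewrite mulr_ge0 // exprz_ge0 // divr_ge0 ?ltW.
apply: bounded_sums_le (bounded_sumsZ c0 (bounded_sums_geometric q01)) => n.
have -> : x ^ e n = y ^ e n * ((x / y) ^ N * (y / x) ^+ n).
  have -> : (x / y) ^ N * (y / x) ^+ n = (x / y) ^ (e n).
    rewrite /e expfzDr ?mulf_neq0 ?invr_eq0 ?gt_eqF //.
    congr (_ * _); rewrite -[y / x]invrK invf_div exprVn.
    by rewrite -exprnN.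
  by rewrite -expfzMl mulrC divfK // gt_eqF.
rewrite (mulrA (normc _)) -(mulrA M); apply: ler_wpM2r; last exact: hM.
by rewrite mulr_ge0 ?exprz_ge0 ?exprn_ge0 ?divr_ge0 ?ltW.
Qed.

(** Once b has radius 201/200 and Taylor series c at 1, it equals c, hence a, at real points
    slightly above 1; uniqueness of Laurent expansions gives a = b. The series a has only finitely
    many positive powers, so b is a polynomial, and c is its Taylor expansion at 1. *)
Lemma expansions_polynomial (a b c : int -> K) :
  expansions a b c -> taylor_extends b ->
  (forall m, 0 <= m -> b m = 0) -> (forall k, 0 <= k -> c k = 0) ->
  exists N, [/\ a =1 b, forall n : nat, (N <= n)%N -> b (- n%:Z - 1) = 0 &
    forall k : nat, c (- k%:Z - 1) =
      \sum_(n < N) b (- n%:Z - 1) * 'C(n, k)%:R].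
Proof.
move=> [[Na a0] _ _ ra rb rc ac bc] [gA [hA rA]] b0 c0.
pose h n := b (neg n); pose e n := c (neg n).
have rh : radius_ge h 1 by exact: neg_radius.
have re : radius_ge e 1 by exact: neg_radius.
have ex (x : K) n : x ^ (- neg n - 1) = x ^+ n.
  by rewrite exprnP; congr (_ ^ _); rewrite /neg; lia.
have [rh' he] : radius_ge h (201 / 200) /\ taylor_at h 1 e.
  apply: (radius_gt1 rh re hA rA) => x /andP[x0 x1].
  have [|S [S1 S2]] := bc (1 - x); first by lra.
  exists S; split.
    have := neg_sum (f := fun m => b m * (1 - (1 - x))%:C ^ (- m - 1)) _ S1.
    have -> : 1 - (1 - x) = x by ring.
    move=> hs; apply: eq_has_sum (hs _) => [n|m m0]; first by rewrite ex.
    by rewrite b0 ?mul0r.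
  have := neg_sum (f := fun m => c m * (- (1 - x))%:C ^ (- m - 1)) _ S2.
  have -> : - (1 - x) = x - 1 by ring.
  move=> hs; apply: eq_has_sum (hs _) => [n|m m0]; first by rewrite ex.
  by rewrite c0 ?mul0r.
pose hh (k : int) := b (- k - 1); pose aa (k : int) := a (- k - 1).
have aa0 k : - Na - 1 < k -> aa k = 0 by move=> hk; apply: a0; lia.
have nat_hh (k : int) : (forall i : nat, k <> i) -> hh k = 0.
  by case: k => [n /(_ n) //|n _]; apply: b0; lia.
have bh (x : R) : 0 < x < 201 / 200 ->
    exists M, bounded_sums (fun k => normc (hh k) * x ^ k) M.
  move=> /andP[x0 x1]; have [|M hM] := radius_ge_bounded rh' (r := x).
    by rewrite ltW.
  apply: (bounded_sums_image (e := Posz) _ _ _ (M := M)) => //; first by move=> i j [].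
  - by move=> k; rewrite mulr_ge0 ?normc_ge0 // exprz_ge0 // ltW.
  - by move=> k /nat_hh ->; rewrite normc0 mul0r.
have ba (x : R) : 1 < x -> exists M, bounded_sums (fun k => normc (aa k) * x ^ k) M.
  move=> x1; pose y := (1 + x) / 2.
  have y0 : 0 < y by rewrite /y; lra.
  have [|M hM] := ra y; first by rewrite /y; lra.
  apply: (one_sided_bounded aa0 y0 (M := M / y)); first by rewrite /y; lra.
  move=> k; rewrite ler_pdivlMr //; apply: le_trans (hM (- k - 1)).
  rewrite /aa -mulrA; apply: ler_wpM2l; first exact: normc_ge0.
  rewrite -{2}[y]expr1z -expfzDr ?gt_eqF //.
  by rewrite (_ : - (- k - 1) = k + 1) //; ring.
have bd (x : R) : 1 < x < 201 / 200 ->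
    exists M, bounded_sums (fun k => normc (hh k - aa k) * x ^ k) M.
  move=> /andP[x0 x1]; have [|M hM] := bh x; first by lra.
  have [M' hM'] := ba x x0; exists (M + M').
  apply: bounded_sums_le (bounded_sumsD hM hM') => k; rewrite -mulrDl.
  apply: ler_wpM2r; first by rewrite exprz_ge0 //; lra.
  by apply: le_trans (le_normcD _ _) _; rewrite normcN.
(* Any two distinct radii strictly between 1 and 201/200 bound a suitable annulus. *)
have [|M1 hM1] := bd (1001 / 1000); first by lra.
have [|M2 hM2] := bd (1004 / 1000); first by lra.
have hz : forall k, hh k - aa k = 0.
  apply: (laurent_eq0 _ _ hM1 hM2) => [||x /andP[x0 x1]]; [by lra|by lra|].
  have [|S [S1 S2]] := taylor_has_sum rh' he (y := (x - 1)%:C).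
    by rewrite normc1 normc_real ger0_norm; lra.
  have [|T [T1 T2]] := ac (x - 1); first by lra.
  have xx : 1 + (x - 1) = x by ring.
  have ST : S = T.
    apply: has_sum_unique S2 _.
    have := neg_sum (f := fun m => c m * (x - 1)%:C ^ (- m - 1)) _ T2.
    move=> hs; apply: eq_has_sum (hs _) => [n|m m0]; first by rewrite ex.
    by rewrite c0 ?mul0r.
  rewrite -(subrr S).
  have hS : has_sum (fun k => hh k * x%:C ^ k) S.
    apply/(@has_sum_reindex _ _ _ Posz) => [i j [] //|k /nat_hh ->|].
      by rewrite mul0r.
    by apply: eq_has_sum S1 => n; rewrite -[1]/(1%:C) -rmorphD xx.
  have hT : has_sum (fun k => aa k * x%:C ^ k) S.
    rewrite ST; have hb : injective (fun k : int => - k - 1) by move=> i j /=; lia.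
    have := (@has_sum_reindex _ _ _ (fun k : int => - k - 1) _ T hb _).1 T1.
    rewrite xx => hs; apply: eq_has_sum (hs _) => [k|m hm].
      by rewrite /aa; congr (_ * _ ^ _); ring.
    by exfalso; apply: (hm (- m - 1)); ring.
  by apply: eq_has_sum (has_sumB hS hT) => k; rewrite mulrBl.
have ab m : a m = b m.
  have := hz (- m - 1); rewrite /hh /aa (_ : - (- m - 1) - 1 = m); last by ring.
  by move/eqP; rewrite subr_eq0 => /eqP ->.
have hN n : (`|Na| <= n)%N -> h n = 0.
  by move=> hn; rewrite /h -ab a0 // /neg; lia.
exists `|Na|%N; split => //.
move=> k; apply: has_sum_unique (he k) _.
have := @has_sum_nat_fin R (fun n => h n * ('C(n, k)%:R * 1 ^+ (n - k))) `|Na|%N.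
have -> : \sum_(n < `|Na|%N) h n * ('C(n, k)%:R * 1 ^+ (n - k)) =
    \sum_(n < `|Na|%N) b (- n%:Z - 1) * 'C(n, k)%:R.
  by apply: eq_bigr => n _; rewrite expr1n mulr1.
by apply=> n nN; rewrite hN ?mul0r.
Qed.

End Continuation.

(** * The Jacobi identity for Laurent coefficients *)

Section JacobiCoefficients.
Variable R : realType.
Local Notation K := R[i].
Implicit Types (a b c f : int -> K) (l m : int).

Lemma sum_cbinomS (x : int) (F : nat -> K) N :
  \sum_(i < N.+1) cbinom K (x + 1) i * F i =
  \sum_(i < N.+1) cbinom K x i * F i + \sum_(i < N) cbinom K x i * F i.+1.
Proof.
elim: N => [|N IH].
  by rewrite !big_ord_recl !big_ord0 !cbinom0 !addr0.
rewrite big_ord_recr IH /= [in RHS]big_ord_recr /= [X in _ = _ + X]big_ord_recr /=.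
by rewrite cbinom_pascal; ring.
Qed.

Lemma sum_cbinomS0 (x : int) (F : nat -> K) N : F N = 0 ->
  \sum_(i < N) cbinom K (x + 1) i * F i =
  \sum_(i < N) cbinom K x i * (F i + F i.+1).
Proof.
case: N => [|N] FN; first by rewrite !big_ord0.
under [RHS]eq_bigr do rewrite mulrDr.
by rewrite big_split /= sum_cbinomS [X in _ = _ + X]big_ord_recr /= FN mulr0 addr0.
Qed.

(* [jac] is the residue of z^m (z-1)^l (a - b - c), where the factor is expanded
   at infinity for a, at 0 for b and at 1 for c. *)
Definition jac_product a l m (i : nat) : K := (-1) ^+ i * a (m + l - i%:Z).
Definition jac_opposite b l m (i : nat) : K := (-1) ^ l * (-1) ^+ i * b (m + i%:Z).
Definition jac_iterate c l (i : nat) : K := c (l + i%:Z).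

Definition jac N a b c l m : K :=
  \sum_(i < N) cbinom K l i * jac_product a l m i -
  \sum_(i < N) cbinom K l i * jac_opposite b l m i -
  \sum_(i < N) cbinom K m i * jac_iterate c l i.

(** For one-sided sequences the sums stabilise in N. Asking for large N only allows summation
    indices to be shifted without boundary terms. *)
Definition jac_zero a b c l m :=
  exists N0, forall N, (N0 <= N)%N -> jac N a b c l m = 0.

Definition one_sided a b c :=
  [/\ exists N : int, forall m, m < N -> a m = 0,
      exists N : int, forall m, N <= m -> b m = 0 &
      exists N : int, forall m, N <= m -> c m = 0].

Lemma one_sided_terms a b c l m : one_sided a b c ->
  exists N0, forall i, (N0 <= i)%N ->
    [/\ jac_product a l m i = 0, jac_opposite b l m i = 0 & jac_iterate c l i = 0].
Proof.
case=> -[Na a0] [Nb b0] [Nc c0].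
exists (absz (m + l - Na)%R + 1 + absz (Nb - m)%R + absz (Nc - l)%R)%N => i hi.
split; rewrite /jac_product /jac_opposite /jac_iterate.
- by rewrite a0 ?mulr0 //; lia.
- by rewrite b0 ?mulr0 //; lia.
- by rewrite c0 //; lia.
Qed.

(* Multiplication by z: [mulz] on a series in z and [mulz_c] on a series in z-1;
   multiplication by z-1: [mulz1] and [mulz]. *)
Definition mulz f m := f (m + 1).
Definition mulz_c f m := f (m + 1) + f m.
Definition mulz1 f m := f (m + 1) - f m.

Lemma signS l : (-1 : K) ^ (l + 1) = - (-1) ^ l.
Proof. by rewrite expfzDr ?oppr_eq0 ?oner_eq0 // expr1z mulrN1. Qed.

Lemma jac_mulz a b c l m : one_sided a b c -> exists N0, forall N, (N0 <= N)%N ->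
  jac N (mulz a) (mulz b) (mulz_c c) l m = jac N a b c l (m + 1).
Proof.
move=> os; have [N0 h] := one_sided_terms l m os; exists N0 => N hN.
have [_ _ hc] := h N hN.
rewrite /jac (sum_cbinomS0 _ hc).
congr (_ - _ - _); apply: eq_bigr => i _; congr (_ * _).
- by rewrite /jac_product /mulz; congr (_ * a _); ring.
- by rewrite /jac_opposite /mulz; congr (_ * b _); ring.
- rewrite /jac_iterate /mulz_c addrC; congr (_ + c _).
  by rewrite -addn1 PoszD addrA.
Qed.

Lemma jac_mulz1 a b c l m : one_sided a b c -> exists N0, forall N, (N0 <= N)%N ->
  jac N (mulz1 a) (mulz1 b) (mulz c) l m = jac N a b c (l + 1) m.
Proof.
move=> os; have [N0 h] := one_sided_terms (l + 1) m os; exists N0 => N hN.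
have [ha hb _] := h N hN.
rewrite /jac (sum_cbinomS0 _ ha) (sum_cbinomS0 _ hb).
congr (_ - _ - _); apply: eq_bigr => i _; congr (_ * _).
- rewrite /jac_product /mulz1 exprS -[i.+1]addn1 PoszD.
  have -> : m + l - i%:Z + 1 = m + (l + 1) - i%:Z by ring.
  have -> : m + (l + 1) - (i%:Z + 1) = m + l - i%:Z by ring.
  by ring.
- rewrite /jac_opposite /mulz1 signS exprS -[i.+1]addn1 PoszD addrA.
  by ring.
- by rewrite /jac_iterate /mulz; congr (c _); ring.
Qed.

(** The residue form of z^m (z-1)^(l+1) = z^(m+1) (z-1)^l - z^m (z-1)^l. *)
Lemma jac_rec a b c l m : one_sided a b c -> exists N0, forall N, (N0 <= N)%N ->
  jac N a b c (l + 1) m = jac N a b c l (m + 1) - jac N a b c l m.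
Proof.
move=> os; have [N1 h1] := jac_mulz l m os; have [N2 h2] := jac_mulz1 l m os.
exists (maxn N1 N2) => N; rewrite geq_max => /andP[/h1 <- /h2 <-].
rewrite /jac.
have -> : \sum_(i < N) cbinom K l i * jac_product (mulz1 a) l m i =
    \sum_(i < N) cbinom K l i * jac_product (mulz a) l m i -
    \sum_(i < N) cbinom K l i * jac_product a l m i.
  by rewrite -sumrB; apply: eq_bigr => i _; rewrite /jac_product /mulz1 /mulz; ring.
have -> : \sum_(i < N) cbinom K l i * jac_opposite (mulz1 b) l m i =
    \sum_(i < N) cbinom K l i * jac_opposite (mulz b) l m i -
    \sum_(i < N) cbinom K l i * jac_opposite b l m i.
  by rewrite -sumrB; apply: eq_bigr => i _; rewrite /jac_opposite /mulz1 /mulz; ring.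
have -> : \sum_(i < N) cbinom K m i * jac_iterate (mulz_c c) l i =
    \sum_(i < N) cbinom K m i * jac_iterate (mulz c) l i +
    \sum_(i < N) cbinom K m i * jac_iterate c l i.
  by rewrite -big_split; apply: eq_bigr => i _; rewrite /= -mulrDr.
by ring.
Qed.

Lemma cbinom_neg (n i : nat) :
  (-1) ^+ i * cbinom K (- n%:Z - 1) i = 'C(n + i, n)%:R.
Proof.
rewrite cbinomE; have x0 : (- n%:Z - 1)%:~R <= 0 :> R.
  by rewrite (_ : 0 = 0%:~R) // ler_int; lia.
have -> : (-1 : K) ^+ i = ((-1) ^+ i)%:C by rewrite rmorphXn rmorphN rmorph1.
rewrite -rmorphM -normr_rbinom_le0 //.
rewrite -(rmorph_nat (real_complex R)); congr real_complex_def.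
rewrite normr_rbinom_le0 //.
elim: i => [|i IH]; first by rewrite rbinom0 addn0 binn mulr1.
have h : i.+1%:R != 0 :> R by rewrite pnatr_eq0.
apply: (mulfI h); rewrite mulrCA rbinomS.
have -> : (-1) ^+ i.+1 * (((- n%:Z - 1)%:~R - i%:R) * rbinom (- n%:Z - 1)%:~R i) =
    (n + i).+1%:R * ((-1) ^+ i * rbinom (- n%:Z - 1)%:~R i :> R).
  rewrite exprS rmorphB rmorphN /= -[(n + i).+1]addn1 !natrD.
  by rewrite -[(n%:Z)%:~R]/(n%:R : R); ring.
have B k : 'C(n + k, n) = 'C(n + k, k) by rewrite -(bin_sub (leq_addr k n)) addKn.
by rewrite IH -!natrM !B addnS -mul_bin_diag.
Qed.

(** For l = 0 the identity says a = b, and [jac_rec] carries it to l > 0. For l = -n-1, once l+1 is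
    settled, [jac_rec] shows that the expression does not depend on m. At m = 0 it is the formula
    expressing c_(-n-1) by the coefficients of the polynomial, (z-1)^(-n-1) being expanded at
    infinity. *)
Lemma jac_zero_normalized a b c (N1 : nat) : one_sided a b c ->
  (forall m, 0 <= m -> b m = 0) -> (forall k, 0 <= k -> c k = 0) ->
  a =1 b -> (forall n : nat, (N1 <= n)%N -> b (- n%:Z - 1) = 0) ->
  (forall k : nat, c (- k%:Z - 1) =
      \sum_(n < N1) b (- n%:Z - 1) * 'C(n, k)%:R) ->
  forall l m, jac_zero a b c l m.
Proof.
move=> os b0 c0 ab bN cE.
have S0 (F : nat -> K) N : \sum_(i < N.+1) cbinom K 0 i * F i = F 0%N.
  rewrite big_ord_recl cbinom0 mul1r big1 ?addr0 // => i _.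
  by rewrite (cbinom_nat R 0) mul0r.
have z0 m : jac_zero a b c 0 m.
  exists 1%N => -[//|N] _; rewrite /jac !S0.
  rewrite /jac_product /jac_opposite /jac_iterate big1 => [|i _]; last first.
    by rewrite c0 ?mulr0 // add0r.
  have e1 : m + 0 - 0%N%:Z = m by lia.
  have e2 : m + 0%N%:Z = m by lia.
  by rewrite expr0 expr0z e1 e2 ab; ring.
have pos n m : jac_zero a b c (n%:Z) m.
  elim: n m => [|n IH] m; first exact: z0.
  have [N2 h2] := jac_rec n m os.
  have [N3 h3] := IH (m + 1); have [N4 h4] := IH m.
  exists (maxn N2 (maxn N3 N4)) => N; rewrite !geq_max => /and3P[i2 i3 i4].
  by rewrite -addn1 PoszD h2 // h3 // h4 // subrr.
have base (n : nat) : jac_zero a b c (- n%:Z - 1) 0.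
  have [N2 h2] := one_sided_terms (- n%:Z - 1) 0 os.
  exists (N2 + N1).+1 => N hN; rewrite /jac.
  have -> : \sum_(i < N) cbinom K (- n%:Z - 1) i * jac_opposite b (- n%:Z - 1) 0 i = 0.
    by apply: big1 => i _; rewrite /jac_opposite b0 ?mulr0 // add0r.
  have -> : \sum_(i < N) cbinom K 0 i * jac_iterate c (- n%:Z - 1) i = c (- n%:Z - 1).
    by case: N hN => // N _; rewrite S0 /jac_iterate; congr c; lia.
  rewrite cE subr0.
  have -> : \sum_(i < N) cbinom K (- n%:Z - 1) i * jac_product a (- n%:Z - 1) 0 i =
      \sum_(i < N) b (- (n + i)%N%:Z - 1) * 'C(n + i, n)%:R.
    apply: eq_bigr => i _; rewrite -cbinom_neg /jac_product ab.
    rewrite (_ : 0 + (- n%:Z - 1) - i%:Z = - (n + i)%N%:Z - 1); last by lia.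
    by ring.
  apply/eqP; rewrite subr_eq0; apply/eqP.
  pose F j := b (- j%:Z - 1) * 'C(j, n)%:R : K.
  have -> : \sum_(j < N1) F j = \sum_(j < n + N) F j.
    rewrite (big_ord_widen (n + N)%N F); last by lia.
    rewrite big_mkcond; apply: eq_bigr => j _; case: ltnP => // hj.
    by rewrite /F bN ?mul0r.
  by rewrite big_split_ord /= [X in _ = X + _]big1 ?add0r // => i _;
    rewrite /F bin_small ?mulr0.
have neg (n : nat) m : jac_zero a b c (- n%:Z - 1) m.
  have const (n' : nat) (m' : int) : jac_zero a b c (- n'%:Z) m' ->
      jac_zero a b c (- n'%:Z - 1) m' <-> jac_zero a b c (- n'%:Z - 1) (m' + 1).
    move=> [N2 h2]; have [N3] := jac_rec (- n'%:Z - 1) m' os.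
    rewrite subrK => h3.
    have h N : (maxn N2 N3 <= N)%N ->
        jac N a b c (- n'%:Z - 1) (m' + 1) = jac N a b c (- n'%:Z - 1) m'.
      rewrite geq_max => /andP[i2 i3]; apply/eqP.
      by rewrite -subr_eq0 -h3 // h2.
    split=> -[N4 h4]; exists (maxn (maxn N2 N3) N4) => N; rewrite geq_max => /andP[iN i4].
      by rewrite h // h4.
    by rewrite -h // h4.
  have step (n' : nat) : (forall m', jac_zero a b c (- n'%:Z) m') ->
      forall m', jac_zero a b c (- n'%:Z - 1) m'.
    move=> IH; case; elim=> [|k IHk]; first exact: base.
    - have -> : k.+1%:Z = k%:Z + 1 by lia.
      exact: (const _ _ (IH _)).1 IHk.
    - by apply: (const _ _ (IH _)).2; exact: base.
    - apply: (const _ _ (IH _)).2.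
      by have -> : Negz k.+1 + 1 = Negz k by lia.
  elim: n m => [|n IH]; first by apply: step => m'; rewrite oppr0; exact: (pos 0%N).
  apply: step => m'; have := IH m'.
  by rewrite (_ : - n.+1%:Z = - n%:Z - 1) //; lia.
case=> n m; first exact: pos.
by rewrite NegzE (_ : - n.+1%:Z = - n%:Z - 1); [exact: neg|lia].
Qed.

End JacobiCoefficients.

#[local] Opaque taylor_at.

(** * Removing the poles at 0 and 1 *)

Section Expansions.
Variable R : realType.
Local Notation K := R[i].
Implicit Types (a b c f : int -> K) (l m : int).

Lemma expansions_one_sided a b c : expansions a b c -> one_sided a b c.
Proof. by case. Qed.

Lemma has_sum_mulz f (z S : K) : z != 0 ->
  has_sum (fun k => f k * z ^ (- k - 1)) S ->
  has_sum (fun k => mulz f k * z ^ (- k - 1)) (z * S).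
Proof.
move=> z0 /(has_sumZ z) hs.
have inj : injective (fun k : int => k + 1) by move=> i j /=; lia.
have := (@has_sum_reindex _ _ _ (fun k : int => k + 1) _ (z * S) inj _).1 hs.
move=> h; apply: eq_has_sum (h _) => [k|j /(_ (j - 1))]; last by rewrite subrK.
rewrite /mulz mulrCA; congr (_ * _).
by rewrite -[z in LHS]expr1z -expfzDr //; congr (_ ^ _); ring.
Qed.

Lemma has_sum_mulz1 f (z S : K) : z != 0 ->
  has_sum (fun k => f k * z ^ (- k - 1)) S ->
  has_sum (fun k => mulz1 f k * z ^ (- k - 1)) ((z - 1) * S).
Proof.
move=> z0 hs; have := has_sumB (has_sum_mulz z0 hs) hs.
rewrite -{2}[S]mul1r -mulrBl.
by apply: eq_has_sum => k; rewrite /mulz1 mulrBl.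
Qed.

Lemma has_sum_mulz_c f (z S : K) : z != 0 ->
  has_sum (fun k => f k * z ^ (- k - 1)) S ->
  has_sum (fun k => mulz_c f k * z ^ (- k - 1)) ((1 + z) * S).
Proof.
move=> z0 hs; have := has_sumD (has_sum_mulz z0 hs) hs.
rewrite -{2}[S]mul1r -mulrDl addrC.
by apply: eq_has_sum => k; rewrite /mulz_c mulrDl.
Qed.

Definition term_bounded f (x : R) := exists M, forall m, normc (f m) * x ^ (- m) <= M.

Lemma term_bounded_mulz f x : 0 < x -> term_bounded f x -> term_bounded (mulz f) x.
Proof.
move=> x0 [M hM]; exists (x * M) => m.
apply: le_trans (ler_wpM2l (ltW x0) (hM (m + 1))); rewrite /mulz mulrCA.
apply: ler_wpM2l; first exact: normc_ge0.
rewrite -[x in leRHS]expr1z -expfzDr ?gt_eqF //.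
by rewrite (_ : 1 + - (m + 1) = - m) //; ring.
Qed.

Lemma term_boundedD f (g : int -> K) x : 0 < x -> term_bounded f x -> term_bounded g x ->
  term_bounded (fun m => f m + g m) x.
Proof.
move=> x0 [M hM] [N hN]; exists (M + N) => m.
apply: le_trans (lerD (hM m) (hN m)); rewrite -mulrDl.
by apply: ler_wpM2r (le_normcD _ _); rewrite exprz_ge0 // ltW.
Qed.

Lemma term_boundedZ f x (y : K) : term_bounded f x -> term_bounded (fun m => y * f m) x.
Proof.
move=> [M hM]; exists (normc y * M) => m.
by rewrite normcM -mulrA ler_wpM2l ?normc_ge0.
Qed.

Lemma term_boundedB f (g : int -> K) x : 0 < x -> term_bounded f x -> term_bounded g x ->
  term_bounded (fun m => f m - g m) x.
Proof.
move=> x0 hf /(@term_boundedZ _ _ (-1)) hg.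
have [M hM] := term_boundedD x0 hf hg; exists M => m.
by have := hM m; rewrite mulN1r.
Qed.

Lemma normc_gt0_real (x : R) : 0 < x -> x%:C != 0 :> K.
Proof. by move=> x0; rewrite -normc_eq0 normc_real normr_eq0 gt_eqF. Qed.

Lemma expansions_mulz a b c : expansions a b c ->
  expansions (mulz a) (mulz b) (mulz_c c).
Proof.
case=> -[Na a0] [Nb b0] [Nc c0] ra rb rc ac bc; split.
- by exists (Na - 1) => m hm; apply: a0; lia.
- by exists Nb => m hm; apply: b0; lia.
- by exists Nc => m hm; rewrite /mulz_c !c0 ?addr0 //; lia.
- by move=> x x1; apply: term_bounded_mulz; [lra|exact: ra].
- by move=> x x1; apply: term_bounded_mulz; [lra|exact: rb].
- move=> x x1; have x0 : 0 < x by lra.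
  by apply: term_boundedD => //; [apply: term_bounded_mulz => //|]; exact: rc.
- move=> t t1; have [S [S1 S2]] := ac t t1; exists ((1 + t)%:C * S); split.
    by apply: has_sum_mulz S1; apply: normc_gt0_real; lra.
  by rewrite rmorphD; apply: has_sum_mulz_c S2; apply: normc_gt0_real; lra.
- move=> t t1; have [S [S1 S2]] := bc t t1; exists ((1 - t)%:C * S); split.
    by apply: has_sum_mulz S1; apply: normc_gt0_real; lra.
  rewrite rmorphD; apply: has_sum_mulz_c S2.
  by rewrite rmorphN oppr_eq0; apply: normc_gt0_real; lra.
Qed.

Lemma expansions_mulz1 a b c : expansions a b c ->
  expansions (mulz1 a) (mulz1 b) (mulz c).
Proof.
case=> -[Na a0] [Nb b0] [Nc c0] ra rb rc ac bc; split.
- by exists (Na - 1) => m hm; rewrite /mulz1 !a0 ?subr0 //; lia.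
- by exists Nb => m hm; rewrite /mulz1 !b0 ?subr0 //; lia.
- by exists Nc => m hm; apply: c0; lia.
- move=> x x1; have x0 : 0 < x by lra.
  by apply: term_boundedB => //; [apply: term_bounded_mulz => //|]; exact: ra.
- move=> x x1; have x0 : 0 < x by lra.
  by apply: term_boundedB => //; [apply: term_bounded_mulz => //|]; exact: rb.
- by move=> x x1; apply: term_bounded_mulz; [lra|exact: rc].
- move=> t t1; have [S [S1 S2]] := ac t t1; exists (t%:C * S); split.
    have h : (1 + t)%:C != 0 :> K by apply: normc_gt0_real; lra.
    rewrite [t%:C](_ : _ = (1 + t)%:C - 1); first exact: has_sum_mulz1 h S1.
    by rewrite rmorphD rmorph1; ring.
  by apply: has_sum_mulz S2; apply: normc_gt0_real; lra.
- move=> t t1; have [S [S1 S2]] := bc t t1; exists ((- t)%:C * S); split.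
    have h : (1 - t)%:C != 0 :> K by apply: normc_gt0_real; lra.
    rewrite [(- t)%:C](_ : _ = (1 - t)%:C - 1); first exact: has_sum_mulz1 h S1.
    by rewrite rmorphB rmorphN rmorph1; ring.
  apply: has_sum_mulz S2.
  by rewrite rmorphN oppr_eq0; apply: normc_gt0_real; lra.
Qed.

Lemma expansionsD a b c a' b' c' : expansions a b c -> expansions a' b' c' ->
  expansions (fun m => a m + a' m) (fun m => b m + b' m) (fun m => c m + c' m).
Proof.
case=> -[Na a0] [Nb b0] [Nc c0] ra rb rc ac bc.
case=> -[Na' a0'] [Nb' b0'] [Nc' c0'] ra' rb' rc' ac' bc'; split.
- exists (Num.min Na Na') => m; rewrite lt_min => /andP[h h'].
  by rewrite a0 // a0' // addr0.
- exists (Num.max Nb Nb') => m; rewrite ge_max => /andP[h h'].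
  by rewrite b0 // b0' // addr0.
- exists (Num.max Nc Nc') => m; rewrite ge_max => /andP[h h'].
  by rewrite c0 // c0' // addr0.
- by move=> x x1; apply: term_boundedD; [lra|exact: ra|exact: ra'].
- by move=> x x1; apply: term_boundedD; [lra|exact: rb|exact: rb'].
- by move=> x x1; apply: term_boundedD; [lra|exact: rc|exact: rc'].
- move=> t t1; have [S [S1 S2]] := ac t t1; have [T [T1 T2]] := ac' t t1.
  exists (S + T); split.
    by apply: eq_has_sum (has_sumD S1 T1) => k; rewrite mulrDl.
  by apply: eq_has_sum (has_sumD S2 T2) => k; rewrite mulrDl.
- move=> t t1; have [S [S1 S2]] := bc t t1; have [T [T1 T2]] := bc' t t1.
  exists (S + T); split.
    by apply: eq_has_sum (has_sumD S1 T1) => k; rewrite mulrDl.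
  by apply: eq_has_sum (has_sumD S2 T2) => k; rewrite mulrDl.
Qed.

Lemma expansionsZ a b c (y : K) : expansions a b c ->
  expansions (fun m => y * a m) (fun m => y * b m) (fun m => y * c m).
Proof.
case=> -[Na a0] [Nb b0] [Nc c0] ra rb rc ac bc; split.
- by exists Na => m h; rewrite a0 // mulr0.
- by exists Nb => m h; rewrite b0 // mulr0.
- by exists Nc => m h; rewrite c0 // mulr0.
- by move=> x x1; apply: term_boundedZ; exact: ra.
- by move=> x x1; apply: term_boundedZ; exact: rb.
- by move=> x x1; apply: term_boundedZ; exact: rc.
- move=> t t1; have [S [S1 S2]] := ac t t1; exists (y * S); split.
    by apply: eq_has_sum (has_sumZ y S1) => k; rewrite mulrA.
  by apply: eq_has_sum (has_sumZ y S2) => k; rewrite mulrA.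
- move=> t t1; have [S [S1 S2]] := bc t t1; exists (y * S); split.
    by apply: eq_has_sum (has_sumZ y S1) => k; rewrite mulrA.
  by apply: eq_has_sum (has_sumZ y S2) => k; rewrite mulrA.
Qed.

#[local] Transparent taylor_at.

(** Here h'(z) = h'(0) + z h(z), and about w the factor z is w + y: each coefficient is w times the
    old one plus its predecessor. *)
Lemma taylor_at_shift (h h' : nat -> K) (w : K) (g : nat -> K) :
  (forall n, h' n.+1 = h n) -> taylor_at h w g ->
  taylor_at h' w (fun k => if k is k'.+1 then g k' + w * g k else h' 0%N + w * g 0%N).
Proof.
move=> hS hg k.
pose F k n := h n * ('C(n, k)%:R * w ^+ (n - k)).
have key S : has_sum (fun n => h' n.+1 * ('C(n.+1, k)%:R * w ^+ (n.+1 - k))) S ->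
    has_sum (fun n => h' n * ('C(n, k)%:R * w ^+ (n - k)))
      (h' 0%N * 'C(0, k)%:R + S).
  move=> hs; pose f0 n := if n is 0 then h' 0%N * 'C(0, k)%:R else 0 : K.
  pose f1 n := if n is n'.+1 then h' n * ('C(n, k)%:R * w ^+ (n - k)) else 0 : K.
  have h0 : has_sum f0 (h' 0%N * 'C(0, k)%:R).
    have := @has_sum_nat_fin R f0 1; rewrite big_ord_recl big_ord0 addr0.
    by apply; case.
  have h1 : has_sum f1 S.
    apply/(@has_sum_reindex _ _ _ succn) => [i j []//|[|j] jn//|].
      by have := jn j.
    exact: hs.
  apply: eq_has_sum (has_sumD h0 h1) => -[|n]; rewrite /f0 /f1 ?add0r //.
  by rewrite addr0 sub0n expr0 mulr1.
case: k key => [|k] key.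
  rewrite -[h' 0%N]mulr1 -[X in h' 0%N * X]/('C(0, 0)%:R); apply: key.
  apply: eq_has_sum (has_sumZ w (hg 0%N)) => n.
  by rewrite hS !bin0 !subn0 exprS; ring.
rewrite -[X in has_sum _ X]add0r -[X in X + _](mulr0 (h' 0%N)); apply: key.
apply: eq_has_sum (has_sumD (hg k) (has_sumZ w (hg k.+1))) => n.
rewrite hS binS natrD subSS.
have [kn|nk] := ltnP k n.
  by rewrite -[(n - k)%N]prednK ?subn_gt0 // -subnS exprS; ring.
by rewrite (bin_small (_ : n < k.+1)%N) //; ring.
Qed.

Lemma taylor_atB (h h' : nat -> K) (w : K) (g g' : nat -> K) :
  taylor_at h w g -> taylor_at h' w g' ->
  taylor_at (fun n => h n - h' n) w (fun k => g k - g' k).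
Proof.
move=> hg hg' k; apply: eq_has_sum (has_sumB (hg k) (hg' k)) => n.
by rewrite mulrBl.
Qed.

#[local] Opaque taylor_at.

Lemma radius_geD (g g' : nat -> K) rho : radius_ge g rho -> radius_ge g' rho ->
  radius_ge (fun k => g k + g' k) rho.
Proof.
move=> hg hg' r r1; have [M hM] := hg r r1; have [N hN] := hg' r r1.
exists (M + N) => n; apply: le_trans (lerD (hM n) (hN n)).
rewrite -mulrDl ler_wpM2r ?le_normcD // exprn_ge0 //; by case/andP: r1.
Qed.

Lemma radius_geZ (g : nat -> K) rho (y : K) : radius_ge g rho ->
  radius_ge (fun k => y * g k) rho.
Proof.
move=> hg r r1; have [M hM] := hg r r1; exists (normc y * M) => n.
by rewrite normcM -mulrA ler_wpM2l ?normc_ge0.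
Qed.

Lemma radius_ge_pred (g : nat -> K) rho (y : K) : radius_ge g rho ->
  radius_ge (fun k => if k is k'.+1 then g k' else y) rho.
Proof.
move=> hg r r1; have [M hM] := hg r r1; exists (normc y + M * r) => -[|n].
  have r0 : 0 <= r by case/andP: r1.
  have M0 : 0 <= M by apply: le_trans (hM 0%N); rewrite expr0 mulr1 normc_ge0.
  by rewrite expr0 mulr1 lerDl mulr_ge0.
rewrite exprSr mulrA; have r0 : 0 <= r by case/andP: r1.
by apply: le_trans (ler_wpM2r r0 (hM n)) _; rewrite lerDr normc_ge0.
Qed.

Lemma taylor_extends_mulz b : taylor_extends b -> taylor_extends (mulz b).
Proof.
case=> g [hg rg]; pose y := mulz b (- 0%N%:Z - 1); pose w : K := (- (1 / 4))%:C.
exists (fun k => if k is k'.+1 then g k' + w * g k else y + w * g 0%N); split.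
  apply: taylor_at_shift hg => n; rewrite /mulz; congr b.
  by rewrite -addn1 PoszD; ring.
have h := radius_geD (radius_ge_pred y rg) (radius_geZ w rg).
by move=> r /h[M hM]; exists M => -[|n]; [exact: hM 0%N|exact: hM n.+1].
Qed.

Lemma taylor_extends_mulz1 b : taylor_extends b -> taylor_extends (mulz1 b).
Proof.
move=> hb; have [g [hg rg]] := hb; have [g' [hg' rg']] := taylor_extends_mulz hb.
exists (fun k => g' k - g k); split; first exact: taylor_atB.
have := radius_geD rg' (radius_geZ (-1) rg).
by move=> h r r1; have [M hM] := h r r1; exists M => n; have := hM n; rewrite mulN1r.
Qed.

Lemma jac_zero_shift a b c a' b' c' l m l' m' :
  (exists N0, forall N, (N0 <= N)%N -> jac N a' b' c' l' m' = jac N a b c l m) ->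
  jac_zero a' b' c' l' m' -> jac_zero a b c l m.
Proof.
move=> [N0 h] [N1 h1]; exists (maxn N0 N1) => N; rewrite geq_max => /andP[i0 i1].
by rewrite -h // h1.
Qed.

(** The outer induction lowers the pole of b at 0 by a factor z, the inner one the pole of c at 1 by
    a factor z-1, which does not recreate a pole at 0. The factors are compensated by lowering m,
    respectively l, by one. *)
Lemma expansions_jacobi a b c : expansions a b c -> taylor_extends b ->
  forall l m, jac_zero a b c l m.
Proof.
move=> ex te.
have [nb hb] : exists n : nat, forall m, n%:Z <= m -> b m = 0.
  by case: ex => _ [N hN] _ *; exists `|N|%N => m hm; apply: hN; lia.
elim: nb a b c ex te hb => [|nb IH] a b c ex te hb l m; last first.
  apply: (jac_zero_shift (a' := mulz a) (b' := mulz b) (c' := mulz_c c)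
    (l' := l) (m' := m - 1)).
    by have := jac_mulz l (m - 1) (expansions_one_sided ex); rewrite subrK.
  apply: IH; [exact: expansions_mulz|exact: taylor_extends_mulz|].
  by move=> k hk; apply: hb; lia.
have [nc hc] : exists n : nat, forall k, n%:Z <= k -> c k = 0.
  by case: ex => _ _ [N hN] *; exists `|N|%N => k hk; apply: hN; lia.
elim: nc a b c ex te hb hc l m => [|nc IH] a b c ex te hb hc l m; last first.
  apply: (jac_zero_shift (a' := mulz1 a) (b' := mulz1 b) (c' := mulz c)
    (l' := l - 1) (m' := m)).
    by have := jac_mulz1 (l - 1) m (expansions_one_sided ex); rewrite subrK.
  apply: IH; [exact: expansions_mulz1|exact: taylor_extends_mulz1| |].
    by move=> k hk; rewrite /mulz1 !hb ?subr0 //; lia.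
  by move=> k hk; apply: hc; lia.
have [N [ab bN cE]] := expansions_polynomial ex te hb hc.
exact: jac_zero_normalized (expansions_one_sided ex) hb hc ab bN cE l m.
Qed.

End Expansions.

(** * Modes of open-string vertex algebras *)

Section FiniteSupportSums.
Variable W : nmodType.

Lemma fsum_single (I : choiceType) (F : I -> W) (i : I) :
  (forall j, j != i -> F j = 0) -> \sum_(j \in [set: I]) F j = F i.
Proof.
move=> F0; rewrite -(fsbig_widen [set i] setT) ?fsbig_set1 // => j [_ /eqP].
exact: F0.
Qed.

Lemma fsum_nat (F : nat -> W) N : (forall k, (N <= k)%N -> F k = 0) ->
  \sum_(k \in [set: nat]) F k = \sum_(k < N) F k.
Proof.
move=> F0; rewrite -(fsbig_widen `I_N setT) //; first by rewrite -fsbig_ord.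
by move=> k [_ /negP]; rewrite -leqNgt => /F0.
Qed.

End FiniteSupportSums.

Section Graded.
Variables (K : fieldType) (I : choiceType) (V : graded_space K I).

Lemma homog_gproj n (v : V) : homog n (gproj V n v).
Proof. by rewrite /homog /= gprojE eqxx. Qed.

Lemma gproj_homog m n (v : V) : homog n v -> gproj V m v = if m == n then v else 0.
Proof. by move=> <-; rewrite gprojE; case: eqP => // _; rewrite homog_gproj. Qed.

Lemma gproj_decomp (v : V) : exists s : seq I, v = \sum_(n <- s) gproj V n v.
Proof.
exists (enum_fset (fset_set [set n | gproj V n v != 0])).
rewrite {1}[v]gproj_sum -(fsbig_widen [set n | gproj V n v != 0] setT) //.
  by rewrite fsbig_finite //; exact: gproj_fin.
by move=> n [_ /negP]; rewrite negbK => /eqP.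
Qed.

Lemma gproj_eq0 (v : V) : (forall n, gproj V n v = 0) -> v = 0.
Proof. by move=> h; have [s ->] := gproj_decomp v; apply: big1. Qed.

Lemma graded_ind (P : V -> Prop) : P 0 -> (forall u v, P u -> P v -> P (u + v)) ->
  (forall n v, homog n v -> P v) -> forall v, P v.
Proof.
move=> P0 PD Ph v; have [s ->] := gproj_decomp v.
elim/big_ind: _ => // n _; exact/Ph/homog_gproj.
Qed.

Lemma homogD n (u v : V) : homog n u -> homog n v -> homog n (u + v).
Proof. by rewrite /homog /= linearD => -> ->. Qed.

Lemma homogZ n c (v : V) : homog n v -> homog n (c *: v).
Proof. by rewrite /homog /= linearZ => ->. Qed.

Lemma homog0 n : homog n (0 : V).
Proof. by rewrite /homog /= linear0. Qed.

Lemma homog_sum n (J : Type) (r : seq J) (F : J -> V) :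
  (forall j, homog n (F j)) -> homog n (\sum_(j <- r) F j).
Proof.
by move=> h; elim/big_ind: _ => //; [exact: homog0 | move=> *; exact: homogD].
Qed.

Lemma scalar_pack (f : V -> K) : scalar f -> exists phi : {scalar V}, phi =1 f.
Proof.
move=> hf; pose m := GRing.isLinear.Build K V K^o *%R f hf.
by exists (HB.pack_for {scalar V} f m).
Qed.

(* Removing redundant vectors from a spanning family until the coefficient of
   [x] is unique. *)
Lemma functional_of_span n (x : V) (k : nat) (t : 'I_k -> V) : x != 0 ->
  (forall v, homog n v ->
     exists a (c : 'I_k -> K), v = a *: x + \sum_i c i *: t i) ->
  homog n x -> exists phi : {scalar V}, phi x != 0.
Proof.
move=> x0 sp hx.
have uniq_case (k' : nat) (t' : 'I_k' -> V) :
    (forall v, homog n v -> exists a (c : 'I_k' -> K), v = a *: x + \sum_i c i *: t' i) ->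
    (forall a (c : 'I_k' -> K), a *: x + \sum_i c i *: t' i = 0 -> a = 0) ->
    exists phi : {scalar V}, phi x != 0.
  move=> sp' un; pose f v := sval (cid (sp' _ (homog_gproj n v))).
  have fE v : exists c : 'I_k' -> K, gproj V n v = f v *: x + \sum_i c i *: t' i.
    exact: svalP (cid (sp' _ (homog_gproj n v))).
  have lin : scalar f.
    move=> a u v; have [c hc] := fE (a *: u + v).
    have [cu hu] := fE u; have [cv hv] := fE v.
    apply/eqP; rewrite -subr_eq0; apply/eqP.
    apply: (un _ (fun i => c i - (a * cu i + cv i))).
    have : gproj V n (a *: u + v) - (a *: gproj V n u + gproj V n v) = 0.
      by rewrite linearP subrr.
    rewrite hc hu hv => e; rewrite -[RHS]e.
    under [X in _ + X = _]eq_bigr do rewrite scalerBl scalerDl -scalerA.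
    rewrite sumrB big_split /= -scaler_sumr scalerBl scalerDl -scalerA scalerDr.
    by rewrite addrACA -opprD; congr (_ - _); rewrite addrACA.
  have [phi phiE] := scalar_pack lin; exists phi; rewrite phiE.
  have [c hc] := fE x; rewrite hx in hc.
  apply/eqP => fx0; have := un (f x - 1) c.
  rewrite fx0 sub0r scaleN1r; rewrite fx0 scale0r add0r in hc.
  by rewrite -hc addNr => /(_ erefl)/eqP; rewrite oppr_eq0 oner_eq0.
elim: k t sp => [|k IH] t sp.
  apply: uniq_case sp _ => a c; rewrite big_ord0 addr0 => /eqP.
  by rewrite scaler_eq0 (negbTE x0) orbF => /eqP.
have [un|] := pselect (forall a (c : 'I_k.+1 -> K),
  a *: x + \sum_i c i *: t i = 0 -> a = 0); first exact: uniq_case sp un.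
move=> /existsNP[a] /existsNP[c] /not_implyP[dep /eqP a0].
have [j cj] : exists j, c j != 0.
  apply/existsP; rewrite -negb_forall; apply/negP => /forallP c0.
  move: dep; rewrite big1 => [|i _]; last first.
    by rewrite (eqP (c0 i)) scale0r.
  by move/eqP; rewrite addr0 scaler_eq0 (negbTE a0) (negbTE x0).
have tj : t j = - (c j)^-1 *: (a *: x + \sum_i c (lift j i) *: t (lift j i)).
  apply: (scalerI cj); rewrite scalerA mulrN divff // scaleN1r.
  apply/eqP; rewrite -subr_eq0 opprK; apply/eqP; rewrite -[RHS]dep.
  by rewrite (bigD1_ord j) //= addrCA.
apply: (IH (fun i => t (lift j i))) => v /sp[b [d ->]].
exists (b - d j / c j * a), (fun i => d (lift j i) - d j / c j * c (lift j i)).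
rewrite (bigD1_ord j) //= tj.
have -> y : d j *: (- (c j)^-1 *: y) = - (d j / c j *: y).
  by rewrite scalerA mulrN scaleNr.
under [in RHS]eq_bigr do rewrite scalerBl -scalerA.
rewrite sumrB -scaler_sumr scalerBl -[(d j / c j * a) *: x]scalerA scalerDr opprD.
by rewrite -!addrA; congr (_ + (_ + _)); rewrite addrC.
Qed.

End Graded.

Section Functionals.
Variables (R : realType) (V : graded_space R[i] R).
Hypothesis gr : grading_restricted V.
Local Notation K := R[i].

Lemma homog_functional_eq0 n (x : V) : homog n x ->
  (forall phi : {scalar V}, phi x = 0) -> x = 0.
Proof.
move=> hx h; apply/eqP; apply/negP => /negP x0.
have [sp _] := gr; have [s hs] := sp n.
have [|phi] := @functional_of_span _ _ V n x (size s) (fun i => s`_i) x0 _ hx.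
  by move=> v /hs[c ->]; exists 0, (fun i => c i); rewrite scale0r add0r.
by rewrite h eqxx.
Qed.

Lemma functional_eq0 (x : V) :
  (forall (phi : {scalar V}) n, phi (gproj V n x) = 0) -> x = 0.
Proof.
move=> h; apply: gproj_eq0 => n; apply: homog_functional_eq0 (homog_gproj _ _) _.
by move=> phi; exact: h.
Qed.

(** Such functionals read off one component of an element of the completion, so every pairing with
    them reduces to a single term. *)
Definition comp_functional (phi : {scalar V}) (n : R) : {scalar V} := phi \o gproj V n.

Lemma graded_dual_comp phi n : graded_dual (comp_functional phi n).
Proof.
apply: (@sub_finite_set _ _ [set n]) => [m [v]|]; last exact: finite_set1.
rewrite /comp_functional /= gprojE; case: (eqVneq n m) => [->//|_].
by rewrite linear0 eqxx.
Qed.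

Lemma pairing_comp phi n (f : R -> V) : completion f ->
  pairing (comp_functional phi n) f = phi (f n).
Proof.
move=> cf; rewrite /pairing (fsum_single (i := n)).
  by rewrite /comp_functional /= cf.
move=> m mn; rewrite /comp_functional /= (gproj_homog n (cf m)).
by rewrite eq_sym (negbTE mn) linear0.
Qed.

Lemma pairing_eq0 (f : R -> V) : completion f ->
  (forall v', graded_dual v' -> pairing v' f = 0) -> forall n, f n = 0.
Proof.
move=> cf h n; apply: homog_functional_eq0 (cf n) _ => phi.
by rewrite -(pairing_comp phi n cf) h //; exact: graded_dual_comp.
Qed.

Lemma homog_bounded_below : exists N : R, forall n, n < N ->
  forall v : V, homog n v -> v = 0.
Proof. by case: gr. Qed.

End Functionals.

Section Modes.
Variables (R : realType) (V : open_string_vertex_algebra R).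
Variable Yf : V -> R -> V -> V.
Hypothesis gr : grading_restricted V.
Hypothesis fv : formal_vertex_operators Yf.
Local Notation K := R[i].

Lemma mode_homog p q n (u v : V) : homog p u -> homog q v ->
  homog (p + q - n - 1) (Yf u n v).
Proof.
move=> hu hv; have := fv_weight fv n hu hv.
by rewrite (_ : q + (p - n - 1) = p + q - n - 1) //; ring.
Qed.

Lemma modeDl n (u u' v : V) : Yf (u + u') n v = Yf u n v + Yf u' n v.
Proof. by have := fv_linearl fv n v 1 u u'; rewrite !scale1r. Qed.

Lemma mode0l n (v : V) : Yf 0 n v = 0.
Proof.
have := fv_linearl fv n v (-1) 0 0; rewrite scaler0 addr0 scaleN1r.
by rewrite addNr.
Qed.

Lemma modeZl n a (u v : V) : Yf (a *: u) n v = a *: Yf u n v.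
Proof. by have := fv_linearl fv n v a u 0; rewrite !addr0 mode0l addr0. Qed.

Lemma modeDr n (u v v' : V) : Yf u n (v + v') = Yf u n v + Yf u n v'.
Proof. by have := fv_linearr fv u n 1 v v'; rewrite !scale1r. Qed.

Lemma mode0r n (u : V) : Yf u n 0 = 0.
Proof.
have := fv_linearr fv u n (-1) 0 0; rewrite scaler0 addr0 scaleN1r.
by rewrite addNr.
Qed.

Lemma modeZr n a (u v : V) : Yf u n (a *: v) = a *: Yf u n v.
Proof. by have := fv_linearr fv u n a v 0; rewrite !addr0 mode0r addr0. Qed.

Lemma mode_suml n (J : Type) (r : seq J) (F : J -> V) (v : V) :
  Yf (\sum_(j <- r) F j) n v = \sum_(j <- r) Yf (F j) n v.
Proof.
by elim/big_rec2: _ => [|j x y _ <-]; rewrite ?mode0l ?modeDl.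
Qed.

Lemma mode_sumr n (J : Type) (r : seq J) (F : J -> V) (u : V) :
  Yf u n (\sum_(j <- r) F j) = \sum_(j <- r) Yf u n (F j).
Proof.
by elim/big_rec2: _ => [|j x y _ <-]; rewrite ?mode0r ?modeDr.
Qed.

Lemma mode_truncated (u v : V) : exists N, forall n, N <= n -> Yf u n v = 0.
Proof.
have [B hB] := homog_bounded_below gr.
elim/graded_ind: u => [|u u' [N hN] [N' hN']|p u hu].
- by exists 0 => n _; exact: mode0l.
- exists (Num.max N N') => n; rewrite ge_max => /andP[h h'].
  by rewrite modeDl hN // hN' // addr0.
elim/graded_ind: v => [|v v' [N hN] [N' hN']|q v hv].
- by exists 0 => n _; exact: mode0r.
- exists (Num.max N N') => n; rewrite ge_max => /andP[h h'].
  by rewrite modeDr hN // hN' // addr0.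
by exists (p + q - B) => n hn; apply: hB (mode_homog n hu hv); lra.
Qed.

(** The bridge from the analytic map to modes. By weight, only the mode k = p+q-n-1 reaches the
    component n, and its factor is r^(-k-1). *)
Lemma os_Y_mode p q n r (u v : V) : homog p u -> homog q v -> 0 < r ->
  os_Y u r v n = (r `^ (n - p - q))%:C *: Yf u (p + q - n - 1) v.
Proof.
move=> hu hv r0.
have hn : homog n (Yf u (p + q - n - 1) v).
  by have := mode_homog (p + q - n - 1) hu hv;
    rewrite (_ : p + q - _ - 1 = n) //; ring.
apply/eqP; rewrite -subr_eq0; apply/eqP.
have cY : completion (os_Y u r v) by exact: os_Y_completion.
apply: (homog_functional_eq0 gr (n := n)) => [|phi].
  by apply: homogD; [exact: cY | rewrite -scaleN1r; do 2 apply: homogZ].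
rewrite linearB linearZ /= -(pairing_comp phi n cY).
rewrite (fv_expansion fv u v (graded_dual_comp phi n) r0).
rewrite (fsum_single (i := p + q - n - 1)) => [|k kn].
  rewrite /comp_functional /= hn mulrC; apply/eqP; rewrite subr_eq0; apply/eqP.
  by congr (_%:C * _); congr (_ `^ _); ring.
rewrite /comp_functional /= (gproj_homog n (mode_homog k hu hv)).
case: (eqVneq n) => [e|_]; last by rewrite linear0 mul0r.
by move/eqP: kn; case; rewrite e; ring.
Qed.

End Modes.

Section Limits.
Variable R : realType.
Local Notation K := R[i].

Lemma cvg_realC (F : set_system R) {FF : Filter F} (f : R -> R) (l : R) (c : K) :
  f x @[x --> F] --> l -> (((f x)%:C * c) : K^o) @[x --> F] --> (l%:C * c : K^o).
Proof.
move=> fl; apply/cvgrPdist_lt => e e0.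
have [r r0 ->] : exists2 r : R, 0 < r & e = r%:C.
  case: e e0 => a b; rewrite ltcE /= => /andP[/eqP -> a0]; by exists a.
have c0 : 0 < normc c + 1 by rewrite ltr_wpDl ?normc_ge0.
have rc : 0 < r / (normc c + 1) by rewrite divr_gt0.
move/cvgrPdist_lt : fl => /(_ _ rc); apply: filterS => x.
rewrite ltr_pdivlMr // -mulrBl -rmorphB normC_normc ltcR normcM normc_real.
by apply: le_lt_trans; rewrite ler_wpM2l // lerDl.
Qed.

Lemma cvgC_unique (F : set_system R) {FF : ProperFilter F} (f : R -> K^o) (a b : K^o) :
  f x @[x --> F] --> a -> f x @[x --> F] --> b -> a = b.
Proof. exact: (@cvg_unique _ (@norm_hausdorff _ K^o)). Qed.

Lemma powR_derivative_at1 (x : R) :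
  (h^-1 * ((1 + h) `^ x - 1)) @[h --> (0 : R)^'] --> x.
Proof.
have [hd he] := is_derive1_powR x (ltr01 : 0 < (1 : R)).
have hl : h^-1 *: ((((powR (R := R)) ^~ x) \o shift 1) (h *: (1 : R)) - 1 `^ x)
    @[h --> (0 : R)^'] --> 'D_1 ((powR (R := R)) ^~ x) 1 by exact: hd.
rewrite he powR1 mulr1 in hl; apply: cvg_trans hl; apply: near_eq_cvg; near=> h.
by rewrite /= /GRing.scale /= ?mulr1 (addrC h).
Unshelve. all: by end_near. Qed.

End Limits.

Arguments cvg_realC {R F FF f l} c _.

(** * The operator D and the vacuum in terms of modes *)

Section Vacuum.
Variables (R : realType) (V : open_string_vertex_algebra R).
Variable Yf : V -> R -> V -> V.
Hypothesis gr : grading_restricted V.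
Hypothesis fv : formal_vertex_operators Yf.
Local Notation K := R[i].
Local Notation D := (os_D V).
Local Notation "'vac'" := (os_one V).

Lemma homogDop p (u : V) : homog p u -> homog (p + 1) (D u).
Proof. exact: os_D_weight. Qed.

Lemma mode_D_bracket n (u v : V) : D (Yf u n v) - Yf u n (D v) = Yf (D u) n v.
Proof.
elim/graded_ind: u => [|u u' hu hu'|p u hu].
- by rewrite linear0 !(mode0l fv) linear0 subr0.
- by rewrite linearD !(modeDl fv) -hu -hu' linearD opprD addrACA.
elim/graded_ind: v => [|v v' hv hv'|q v hv].
- by rewrite linear0 !(mode0r fv) linear0 subr0.
- by rewrite linearD !(modeDr fv) -hv -hv' linearD opprD addrACA.
have r0 : 0 < (1 : R) by [].
have := os_D_bracket u v (p + q - n) r0; rewrite /D_bar.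
rewrite (os_Y_mode gr fv _ hu hv r0) (os_Y_mode gr fv _ hu (homogDop hv) r0).
rewrite (os_Y_mode gr fv _ (homogDop hu) hv r0) !powR1 !scale1r.
have -> : p + q - (p + q - n - 1) - 1 = n by ring.
have -> : p + (q + 1) - (p + q - n) - 1 = n by ring.
by have -> : p + 1 + q - (p + q - n) - 1 = n by ring.
Qed.

(** For homogeneous vectors the relevant component of Y(u,r)v is r^(-n) times a fixed vector, so its
    weak derivative at r = 1 is read off. *)
Lemma mode_D n (u v : V) : Yf (D u) n v = - n%:C *: Yf u (n - 1) v.
Proof.
elim/graded_ind: u => [|u u' hu hu'|p u hu].
- by rewrite linear0 !(mode0l fv) scaler0.
- by rewrite linearD !(modeDl fv) hu hu' scalerDr.
elim/graded_ind: v => [|v v' hv hv'|q v hv].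
- by rewrite !(mode0r fv) scaler0.
- by rewrite !(modeDr fv) hv hv' scalerDr.
have r0 : 0 < (1 : R) by [].
pose m := p + q - n.
have h1 : homog m (Yf (D u) n v).
  by have := mode_homog fv n (homogDop hu) hv; rewrite (_ : _ - 1 = m) // /m; ring.
have h2 : homog m (Yf u (n - 1) v).
  by have := mode_homog fv (n - 1) hu hv; rewrite (_ : _ - 1 = m) // /m; ring.
apply/eqP; rewrite -subr_eq0; apply/eqP.
apply: (homog_functional_eq0 gr (n := m)) => [|phi].
  by apply: homogD => //; rewrite -scaleN1r; do 2 apply: homogZ.
rewrite linearB linearZ /=; apply/eqP; rewrite subr_eq0; apply/eqP.
have := @os_D_derivative R V u v 1 r0 _ (graded_dual_comp phi m).
rewrite (pairing_comp phi m (@os_Y_completion R V (D u) 1 v r0)).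
rewrite (os_Y_mode gr fv _ (homogDop hu) hv r0) powR1 scale1r.
have -> : p + 1 + q - m - 1 = n by rewrite /m; ring.
move=> lim1; apply: cvgC_unique lim1 _.
have := @cvg_realC R _ (dnbhs_filter 0) _ _ (phi (Yf u (n - 1) v)) (@powR_derivative_at1 R (- n)).
rewrite rmorphN => lim2. apply: cvg_trans lim2; apply: near_eq_cvg; near=> h.
have h0 : 0 < 1 + h.
  have : `|h| < 1 by near: h; apply: dnbhs0_lt.
  by rewrite ltr_norml; lra.
rewrite (pairing_comp phi m (@os_Y_completion R V _ _ _ h0)).
rewrite (pairing_comp phi m (@os_Y_completion R V _ _ _ r0)).
rewrite (os_Y_mode gr fv _ hu hv h0) (os_Y_mode gr fv _ hu hv r0).
have -> : m - p - q = - n by rewrite /m; ring.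
have -> : p + q - m - 1 = n - 1 by rewrite /m; ring.
rewrite powR1 scale1r linearZ /= rmorphM rmorphB rmorph1.
by rewrite -mulrA mulrBl mul1r.
Unshelve. all: by end_near. Qed.

End Vacuum.

Section Creation.
Variables (R : realType) (V : open_string_vertex_algebra R).
Variable Yf : V -> R -> V -> V.
Hypothesis gr : grading_restricted V.
Hypothesis fv : formal_vertex_operators Yf.
Local Notation K := R[i].
Local Notation D := (os_D V).
Local Notation vac := (os_one V).

Lemma gproj_dop n (v : V) : gproj V n (dop v) = n%:C *: gproj V n v.
Proof.
rewrite /dop -(fsbig_widen [set m | gproj V m v != 0] setT) //; last first.
  by move=> m [_ /negP]; rewrite negbK => /eqP /= vm; rewrite vm scaler0.
rewrite fsbig_finite; last exact: gproj_fin.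
rewrite linear_sum /=.
under eq_bigr => m _ do rewrite linearZ /= gprojE.
have [vn|vn] := eqVneq (gproj V n v) 0.
  rewrite vn scaler0; apply: big1 => m _.
  by case: (eqVneq n m) => [<-|_]; rewrite ?vn scaler0.
rewrite (bigD1_seq n) ?fset_uniq //=; last first.
  by rewrite in_fset_set; [exact/mem_set|exact: gproj_fin].
rewrite eqxx big1 ?addr0 // => m mn.
by rewrite eq_sym (negbTE mn) scaler0.
Qed.

Lemma vertex_operator_eq0 (w : V) :
  (forall r v n, 0 < r -> os_Y w r v n = 0) -> w = 0.
Proof.
move=> h; apply: (functional_eq0 gr) => phi n.
have := @os_creation R V w _ (graded_dual_comp phi n).
rewrite pairing_comp; last by move=> m; exact: homog_gproj.
move=> lim1; apply: cvgC_unique lim1 _.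
have : (fun _ : R => 0 : K^o) x @[x --> (0 : R)^'+] --> (0 : K^o) by exact: cvg_cst.
apply: cvg_trans; apply: near_eq_cvg; near=> r.
have r0 : 0 < r by near: r; exact: nbhs_right_gt.
by rewrite (pairing_comp phi n (@os_Y_completion R V _ _ _ r0)) h // linear0.
Unshelve. all: by end_near. Qed.

Lemma os_Y_vacuum r (v : V) n : 0 < r -> os_Y vac r v n = gproj V n v.
Proof. by move=> r0; rewrite os_identity. Qed.

(** Y(1,r) is the identity, hence constant in r and commuting with d. The bracket formula then gives
    Y(d1,r) = 0, so d1 = 0 by the creation property, and every component of nonzero weight
    vanishes. *)
Lemma homog_vacuum : homog 0 vac.
Proof.
suff d0 : dop vac = 0.
  rewrite /homog /=; apply/eqP; rewrite -subr_eq0; apply/eqP; apply: gproj_eq0 => n.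
  rewrite linearB /= gprojE.
  have := gproj_dop n vac; rewrite d0 linear0 => /esym/eqP; rewrite scaler_eq0.
  case: (eqVneq n 0) => [-> _|n0]; first by rewrite subrr.
  have nC : n%:C != 0 :> K by rewrite -normc_eq0 normc_real normr_eq0.
  by rewrite (negbTE nC) /= => /eqP ->; rewrite subr0.
apply: vertex_operator_eq0 => r v n r0.
have [g [cg wg]] := @os_d_bracket R V vac v r r0.
have g0 : forall n, g n = 0.
  apply: (pairing_eq0 gr cg) => v' dv'; have lim1 := wg v' dv'.
  apply: cvgC_unique lim1 _.
  have : (fun _ : R => 0 : K^o) x @[x --> (0 : R)^'] --> (0 : K^o) by exact: cvg_cst.
  apply: cvg_trans; apply: near_eq_cvg; near=> h.
  have h0 : 0 < r + h.
    have : `|h| < r by near: h; apply: dnbhs0_lt.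
    by rewrite ltr_norml; lra.
  by rewrite !os_identity // subrr mulr0.
move=> /(_ n); rewrite g0 scaler0 addr0 => <-.
by rewrite /dop_bar !os_Y_vacuum // gproj_dop subrr.
Unshelve. all: by end_near. Qed.

Lemma mode_vacuum n (v : V) : Yf vac n v = if n == -1 then v else 0.
Proof.
elim/graded_ind: v => [|v v' hv hv'|q v hv].
- by rewrite (mode0r fv) if_same.
- by rewrite (modeDr fv) hv hv'; case: ifP; rewrite ?addr0.
have r0 : 0 < (1 : R) by [].
have := os_Y_vacuum v (q - n - 1) r0.
rewrite (os_Y_mode gr fv _ homog_vacuum hv r0) powR1 scale1r.
have -> : 0 + q - (q - n - 1) - 1 = n by ring.
move=> ->; rewrite (gproj_homog _ hv).
by have -> : (q - n - 1 == q) = (n == -1) by apply/eqP/eqP => ?; lra.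
Qed.

(** The component of Y(w,r)1 of weight p-n-1 is r^(-n-1) w_n 1. It tends to 0 since p-n-1 differs
    from p, while the factor is at least 1 for r < 1. The index may be any real above -1. *)
Lemma mode_on_vacuum_ge0 n (w : V) : -1 < n -> Yf w n vac = 0.
Proof.
move=> n1; elim/graded_ind: w => [|u u' hu hu'|p w hw].
- exact: (mode0l fv).
- by rewrite (modeDl fv) hu hu' addr0.
pose m := p - n - 1.
have hm : homog m (Yf w n vac).
  by have := mode_homog fv n hw homog_vacuum; rewrite addr0.
apply: (homog_functional_eq0 gr hm) => phi.
have lim := @os_creation R V w _ (graded_dual_comp phi m).
rewrite pairing_comp in lim; last by move=> k; exact: homog_gproj.
rewrite /to_completion (gproj_homog m hw) in lim.
have mp : m != p by apply/eqP; rewrite /m => ?; lra.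
rewrite (negbTE mp) linear0 in lim.
apply/eqP; rewrite -normc_eq0 eq_le normc_ge0 andbT.
apply/ler_addgt0Pr => e e0; rewrite add0r.
have e0' : 0 < e%:C :> K by rewrite ltcR.
move/cvgrPdist_lt : lim => /(_ _ e0') lim.
near (0 : R)^'+ => r.
have r0 : 0 < r by near: r; exact: nbhs_right_gt.
have r1 : r < 1 by near: r; exact: nbhs_right_lt.
have : `|0 - pairing (comp_functional phi m) (os_Y w r vac)| < e%:C by near: r; exact: lim.
rewrite (pairing_comp phi m (@os_Y_completion R V _ _ _ r0)).
rewrite (os_Y_mode gr fv _ hw homog_vacuum r0) linearZ /=.
have -> : p + 0 - m - 1 = n by rewrite /m; ring.
rewrite sub0r normrN normC_normc ltcR normcM normc_real ger0_norm ?powR_ge0 //.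
move=> /ltW; apply: le_trans; rewrite ler_peMl ?normc_ge0 //.
have -> : m - p - 0 = - (n + 1) by rewrite /m; ring.
rewrite powRN invf_ge1 ?powR_gt0 //.
have : r `^ (n + 1) <= 1 `^ (n + 1).
  by apply: ge0_ler_powR; rewrite ?nnegrE ?ltW //; lra.
by rewrite powR1.
Unshelve. all: by end_near. Qed.

Lemma mode_on_vacuum_N1 (w : V) : Yf w (-1) vac = w.
Proof.
elim/graded_ind: w => [|u u' hu hu'|p w hw].
- exact: (mode0l fv).
- by rewrite (modeDl fv) hu hu'.
have hm : homog p (Yf w (-1) vac).
  by have := mode_homog fv (-1) hw homog_vacuum; rewrite addr0 opprK addrK.
apply/eqP; rewrite -subr_eq0; apply/eqP.
apply: (homog_functional_eq0 gr (n := p)) => [|phi].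
  by apply: homogD => //; rewrite -scaleN1r; exact: homogZ.
rewrite linearB /=; apply/eqP; rewrite subr_eq0; apply/eqP.
have lim := @os_creation R V w _ (graded_dual_comp phi p).
rewrite pairing_comp in lim; last by move=> k; exact: homog_gproj.
rewrite /to_completion hw in lim.
apply: cvgC_unique lim.
have : (fun _ : R => phi (Yf w (-1) vac) : K^o) x @[x --> (0 : R)^'+] -->
   (phi (Yf w (-1) vac) : K^o) by exact: cvg_cst.
apply: cvg_trans; apply: near_eq_cvg; near=> r.
have r0 : 0 < r by near: r; exact: nbhs_right_gt.
rewrite (pairing_comp phi p (@os_Y_completion R V _ _ _ r0)).
rewrite (os_Y_mode gr fv _ hw homog_vacuum r0).
have -> : p - p - 0 = 0 by ring.
have -> : p + 0 - p - 1 = -1 by ring.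
by rewrite powRr0 scale1r.
Unshelve. all: by end_near. Qed.

Lemma D_vacuum : D vac = 0.
Proof.
rewrite -(mode_on_vacuum_N1 (D vac)) (mode_D gr fv) mode_vacuum.
by rewrite ifF ?scaler0 //; apply/eqP; lra.
Qed.

Definition divD (j : nat) (v : V) : V := (j`!%:R^-1 : K) *: iter j D v.

Lemma divD0 v : divD 0 v = v.
Proof. by rewrite /divD fact0 invr1 scale1r. Qed.

Lemma divDS j v : D (divD j v) = j.+1%:R *: divD j.+1 v.
Proof.
rewrite /divD linearZ /= scalerA factS natrM invfM mulrA divff ?mul1r //.
by rewrite pnatr_eq0.
Qed.

Lemma divD_linear j : linear (divD j).
Proof.
move=> a u v; rewrite /divD.
have -> : iter j D (a *: u + v) = a *: iter j D u + iter j D v.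
  by elim: j => //= j ->; rewrite linearP.
by rewrite scalerDr !scalerA mulrC.
Qed.

Lemma divDr0 j : divD j 0 = 0.
Proof. by rewrite /divD (_ : iter j D 0 = 0) ?scaler0 //; elim: j => //= j ->; rewrite linear0. Qed.

Lemma divDD j u v : divD j (u + v) = divD j u + divD j v.
Proof. by have := divD_linear j 1 u v; rewrite !scale1r. Qed.

Lemma divDZ j a v : divD j (a *: v) = a *: divD j v.
Proof. by have := divD_linear j a v 0; rewrite !addr0 divDr0 addr0. Qed.

End Creation.

Section Expipi.
Variable R : realType.
Local Notation K := R[i].

Lemma expipiD1 (t : R) : expipi (t + 1) = - expipi t.
Proof. by rewrite /expipi mulrDl mul1r cosDpi sinDpi. Qed.

Lemma expipi_int (z : int) : expipi (z%:~R : R) = (-1) ^ z.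
Proof.
have e0 : expipi (0 : R) = 1 by rewrite /expipi mul0r cos0 sin0.
have S (x : int) : expipi ((x + 1)%:~R : R) = - expipi (x%:~R : R).
  by rewrite rmorphD expipiD1.
case: z; elim=> [|n IH]; first exact: e0.
- by rewrite -addn1 PoszD S IH signS.
- apply: oppr_inj; rewrite -S -signS.
  by have -> : Negz 0 + 1 = 0 by []; rewrite e0 expr0z.
- apply: oppr_inj; rewrite -S -signS.
  by have -> : Negz n.+1 + 1 = Negz n by rewrite !NegzE; lia.
Qed.

Lemma rbinomSl (x : R) i : i.+1%:R * rbinom x i.+1 = x * rbinom (x - 1) i.
Proof.
rewrite /rbinom big_ord_recl subr0 factS natrM invfM.
have -> : \prod_(j < i) (x - (bump 0 j)%:R) = \prod_(j < i) (x - 1 - j%:R).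
  by apply: eq_bigr => j _; rewrite /bump /= natrD opprD addrA.
have h1 : i.+1%:R != 0 :> R by rewrite pnatr_eq0.
have h2 : i`!%:R != 0 :> R by rewrite pnatr_eq0 -lt0n fact_gt0.
move: (i.+1%:R : R) (i`!%:R : R) h1 h2 => p q h1 h2.
by field; rewrite h1 h2.
Qed.

End Expipi.

(** * The meromorphic center *)

Section Center.
Variables (R : realType) (V : open_string_vertex_algebra R).
Variable Yf : V -> R -> V -> V.
Hypothesis gr : grading_restricted V.
Hypothesis fv : formal_vertex_operators Yf.
Local Notation K := R[i].
Local Notation D := (os_D V).
Local Notation vac := (os_one V).
Local Notation C0 := (meromorphic_center Yf).

Lemma natK_neq0 n : n.+1%:R != 0 :> K.
Proof. by rewrite pnatr_eq0. Qed.

Lemma mode_divD j e (u v : V) :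
  Yf (divD j u) e v = ((-1) ^+ j * rbinom e j)%:C *: Yf u (e - j%:R) v.
Proof.
elim: j e => [|j IH] e.
  by rewrite divD0 expr0 rbinom0 mul1r scale1r subr0.
apply: (scalerI (natK_neq0 j)).
rewrite -(modeZl fv) -divDS (mode_D gr fv) IH !scalerA.
have -> : e - 1 - j%:R = e - j.+1%:R by rewrite -addn1 natrD; ring.
congr (_ *: _); rewrite -(rmorph_nat (real_complex R)) -rmorphN -!rmorphM.
congr real_complex_def; rewrite exprS.
rewrite [RHS](_ : _ = - (-1) ^+ j * (j.+1%:R * rbinom e j.+1)); last by ring.
by rewrite rbinomSl; ring.
Qed.

Lemma mode_of_D n (u v : V) : Yf u n (D v) = D (Yf u n v) + n%:C *: Yf u (n - 1) v.
Proof.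
have := mode_D_bracket gr fv n u v; rewrite (mode_D gr fv) scaleNr.
move=> e; rewrite -[LHS](subKr (D (Yf u n v))) e opprK //.
Qed.

Lemma divD_sum j (J : Type) (r : seq J) (F : J -> V) :
  divD j (\sum_(i <- r) F i) = \sum_(i <- r) divD j (F i).
Proof. by elim/big_rec2: _ => [|i x y _ <-]; rewrite ?divDr0 ?divDD. Qed.

(** The mode form of Y(u,x) e^(yD) = e^(yD) Y(u,x-y), which is how powers of D are moved to the
    left. *)
Lemma mode_of_divD i n (u v : V) :
  Yf u n (divD i v) =
  \sum_(l < i.+1) (rbinom n l)%:C *: divD (i - l) (Yf u (n - l%:R) v).
Proof.
elim: i n v => [|i IH] n v.
  by rewrite big_ord_recl big_ord0 addr0 subr0 rbinom0 scale1r !divD0.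
apply: (scalerI (natK_neq0 i)).
rewrite -(modeZr fv) -divDS mode_of_D !IH linear_sum /= !scaler_sumr.
rewrite (eq_bigr (fun l : 'I_i.+1 =>
   ((i.+1 - l)%:R * rbinom n l)%:C *: divD (i.+1 - l) (Yf u (n - l%:R) v)));
  last first.
  move=> l _; rewrite linearZ /= divDS scalerA -subSn; last by rewrite -ltnS.
  by rewrite -(rmorph_nat (real_complex R)) -rmorphM mulrC.
rewrite [X in _ + X](eq_bigr (fun l : 'I_i.+1 =>
    (l.+1%:R * rbinom n l.+1)%:C *: divD (i - l) (Yf u (n - l.+1%:R) v)));
  last first.
  move=> l _; rewrite scalerA -rmorphM -rbinomSl.
  by congr (_ *: divD _ (Yf _ _ _)); rewrite -[l.+1]addn1 natrD; ring.
(* The factor i+1 is split as (i+1-l) + l: the first part comes from applying D on the left, the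
   second from the commutator. *)
rewrite [RHS](eq_bigr (fun l : 'I_i.+2 =>
   ((i.+1 - l)%:R * rbinom n l)%:C *: divD (i.+1 - l) (Yf u (n - l%:R) v) +
   (l%:R * rbinom n l)%:C *: divD (i.+1 - l) (Yf u (n - l%:R) v))); last first.
  move=> l _; rewrite -scalerDl scalerA; congr (_ *: _).
  rewrite -(rmorph_nat (real_complex R)) -rmorphM -rmorphD; congr real_complex_def.
  by rewrite -mulrDl -natrD subnK // -ltnS.
rewrite big_split /= [X in _ = X + _]big_ord_recr /= subnn mul0r scale0r addr0.
by rewrite [X in _ = _ + X]big_ord_recl mul0r scale0r add0r.
Qed.

Lemma mode_on_vacuum_neg j (w : V) : Yf w (- j%:R - 1) vac = divD j w.
Proof.
elim: j => [|j IH]; first by rewrite oppr0 sub0r divD0 (mode_on_vacuum_N1 gr fv).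
have := mode_of_D (- j%:R - 1 + 0) w vac.
rewrite addr0 (D_vacuum gr fv) (mode0r fv) IH divDS => /esym/eqP.
rewrite addr_eq0 => /eqP e; apply: (scalerI (natK_neq0 j)).
rewrite e -scaleNr -rmorphN -(rmorph_nat (real_complex R)).
have -> : - (- j%:R - 1) = j.+1%:R :> R by rewrite -addn1 natrD; ring.
by congr (_ *: Yf _ _ _); rewrite -addn1 natrD; ring.
Qed.

(** From D1 = 0 one has 0 = D w_(n+1) 1 + (n+1) w_n 1, and n+1 is not 0. So vanishing descends in
    unit steps from the indices above -1. *)
Lemma mode_on_vacuum_nonint n (w : V) : n \isn't a Num.int -> Yf w n vac = 0.
Proof.
move=> nn; have [i hi] : exists i : nat, -1 < n + i%:R.
  have [h|h] := ltP (-1) n; first by exists 0%N; rewrite addr0.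
  exists (Num.bound (- n)); have := @archi_boundP R (- n).
  by rewrite oppr_ge0 (le_trans h) ?lerN10 // => /(_ isT); lra.
elim: i n nn hi => [|i IH] n nn hi.
  by apply: (mode_on_vacuum_ge0 gr fv); rewrite addr0 in hi.
have nn1 : n + 1 \isn't a Num.int by rewrite rpredDr ?rpred1.
have := mode_of_D (n + 1) w vac.
rewrite (D_vacuum gr fv) (mode0r fv) (IH _ nn1); last first.
  by rewrite -addrA -[1 + _]addrC -(natrD _ i 1) addn1.
rewrite linear0 add0r addrK => /esym/eqP; rewrite scaler_eq0 => /orP[|/eqP //].
rewrite -normc_eq0 normc_real normr_eq0 => /eqP n0.
by move: nn1; rewrite n0 rpred0.
Qed.

Lemma divD_iter k c (v : V) : (k`!%:R^-1 * c) *: iter k D v = c *: divD k v.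
Proof. by rewrite /divD scalerA mulrC. Qed.

Lemma skew_coef_trunc (u v : V) (n : R) : exists N0, forall N, (N0 <= N)%N ->
  skew_coef Yf u v n =
  \sum_(k < N) expipi (- (n + k%:R) - 1) *: divD k (Yf u (n + k%:R) v).
Proof.
have [B hB] := mode_truncated gr fv u v.
exists (Num.bound `|B - n|) => N hN.
rewrite /skew_coef (fsum_nat (N := N)) => [|k hk].
  by apply: eq_bigr => k _; rewrite divD_iter.
rewrite hB ?divD_iter ?divDr0 ?scaler0 //.
have : `|B - n| < k%:R.
  by apply: lt_le_trans (archi_boundP (normr_ge0 _)) _; rewrite ler_nat (leq_trans hN).
by rewrite ltr_norml; lra.
Qed.

(** Skew-symmetry at an integral index, where the exponential [expipi] is the sign (-1)^(m+k+1). *)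
Definition skew_sum N (u v : V) (m : int) :=
  \sum_(k < N) ((-1) ^ (m + k%:Z + 1) : K) *: divD k (Yf u (m%:~R + k%:R) v).

Lemma center_nonint u n v : C0 u -> n \isn't a Num.int -> Yf u n v = 0.
Proof. by case=> _ h _; exact: h. Qed.

Lemma center_skew u v (m : int) : C0 u ->
  exists N0, forall N, (N0 <= N)%N -> Yf v m%:~R u = skew_sum N u v m.
Proof.
case=> _ _ h; have [N0 hN] := skew_coef_trunc u v m%:~R; exists N0 => N /hN e.
rewrite h e; apply: eq_bigr => k _; congr (_ *: _).
have -> : - (m%:~R + k%:R) - 1 = (- (m + k%:Z + 1))%:~R :> R.
  by rewrite rmorphN !rmorphD /= [RHS]opprD.
by rewrite expipi_int -exprz_inv invrN1.
Qed.

Lemma center_skew_nonint u v n : C0 u -> n \isn't a Num.int -> Yf v n u = 0.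
Proof.
move=> cu nn; case: (cu) => _ _ ->.
have [N0 /(_ N0 (leqnn _)) ->] := skew_coef_trunc u v n.
apply: big1 => k _; rewrite (center_nonint _ cu) ?divDr0 ?scaler0 //.
by rewrite rpredDr ?rpred_nat.
Qed.

(** At a non-integral index both sides of the skew-symmetry vanish under these conditions, so only
    integral indices, with signs, remain to be compared. *)
Lemma center_intro u :
  (forall n, n \isn't a Num.int -> gproj V n u = 0) ->
  (forall n v, n \isn't a Num.int -> Yf u n v = 0) ->
  (forall v n, n \isn't a Num.int -> Yf v n u = 0) ->
  (forall v (m : int), exists N0, forall N, (N0 <= N)%N ->
     Yf v m%:~R u = skew_sum N u v m) -> C0 u.
Proof.
move=> h1 h2 h3 h4; split => // v n.
have [N0 e0] := skew_coef_trunc u v n.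
have [nn|nn] := boolP (n \is a Num.int); last first.
  rewrite h3 // (e0 N0) //; apply/esym; apply: big1 => k _.
  by rewrite h2 ?divDr0 ?scaler0 // rpredDr ?rpred_nat.
have /intrP[m nm] := nn; rewrite nm in e0 *.
have [N1 e1] := h4 v m.
rewrite (e1 (maxn N0 N1)) ?leq_maxr // (e0 (maxn N0 N1)) ?leq_maxl //.
apply: eq_bigr => k _; congr (_ *: _).
have -> : - (m%:~R + k%:R) - 1 = (- (m + k%:Z + 1))%:~R :> R.
  by rewrite rmorphN !rmorphD /= [RHS]opprD.
by rewrite expipi_int -exprz_inv invrN1.
Qed.

Lemma skew_sumDl N u u' v m : skew_sum N (u + u') v m = skew_sum N u v m + skew_sum N u' v m.
Proof.
rewrite /skew_sum -big_split; apply: eq_bigr => k _.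
by rewrite (modeDl fv) divDD [LHS]scalerDr.
Qed.

Lemma skew_sumDr N u v v' m : skew_sum N u (v + v') m = skew_sum N u v m + skew_sum N u v' m.
Proof.
rewrite /skew_sum -big_split; apply: eq_bigr => k _.
by rewrite (modeDr fv) divDD [LHS]scalerDr.
Qed.

Lemma skew_sumZl N a u v m : skew_sum N (a *: u) v m = a *: skew_sum N u v m.
Proof.
rewrite /skew_sum scaler_sumr; apply: eq_bigr => k _.
by rewrite (modeZl fv) divDZ [LHS]scalerA mulrC -scalerA.
Qed.

Lemma skew_sum0r N u m : skew_sum N u 0 m = 0.
Proof. by apply: big1 => k _; rewrite (mode0r fv) divDr0 scaler0. Qed.

Lemma centerP a u v : C0 u -> C0 v -> C0 (a *: u + v).
Proof.
move=> cu cv; apply: center_intro => [n nn|n w nn|w n nn|w m].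
- by case: cu cv => h _ _ [h' _ _]; rewrite linearP h // h' // scaler0 addr0.
- by rewrite (modeDl fv) (modeZl fv) !center_nonint // scaler0 addr0.
- by rewrite (modeDr fv) (modeZr fv) !center_skew_nonint // scaler0 addr0.
have [N1 e1] := center_skew w m cu; have [N2 e2] := center_skew w m cv.
exists (maxn N1 N2) => N; rewrite geq_max => /andP[i1 i2].
by rewrite (modeDr fv) (modeZr fv) (e1 N) // (e2 N) // skew_sumDl skew_sumZl.
Qed.

Lemma center0 : C0 0.
Proof.
apply: center_intro => [n nn|n w nn|w n nn|w m].
- by rewrite linear0.
- exact: (mode0l fv).
- exact: (mode0r fv).
exists 0%N => N _; rewrite (mode0r fv); apply/esym; apply: big1 => k _.
by rewrite (mode0l fv) divDr0 scaler0.
Qed.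

Lemma gproj_divD n k (v : V) : gproj V n (divD k v) = divD k (gproj V (n - k%:R) v).
Proof.
elim/graded_ind: v => [|u v hu hv|q v hv].
- by rewrite !(divDr0, linear0).
- by rewrite !(divDD, linearD) hu hv.
have hk : homog (q + k%:R) (divD k v).
  apply: homogZ; elim: k => [|k IH] /=; first by rewrite addr0.
  by rewrite -addn1 natrD addrA; exact: homogDop.
rewrite (gproj_homog _ hk) (gproj_homog _ hv).
have -> : (n - k%:R == q) = (n == q + k%:R) by rewrite subr_eq.
by case: ifP; rewrite ?divDr0.
Qed.

Lemma homog_divD q k (v : V) : homog q v -> homog (q + k%:R) (divD k v).
Proof. by move=> hv; rewrite /homog /= gproj_divD addrK hv. Qed.

Lemma mode_gprojl p q n (u v : V) : homog q v ->
  Yf (gproj V p u) n v = gproj V (p + q - n - 1) (Yf u n v).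
Proof.
move=> hv; elim/graded_ind: u => [|u u' hu hu'|p' u hu].
- by rewrite linear0 !(mode0l fv) linear0.
- by rewrite linearD !(modeDl fv) linearD hu hu'.
rewrite (gproj_homog _ hu) (gproj_homog _ (mode_homog fv n hu hv)).
have -> : (p + q - n - 1 == p' + q - n - 1) = (p == p').
  by apply/eqP/eqP => ?; lra.
by case: ifP => // _; exact: (mode0l fv).
Qed.

Lemma mode_gprojr p q n (u v : V) : homog q v ->
  Yf v n (gproj V p u) = gproj V (p + q - n - 1) (Yf v n u).
Proof.
move=> hv; elim/graded_ind: u => [|u u' hu hu'|p' u hu].
- by rewrite linear0 !(mode0r fv) linear0.
- by rewrite linearD !(modeDr fv) linearD hu hu'.
rewrite (gproj_homog _ hu) (gproj_homog _ (mode_homog fv n hv hu)).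
have -> : (p + q - n - 1 == q + p' - n - 1) = (p == p').
  by apply/eqP/eqP => ?; lra.
by case: ifP => // _; exact: (mode0r fv).
Qed.

(** Each condition is compatible with weights: against a homogeneous v, projecting u amounts to
    projecting the result. This reduces the Jacobi identity to homogeneous elements of the
    center. *)
Lemma center_gproj p u : C0 u -> C0 (gproj V p u).
Proof.
move=> cu; apply: center_intro => [n nn|n v nn|v n nn|v m].
- by case: cu => h _ _; rewrite gprojE; case: ifP => // /eqP <-; rewrite h.
- elim/graded_ind: v => [|v v' hv hv'|q v hv]; first exact: (mode0r fv).
    by rewrite (modeDr fv) hv hv' addr0.
  by rewrite (mode_gprojl _ _ _ hv) center_nonint // linear0.
- elim/graded_ind: v => [|v v' hv hv'|q v hv]; first exact: (mode0l fv).
    by rewrite (modeDl fv) hv hv' addr0.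
  by rewrite (mode_gprojr _ _ _ hv) center_skew_nonint // linear0.
elim/graded_ind: v => [|v v' [N1 h1] [N2 h2]|q v hv].
- by exists 0%N => N _; rewrite (mode0l fv) skew_sum0r.
- exists (maxn N1 N2) => N; rewrite geq_max => /andP[i1 i2].
  by rewrite (modeDl fv) (h1 N) // (h2 N) // skew_sumDr.
have [N0 h] := center_skew v m cu; exists N0 => N hN.
rewrite (mode_gprojr _ _ _ hv) (h N) // linear_sum; apply: eq_bigr => k _.
rewrite linearZ /= gproj_divD (mode_gprojl _ _ _ hv).
by congr (_ *: divD _ (gproj _ _ _)); ring.
Qed.

Lemma center_vacuum : C0 vac.
Proof.
have nn1 n : n \isn't a Num.int -> (n == -1) = false.
  by move=> nn; apply: contraNF nn => /eqP ->; rewrite rpredN rpred1.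
apply: center_intro => [n nn|n v nn|v n nn|v m].
- rewrite (gproj_homog _ (homog_vacuum gr)) ifF //.
  by apply: contraNF nn => /eqP ->; rewrite rpred0.
- by rewrite (mode_vacuum gr fv) nn1.
- exact: mode_on_vacuum_nonint.
have E k : (m%:~R + k%:R == -1 :> R) = (m + k%:Z == -1).
  rewrite -[LHS](_ : ((m + k%:Z)%:~R == (-1)%:~R :> R) = _); first by rewrite eqr_int.
  by rewrite rmorphD.
exists (absz m).+1 => N hN; rewrite /skew_sum.
under eq_bigr => k _ do rewrite (mode_vacuum gr fv) E.
have [m0|m0] := ltP m 0.
  (* For m < 0 the only surviving term is k = -m-1, where the mode of the vacuum is the identity; it
     is D^k v / k!, that is, v_m applied to the vacuum. *)
  have mN : (absz (m + 1)%R < N)%N by lia.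
  rewrite (bigD1 (Ordinal mN)) //= big1 => [|k kN]; last first.
    rewrite ifF ?divDr0 ?scaler0 //; apply/negP => /eqP e.
    by move/negP: kN; apply; apply/eqP/val_inj => /=; lia.
  have -> : m + (absz (m + 1))%:Z = -1 by lia.
  rewrite eqxx addNr expr0z scale1r addr0 -mode_on_vacuum_neg.
  have em : m = - (absz (m + 1))%:Z - 1 by lia.
  by congr (Yf _ _ _); rewrite [in LHS]em rmorphB rmorphN.
rewrite (mode_on_vacuum_ge0 gr fv); last first.
  by rewrite (lt_le_trans (ltrN10 R)) // ler0z.
apply/esym; apply: big1 => k _; rewrite ifF ?divDr0 ?scaler0 //.
by apply/negP => /eqP; lia.
Qed.

End Center.

(** * Translation by e^(rD) and resummation of the skew-symmetry *)

Section Resummation.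
Variable R : realType.
Local Notation K := R[i].

Lemma rbinom_reflect (x : R) l : rbinom (x + l%:R) l = (-1) ^+ l * rbinom (- x - 1) l.
Proof.
rewrite /rbinom mulrA; congr (_ / _).
rewrite -[l in (-1) ^+ l]card_ord -prodr_const -big_split /=.
rewrite (reindex_inj rev_ord_inj) /=; apply: eq_bigr => j _.
rewrite natrB; last exact: ltn_ord.
by rewrite -addn1 natrD; ring.
Qed.

Lemma normr_rbinom_le (y z : R) l : (forall i : nat, `|y - i%:R| <= `|z - i%:R|) ->
  `|rbinom y l| <= `|rbinom z l|.
Proof.
move=> h; rewrite /rbinom !normrM !normr_prod.
by apply: ler_wpM2r => //; apply: ler_prod => i _; rewrite normr_ge0 h.
Qed.

Lemma powR_nat_shift (a x : R) (l : nat) : 0 < a -> a `^ (x - l%:R) = a `^ x * a^-1 ^+ l.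
Proof.
move=> a0; rewrite powRD; last by apply/implyP => _; rewrite gt_eqF.
by rewrite powR_invn ?ltW // exprVn.
Qed.

(** When e^(rD) passes a mode, the mode x+l at radius 1+r is turned into the mode x by absorbing D^l
    / l!; this is the resulting factor. *)
Definition translate_coef (x r : R) (l : nat) : R :=
  rbinom (x + l%:R) l * r ^+ l * (1 + r) `^ (- (x + l%:R) - 1).

Lemma translate_coefE (x r : R) l : 0 < 1 + r ->
  translate_coef x r l =
  (1 + r) `^ (- x - 1) * (rbinom (- x - 1) l * (- (r / (1 + r))) ^+ l).
Proof.
move=> r0; rewrite /translate_coef rbinom_reflect.
have -> : - (x + l%:R) - 1 = (- x - 1) - l%:R by ring.
rewrite powR_nat_shift // [(- (r / (1 + r))) ^+ l]exprNn exprMn.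
by move: (_ `^ _) (rbinom _ _) (r ^+ l) (_^-1 ^+ l) ((-1) ^+ l) => a b c d e; ring.
Qed.

(* The expansion of ((1 + r) - r)^(- x - 1) in powers of r. *)
Lemma has_sum_translate (x r : R) : 0 < 1 + r -> `|r| < 1 + r ->
  has_sum (fun l => (translate_coef x r l)%:C) 1.
Proof.
move=> r0 r1.
have n1 : `|- (r / (1 + r))| < 1.
  by rewrite normrN normrM normfV (gtr0_norm r0) ltr_pdivrMr // mul1r.
have -> : 1 = ((1 + r) `^ (- x - 1))%:C * ((1 + - (r / (1 + r))) `^ (- x - 1))%:C :> K.
  rewrite -rmorphM -powRM ?(ltW r0) //; last by move: n1; rewrite ltr_norml; lra.
  have -> : (1 + r) * (1 + - (r / (1 + r))) = 1 by field; rewrite gt_eqF.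
  by rewrite powR1.
apply: eq_has_sum (has_sumZ ((1 + r) `^ (- x - 1))%:C
  (@binomial_series R (- x - 1) _ n1)) => l.
by rewrite translate_coefE // -rmorphM.
Qed.

(** Replacing x by |x| enlarges every factor of the binomial coefficient in absolute value and makes
    the exponent -|x|-1 negative, so that the alternating case applies. *)
Lemma bounded_sums_translate (x r : R) : 0 < 1 + r -> `|r| < 1 + r ->
  bounded_sums (fun l => `|translate_coef x r l|)
    ((1 + r) `^ (- x - 1) * (1 - `|r| / (1 + r)) `^ (- `|x| - 1)).
Proof.
move=> r0 r1.
have q1 : 0 <= `|r| / (1 + r) < 1.
  by rewrite divr_ge0 ?(ltW r0) //= ltr_pdivrMr // mul1r.
have x0 : - `|x| - 1 <= 0 by have := normr_ge0 x; lra.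
apply: bounded_sums_le (bounded_sumsZ (powR_ge0 _ _) (bounded_sums_rbinom_le0 x0 q1)).
move=> l; rewrite translate_coefE // normrM (ger0_norm (powR_ge0 _ _)).
apply: ler_wpM2l; first exact: powR_ge0.
have hr : `|- (r / (1 + r))| = `|r| / (1 + r).
  by rewrite normrN normrM normfV (gtr0_norm r0).
rewrite normrM normrX hr.
apply: ler_wpM2r; first by rewrite exprn_ge0 //; case/andP: q1.
apply: normr_rbinom_le => i; have i0 : 0 <= i%:R :> R by [].
have -> : - x - 1 - i%:R = - (x + (1 + i%:R)) by ring.
have -> : - `|x| - 1 - i%:R = - (`|x| + (1 + i%:R)) by ring.
rewrite !normrN [leRHS]ger0_norm; last by have := normr_ge0 x; lra.
by apply: le_trans (ler_normD _ _) _; rewrite lerD2l ger0_norm //; lra.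
Qed.

Lemma realC_expz (x : R) (k : int) : (x ^ k)%:C = x%:C ^ k :> K.
Proof.
by case: k => n; rewrite ?NegzE -?exprnN -?exprnP ?fmorphV rmorphXn.
Qed.

(** The coefficient form of Y(Y(w1,t)u,1-t) = Y(e^(tD)Y(u,-t)w1,1-t) = Y(Y(u,-t)w1,1). The double
    series indexed by k = n+j and j is summed over j first: each row is an expansion of
    ((1-t)+t)^(k-s-1) = 1, leaving the series of c at -t. *)
Lemma skew_resummation (c : int -> K) (s t : R) (N : int) (g : int -> K) (S : K) :
  (forall k, N <= k -> c k = 0) ->
  (forall x : R, 0 < x < 1 -> term_bounded c x) -> 0 < t < 1 / 3 ->
  (forall n : int, has_sum (fun j : nat =>
     (-1) ^ (n + 1) * (rbinom (s - n%:~R) j)%:C * c (n + j%:Z)) (g n)) ->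
  has_sum (fun n : int =>
     (t ^ (- n - 1) * (1 - t) `^ (- (s - n%:~R) - 1))%:C * g n) S ->
  has_sum (fun k => c k * (- t)%:C ^ (- k - 1)) S.
Proof.
move=> c0 cb /andP[t0 t1] hg hS.
have r0 : 0 < 1 + - t by lra.
have r1 : `|- t| < 1 + - t by rewrite normrN gtr0_norm //; lra.
pose F (p : int * nat) : K := c p.1 * (- t)%:C ^ (- p.1 - 1) *
  (translate_coef (s - p.1%:~R) (- t) p.2)%:C.
have rowF k : has_sum (fun j => F (k, j)) (c k * (- t)%:C ^ (- k - 1)).
  rewrite -[X in has_sum _ X]mulr1.
  exact: (has_sumZ (c k * (- t)%:C ^ (- k - 1))
    (@has_sum_translate (s - k%:~R) _ r0 r1)).
pose q := 1 - t / (1 - t).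
have q0 : 0 < q by rewrite /q subr_gt0 ltr_pdivrMr; lra.
have q1 : q <= 1 by rewrite /q gerBl divr_ge0; lra.
have q01 : 0 < q <= 1 by rewrite q0.
have qt : q * (1 - t) = 1 - 2 * t by rewrite /q; field; apply/eqP; lra.
(* The k-th row of absolute values is bounded by a constant times |c_k| x^k. The series c is
   controlled for x > 1, which is t < 1/3: this is the origin of the bound 1/3. *)
pose x := (1 - 2 * t) / t.
have x1 : 1 < x by rewrite /x ltr_pdivlMr //; lra.
pose A := t^-1 * (1 - 2 * t) `^ (- s - 1) * q `^ (- (2 * `|s - N%:~R|)).
have A0 : 0 <= A by rewrite !mulr_ge0 ?powR_ge0 // invr_ge0 ltW.
have nt k : normc ((- t)%:C ^ (- k - 1) : K) = t ^ (- k - 1).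
  have nN (n : nat) : normc ((- t)%:C ^+ n : K) = t ^+ n.
    by rewrite normcX normc_real normrN gtr0_norm.
  case: (- k - 1) => n; first exact: nN.
  by rewrite NegzE -!exprnN normcV nN.
have bk k : bounded_sums (fun j => normc (F (k, j))) (A * (normc (c k) * x ^ k)).
  have [hk|hk] := leP N k.
    move=> B; rewrite big1 ?(c0 k hk) ?normc0 ?mul0r ?mulr0 // => j _.
    by rewrite /F /= c0 // !mul0r normc0.
  have e0 : 0 <= normc (c k) * t ^ (- k - 1).
    by rewrite mulr_ge0 ?normc_ge0 // exprz_ge0 // ltW.
  have hb := bounded_sumsZ e0 (bounded_sums_translate (s - k%:~R) r0 r1).
  move=> B; apply: le_trans (_ : normc (c k) * t ^ (- k - 1) *
    ((1 + - t) `^ (- (s - k%:~R) - 1) *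
     (1 - `|- t| / (1 + - t)) `^ (- `|s - k%:~R| - 1)) <= _).
    apply: le_trans (hb B); apply: ler_sum => j _.
    by rewrite /F !normcM nt normc_real.
  rewrite normrN (gtr0_norm t0) -/q.
  (* Since k < N, the absolute value |s-k| exceeds s-k by at most 2 |s-N|, a bound independent of
     k. *)
  have h2 : q `^ (- `|s - k%:~R| - 1) <=
      q `^ (- (2 * `|s - N%:~R|)) * q `^ (- (s - k%:~R) - 1).
    rewrite -powRD; last by apply/implyP => _; rewrite gt_eqF.
    apply: (ger_powR q01).
    have hkN : k%:~R < N%:~R :> R by rewrite ltr_int.
    have := ler_norm (s - N%:~R); have := ler_norm (- (s - N%:~R)).
    rewrite normrN; have [h|h] := leP 0 (s - k%:~R).
      by rewrite (ger0_norm h); lra.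
    by rewrite (ltr0_norm h); lra.
  have ck : 0 <= normc (c k) * t ^ (- k - 1) * (1 - t) `^ (- (s - k%:~R) - 1).
    by rewrite mulr_ge0 ?powR_ge0.
  rewrite mulrA; apply: le_trans (ler_wpM2l ck h2) _.
  have -> : normc (c k) * t ^ (- k - 1) * (1 - t) `^ (- (s - k%:~R) - 1) *
      (q `^ (- (2 * `|s - N%:~R|)) * q `^ (- (s - k%:~R) - 1)) =
      normc (c k) * t ^ (- k - 1) * q `^ (- (2 * `|s - N%:~R|)) *
      (q * (1 - t)) `^ (- (s - k%:~R) - 1).
    rewrite powRM ?(ltW q0) //; last lra.
    by ring.
  rewrite qt /A /x.
  have t2 : 0 < 1 - 2 * t by lra.
  have -> : - (s - k%:~R) - 1 = (- s - 1) + k%:~R by ring.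
  rewrite powRD; last by apply/implyP => _; rewrite gt_eqF.
  rewrite powR_intmul ?(ltW t2) // expfzMl.
  have -> : t ^ (- k - 1) = t^-1 * t^-1 ^ k.
    by rewrite exprz_inv -[t^-1]exprN1 -expfzDr ?gt_eqF //; congr (_ ^ _); ring.
  rewrite le_eqVlt; apply/orP; left; apply/eqP.
  move: (t^-1 ^ k) ((1 - 2 * t) ^ k) (_ `^ (- s - 1)) (q `^ _) => a1 a2 a3 a4.
  by ring.
have [M hM] : exists M, bounded_sums (fun k => normc (c k) * x ^ k) M.
  pose y := (1 + x) / 2.
  have y0 : 0 < y by rewrite /y; lra.
  have [|M hM] := cb y^-1; first by rewrite invr_gt0 y0 invf_lt1 //= /y; lra.
  apply: (one_sided_bounded (N := N - 1) _ y0 (M := M)).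
  - by move=> k hk; apply: c0; lia.
  - by rewrite /y; lra.
  by move=> k; have := hM k; rewrite exprz_inv opprK.
have hF := bounded_sums_pair (fun p => normc_ge0 (F p)) bk (bounded_sumsZ A0 hM).
have [T hT] := bounded_has_sum hF.
have h1 := has_sum_rows hT rowF.
suff -> : S = T by exact: h1.
(* A bijection from the pairs (n,j) of the skew-symmetry to the pairs (k,j) of the double series. *)
pose e (p : int * nat) : int * nat := (p.1 + p.2%:Z, p.2).
have einj : injective e.
  by move=> [a i] [b j] [/= h ij]; rewrite ij in h *; congr (_, _); lia.
have hG : has_sum (fun p => F (e p)) T.
  apply: (@has_sum_reindex _ _ _ e _ T einj _).1 hT => -[k j] /(_ (k - j%:Z, j)).
  by rewrite /e /= subrK.
apply: has_sum_unique hS _; apply: has_sum_rows hG _ => n.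
apply: eq_has_sum (has_sumZ (t ^ (- n - 1) * (1 - t) `^ (- (s - n%:~R) - 1))%:C (hg n)) => j.
rewrite /F /e /translate_coef /=.
have -> : s - (n + j%:Z)%:~R + j%:R = s - n%:~R by rewrite rmorphD /=; ring.
have tC : (- t)%:C != 0 :> K.
  by rewrite -normc_eq0 normc_real normrN gtr0_norm // gt_eqF.
have hj : (- t)%:C ^ (- (n + j%:Z) - 1) * (- t)%:C ^+ j =
    (-1) ^ (n + 1) * (t ^ (- n - 1))%:C :> K.
  rewrite exprnP -expfzDr // (_ : - (n + j%:Z) - 1 + j%:Z = - (n + 1)); last by ring.
  have -> : - n - 1 = - (n + 1) by ring.
  rewrite realC_expz rmorphN -mulN1r expfzMl; congr (_ * _).
  by rewrite -exprz_inv invrN1.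
move: (rbinom _ j) (_ `^ _) => rb pw.
rewrite !rmorphM rmorphXn /=; apply/esym.
transitivity ((- t)%:C ^ (- (n + j%:Z) - 1) * (- t)%:C ^+ j *
  (c (n + j%:Z) * rb%:C * pw%:C)); last by rewrite hj; ring.
by move: (_ ^ (- (n + j%:Z) - 1)) (_ ^+ j) => z1 z2; ring.
Qed.

End Resummation.

(** * Matrix coefficients of products and iterates *)

Section MatrixCoefficients.
Variables (R : realType) (V : open_string_vertex_algebra R).
Variable Yf : V -> R -> V -> V.
Hypothesis gr : grading_restricted V.
Hypothesis fv : formal_vertex_operators Yf.
Local Notation K := R[i].
Local Notation C0 := (meromorphic_center Yf).

Lemma product_term_mode (A B C : V) (pA pB pC p mu r1 r2 : R) (phi : {scalar V}) :
  homog pA A -> homog pB B -> homog pC C -> 0 < r1 -> 0 < r2 ->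
  pairing (comp_functional phi p) (product_term (os_Y (o:=V)) A r1 [:: (B, r2)] [:: mu] C) =
  (r1 `^ (p - pA - mu) * r2 `^ (mu - pB - pC))%:C *
  phi (Yf A (pA + mu - p - 1) (Yf B (pB + pC - mu - 1) C)).
Proof.
move=> hA hB hC r10 r20.
rewrite (pairing_comp phi p (@os_Y_completion R V _ _ _ r10)).
rewrite /product_term /= (os_Y_mode gr fv _ hB hC r20).
have hBC : homog mu (Yf B (pB + pC - mu - 1) C).
  have := mode_homog fv (pB + pC - mu - 1) hB hC.
  by rewrite (_ : pB + pC - _ - 1 = mu) //; ring.
rewrite (os_Y_mode gr fv _ hA (homogZ _ hBC) r10) (modeZr fv) !linearZ /=.
by rewrite rmorphM mulrA.
Qed.

Lemma iterate_term_mode (A B C : V) (pA pB pC p mu r0 r2 : R) (phi : {scalar V}) :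
  homog pA A -> homog pB B -> homog pC C -> 0 < r0 -> 0 < r2 ->
  pairing (comp_functional phi p) (iterate_term (os_Y (o:=V)) A r0 B r2 mu C) =
  (r0 `^ (mu - pA - pB) * r2 `^ (p - mu - pC))%:C *
  phi (Yf (Yf A (pA + pB - mu - 1) B) (mu + pC - p - 1) C).
Proof.
move=> hA hB hC r00 r20.
rewrite (pairing_comp phi p (@os_Y_completion R V _ _ _ r20)).
rewrite /iterate_term (os_Y_mode gr fv _ hA hB r00).
have hAB : homog mu (Yf A (pA + pB - mu - 1) B).
  have := mode_homog fv (pA + pB - mu - 1) hA hB.
  by rewrite (_ : pA + pB - _ - 1 = mu) //; ring.
rewrite (os_Y_mode gr fv _ (homogZ _ hAB) hC r20) (modeZl fv) !linearZ /=.
by rewrite mulrCA mulrA -rmorphM.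
Qed.

Lemma has_sum_int_shift (f : R -> K) (sigma : R) (S : K) :
  (forall mu, mu - sigma \isn't a Num.int -> f mu = 0) ->
  has_sum f S -> has_sum (fun m : int => f (sigma + m%:~R)) S.
Proof.
move=> f0 hS.
apply: (@has_sum_reindex _ _ _ (fun m : int => sigma + m%:~R) f S _ _).1 hS.
  by move=> i j /addrI /intr_inj.
move=> mu hmu; apply: f0; apply/negP => /intrP[m e].
by apply: (hmu m); rewrite -e addrC subrK.
Qed.

Lemma has_sum_int_opp (f : int -> K) (S : K) :
  has_sum f S -> has_sum (fun m : int => f (- m)) S.
Proof.
move=> hS; apply: (@has_sum_reindex _ _ _ (fun m : int => - m) f S _ _).1 hS.
  exact: oppr_inj.
by move=> j /(_ (- j)); rewrite opprK.
Qed.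

Variables (u w1 w2 : V) (pu q1 q2 s : R) (phi : {scalar V}).
Hypotheses (hu : homog pu u) (h1 : homog q1 w1) (h2 : homog q2 w2) (cu : C0 u).
(** The common weight of the three kinds of composite modes with indices adding up to s; the
    functional therefore sees all m and nothing else. *)
Let p := pu + q1 + q2 - 2 - s.

Definition coef_product (m : int) : K := phi (Yf u m%:~R (Yf w1 (s - m%:~R) w2)).
Definition coef_opposite (m : int) : K := phi (Yf w1 (s - m%:~R) (Yf u m%:~R w2)).
Definition coef_iterate (m : int) : K := phi (Yf (Yf u m%:~R w1) (s - m%:~R) w2).

Let nonint_shift (x y : R) : x - y \isn't a Num.int -> forall z : R,
  z = x - y -> z \isn't a Num.int.
Proof. by move=> h z ->. Qed.

Let product_at (m : int) (r1 r2 : R) : 0 < r1 -> 0 < r2 ->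
  pairing (comp_functional phi p)
    (product_term (os_Y (o:=V)) u r1 [:: (w1, r2)] [:: (p + 1 - pu) + m%:~R] w2) =
  (r1 ^ (- m - 1) * r2 `^ (m%:~R + (p + 1 - pu) - q1 - q2))%:C * coef_product m.
Proof.
move=> r10 r20; rewrite (product_term_mode _ _ _ hu h1 h2 r10 r20).
rewrite -(powR_intmul _ (ltW r10)) rmorphB rmorphN /=.
congr ((_ `^ _ * _ `^ _)%:C * phi (Yf _ _ (Yf _ _ _))); rewrite /p; ring.
Qed.

Let opposite_at (m : int) (r1 r2 : R) : 0 < r1 -> 0 < r2 ->
  pairing (comp_functional phi p)
    (product_term (os_Y (o:=V)) w1 r1 [:: (u, r2)] [:: (pu + q2 - 1) - m%:~R] w2) =
  (r1 `^ (p - q1 - (pu + q2 - 1 - m%:~R)) * r2 ^ (- m - 1))%:C * coef_opposite m.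
Proof.
move=> r10 r20; rewrite (product_term_mode _ _ _ h1 hu h2 r10 r20).
rewrite -(powR_intmul _ (ltW r20)) rmorphB rmorphN /=.
congr ((_ * _ `^ _)%:C * phi (Yf _ _ (Yf _ _ _))); rewrite /p; ring.
Qed.

Let iterate_at (m : int) (r0 r2 : R) : 0 < r0 -> 0 < r2 ->
  pairing (comp_functional phi p)
    (iterate_term (os_Y (o:=V)) u r0 w1 r2 ((pu + q1 - 1) - m%:~R) w2) =
  (r0 ^ (- m - 1) * r2 `^ (p - (pu + q1 - 1 - m%:~R) - q2))%:C * coef_iterate m.
Proof.
move=> r00 r20; rewrite (iterate_term_mode _ _ _ hu h1 h2 r00 r20).
rewrite -(powR_intmul _ (ltW r00)) rmorphB rmorphN /=.
congr ((_ `^ _ * _)%:C * phi (Yf (Yf _ _ _) _ _)); rewrite /p; ring.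
Qed.

Let int_ge (N : R) : exists M : int, N <= M%:~R.
Proof.
exists (Num.bound `|N|)%:Z.
by apply: le_trans (ler_norm N) (ltW (archi_boundP (normr_ge0 N))).
Qed.

Let bound_shift (f : int -> K) (x M : R) : 0 < x ->
  (forall m, normc (f m) * x ^ (- m - 1) <= M) -> term_bounded f x.
Proof.
move=> x0 h; exists (M * x) => m.
have -> : x ^ (- m) = x ^ (- m - 1) * x.
  by rewrite -{3}[x]expr1z -expfzDr ?gt_eqF // subrK.
by rewrite mulrA ler_wpM2r // ltW.
Qed.

(** One radius is set to 1, so its powers disappear and z or z-1 is the other one, up to sign. Modes
    of u at non-integral indices vanish, so the sums over real intermediate weights become sums over
    integers. *)
Lemma center_expansions : expansions coef_product coef_opposite coef_iterate.
Proof.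
have pos1 : 0 < (1 : R) by [].
split.
- have [N hN] := mode_truncated gr fv w1 w2.
  have [M hM] := int_ge (N - s).
  exists (- M) => m hm; rewrite /coef_product hN ?(mode0r fv) ?linear0 //.
  have : m%:~R < - M%:~R :> R by rewrite -rmorphN /= ltr_int.
  lra.
- have [N hN] := mode_truncated gr fv u w2.
  have [M hM] := int_ge N.
  exists M => m hm; rewrite /coef_opposite hN ?(mode0r fv) ?linear0 //.
  by apply: le_trans hM _; rewrite ler_int.
- have [N hN] := mode_truncated gr fv u w1.
  have [M hM] := int_ge N.
  exists M => m hm; rewrite /coef_iterate hN ?(mode0l fv) ?linear0 //.
  by apply: le_trans hM _; rewrite ler_int.
- move=> x x1; have x0 : 0 < x by lra.
  have [||M hM] := abs_convergent_bounded (@os_products_cvg R V _ u x [:: (w1, 1)] w2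
    (graded_dual_comp phi p) _ _).
  + by rewrite /= x1.
  + by rewrite /= x0 pos1.
  apply: (bound_shift (M := M) x0) => m.
  have := bounded_sums_term [tuple (p + 1 - pu) + m%:~R] hM.
  rewrite /= product_at // powR1 mulr1 normcM normc_real (ger0_norm (exprz_ge0 _ (ltW x0))).
  by rewrite mulrC.
- move=> x /andP[x0 x1].
  have [||M hM] := abs_convergent_bounded (@os_products_cvg R V _ w1 1 [:: (u, x)] w2
    (graded_dual_comp phi p) _ _).
  + by rewrite /= x1.
  + by rewrite /= x0 pos1.
  apply: (bound_shift (M := M) x0) => m.
  have := bounded_sums_term [tuple (pu + q2 - 1) - m%:~R] hM.
  rewrite /= opposite_at // powR1 mul1r normcM normc_real (ger0_norm (exprz_ge0 _ (ltW x0))).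
  by rewrite mulrC.
- move=> x /andP[x0 x1].
  have [M hM] := abs_convergent_bounded (@os_iterates_cvg R V _ u w1 w2 x 1
    (graded_dual_comp phi p) x0 x1).
  apply: (bound_shift (M := M) x0) => m.
  have := bounded_sums_term ((pu + q1 - 1) - m%:~R) hM.
  rewrite /= iterate_at // powR1 mulr1 normcM normc_real (ger0_norm (exprz_ge0 _ (ltW x0))).
  by rewrite mulrC.
- move=> t /andP[t0 t1].
  have [||S hP hI] := @os_associativity R V _ u w1 w2 (1 + t) 1 (graded_dual_comp phi p).
  + by rewrite ltrDl.
  + by rewrite addrC addKr.
  have t2 : 0 < 1 + t by lra.
  exists S; split.
    apply: eq_has_sum (has_sum_int_shift (sigma := p + 1 - pu) _ hP) => [m|mu hmu].
      by rewrite product_at // powR1 mulr1 realC_expz mulrC.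
    rewrite (product_term_mode _ _ _ hu h1 h2 t2 pos1) center_nonint //.
      by rewrite linear0 mulr0.
    by apply: nonint_shift hmu _ _; ring.
  apply: eq_has_sum (has_sum_int_opp (has_sum_int_shift (sigma := pu + q1 - 1) _ hI))
    => [m|mu hmu].
    rewrite rmorphN /= iterate_at //; last by rewrite addrC addKr.
    by rewrite powR1 mulr1 addrC addKr realC_expz mulrC.
  rewrite (iterate_term_mode _ _ _ hu h1 h2 _ pos1); last by rewrite addrC addKr.
  rewrite [Yf u _ w1]center_nonint ?(mode0l fv) ?linear0 ?mulr0 //.
  rewrite -rpredN; apply: nonint_shift hmu _ _; ring.
- move=> t /andP[t0 t1].
  have t2 : 0 < 1 - t by lra.
  have tt : 1 - (1 - t) = t by ring.
  have [||S hP hI] := @os_associativity R V _ w1 u w2 1 (1 - t) (graded_dual_comp phi p).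
  + by lra.
  + by rewrite tt; lra.
  rewrite tt in hI.
  exists S; split.
    apply: eq_has_sum (has_sum_int_opp (has_sum_int_shift (sigma := pu + q2 - 1) _ hP))
      => [m|mu hmu].
      by rewrite rmorphN /= opposite_at // powR1 mul1r realC_expz mulrC.
    rewrite (product_term_mode _ _ _ h1 hu h2 pos1 t2).
    rewrite [Yf u _ w2]center_nonint ?(mode0r fv) ?linear0 ?mulr0 //.
    rewrite -rpredN; apply: nonint_shift hmu _ _; ring.
  have [N hN] := mode_truncated gr fv u w1.
  have [M hM] := int_ge N.
  have c0 k : M <= k -> coef_iterate k = 0.
    move=> hk; rewrite /coef_iterate hN ?(mode0l fv) ?linear0 //.
    by apply: le_trans hM _; rewrite ler_int.
  pose g (n : int) := phi (Yf (Yf w1 n%:~R u) (s - n%:~R) w2).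
  refine (@skew_resummation R coef_iterate s t M g S c0 _ _ _ _).
  - move=> x /andP[x0 x1].
    have [B hB] := abs_convergent_bounded (@os_iterates_cvg R V _ u w1 w2 x 1
      (graded_dual_comp phi p) x0 x1).
    apply: (bound_shift (M := B) x0) => m.
    have := bounded_sums_term ((pu + q1 - 1) - m%:~R) hB.
    rewrite /= iterate_at // powR1 mulr1 normcM normc_real (ger0_norm (exprz_ge0 _ (ltW x0))).
    by rewrite mulrC.
  - by rewrite t0.
  (* The sign (-1)^(n+j+1) of the skew-symmetry and the sign (-1)^j from the mode of D^j / j!
     combine to (-1)^(n+1). *)
  - move=> n; have [N0 sk] := center_skew gr fv w1 n cu.
    pose J := maxn N0 (absz (M - n)).
    have -> : g n = \sum_(j < J) (-1) ^ (n + 1) * (rbinom (s - n%:~R) j)%:C *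
        coef_iterate (n + j%:Z).
      rewrite /g (sk J) ?leq_maxl // /skew_sum (mode_suml fv) linear_sum.
      apply: eq_bigr => j _; rewrite (modeZl fv) (mode_divD gr fv) !linearZ /=.
      rewrite /coef_iterate rmorphD /= rmorphM rmorphXn rmorphN rmorph1 !mulrA.
      have -> : s - n%:~R - j%:R = s - (n%:~R + j%:R) by ring.
      congr (_ * _ * _); rewrite addrAC expfzDr ?oppr_eq0 ?oner_eq0 //.
      by rewrite -mulrA -exprnP -exprMn mulrNN mulr1 expr1n mulr1.
    apply: (has_sum_nat_fin (f := fun j : nat => (-1) ^ (n + 1) *
      (rbinom (s - n%:~R) j)%:C * coef_iterate (n + j%:Z))) => j.
    by rewrite /J geq_max => /andP[_ hj]; rewrite c0 ?mulr0 //; lia.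
  apply: eq_has_sum (has_sum_int_opp (has_sum_int_shift (sigma := pu + q1 - 1) _ hI))
    => [m|mu hmu].
    rewrite rmorphN /= (iterate_term_mode _ _ _ h1 hu h2 t0 t2) /g.
    rewrite -(powR_intmul _ (ltW t0)) rmorphB rmorphN /=.
    congr ((_ `^ _ * _ `^ _)%:C * phi (Yf (Yf _ _ _) _ _)); rewrite /p; ring.
  rewrite (iterate_term_mode _ _ _ h1 hu h2 t0 t2).
  rewrite [Yf w1 _ u](center_skew_nonint gr fv) ?(mode0l fv) ?linear0 ?mulr0 //.
  rewrite -rpredN; apply: nonint_shift hmu _ _; ring.
Qed.

End MatrixCoefficients.

(** * Resumming powers of D moved through two modes *)

Section TranslateResummation.
Variable R : realType.
Local Notation K := R[i].

(** Groups the pairs (p,l) by the total power j = p + l + Q of D, with Q held fixed. *)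
Lemma has_sum_antidiagonal (F : nat * nat -> K) (S : K) (Q : nat) : has_sum F S ->
  has_sum (fun j => \sum_(p < j.+1) if (p + Q <= j)%N then F (p : nat, (j - p - Q)%N) else 0) S.
Proof.
move=> hF.
pose G (x : nat * nat) := if (x.2 + Q <= x.1)%N then F (x.2, (x.1 - x.2 - Q)%N) else 0.
pose e (x : nat * nat) := (x.1 + x.2 + Q, x.1)%N.
have einj : injective e by move=> [a b] [c d] [] /= h1 h2; congr (_, _); lia.
have G0 x : (forall y, x <> e y) -> G x = 0.
  move=> h; rewrite /G; case: ifP => // le; case: (h (x.2, x.1 - x.2 - Q)%N).
  by case: x le {h} => a b /= le; rewrite /e /=; congr (_, _); lia.
have hG : has_sum G S.
  apply/(has_sum_reindex S einj G0); apply: eq_has_sum hF => -[a b].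
  rewrite /G /e /=; case: ifP => [_|/negP[]]; last by lia.
  by congr F; congr (_, _); lia.
apply: (@has_sum_rows _ _ _ G _ S hG) => j.
apply: (has_sum_nat_fin (f := fun p => G (j, p))) => p jp.
by rewrite /G /=; case: ifP => //; lia.
Qed.

Lemma sum_cutoff (f : nat -> K) (k i : nat) : (forall Q, (k <= Q)%N -> f Q = 0) ->
  \sum_(Q < k) (if (Q <= i)%N then f Q else 0) = \sum_(Q < i.+1) f Q.
Proof.
move=> f0; have -> : \sum_(Q < i.+1) f Q = \sum_(Q < i.+1) if (Q <= i)%N then f Q else 0.
  by apply: eq_bigr => Q _; rewrite -ltnS ltn_ord.
apply: (@has_sum_unique _ _ (fun Q => if (Q <= i)%N then f Q else 0)).
  by apply: has_sum_nat_fin => Q /f0 ->; case: ifP.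
by apply: (has_sum_nat_fin (f := fun Q => if (Q <= i)%N then f Q else 0)) => Q;
  rewrite ltnNge => /negbTE ->.
Qed.

(* [beta Q] stands for the coefficients b taken with v' D^Q / Q!. When e^(rD) is
   moved to the left of u_m and of the mode of w1, [p] powers of D are absorbed
   by u, [l] by w1, and [Q] are left. *)
Definition translate_term (beta : nat -> int -> K) (s r : R) (m : int) (Q p l : nat) : K :=
  (rbinom m%:~R p * r ^+ p * (r ^+ Q * translate_coef (s + Q%:R - (m - p%:Z)%:~R) r l))%:C *
  beta Q (m - p%:Z).

(** The given series is grouped by total power j of D. For each of the finitely many Q, the double
    series over p and l converges absolutely and may be summed over l first, where the translation
    factors add up to 1. *)
Lemma translate_resummation (beta : nat -> int -> K) (s r : R) (m : int) (k : nat)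
    (L : nat -> K) (B : K) :
  0 < r < 1 / 2 -> m <= 0 -> (forall Q, term_bounded (beta Q) (1 / 2)) ->
  (forall Q n, (k <= Q)%N -> beta Q n = 0) ->
  (forall j, L j = \sum_(p < j.+1) \sum_(t < (j - p).+1)
     translate_term beta s r m (j - p - t) p t) ->
  has_sum L B ->
  has_sum (fun p : nat => (rbinom m%:~R p * r ^+ p)%:C *
    \sum_(Q < k) (r ^+ Q)%:C * beta Q (m - p%:Z)) B.
Proof.
move=> /andP[r0 r2] m0 tb b0 LE hL.
have r10 : 0 < 1 + r by lra.
have r11 : `|r| < 1 + r by rewrite gtr0_norm //; lra.
pose H Q (x : nat * nat) := translate_term beta s r m Q x.1 x.2.
pose b Q := fun p : nat => (rbinom m%:~R p * r ^+ p)%:C * ((r ^+ Q)%:C * beta Q (m - p%:Z)).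
have row Q p : has_sum (fun l => H Q (p, l)) (b Q p).
  have h := has_sumZ (b Q p) (has_sum_translate (s + Q%:R - (m - p%:Z)%:~R) r10 r11).
  rewrite mulr1 in h; apply: eq_has_sum h => l.
  by rewrite /H /b /translate_term /= !rmorphM /=; ring.
have hH Q : exists S, has_sum (H Q) S.
  have [M hM] := tb Q.
  pose c := r ^+ Q * M * (1 / 2) ^ m * (1 + r) `^ (2 * `|s + Q%:R - m%:~R|).
  have M0 : 0 <= M.
    by apply: le_trans _ (hM 0); rewrite mulr_ge0 ?normc_ge0 ?exprz_ge0 ?divr_ge0.
  have c0 : 0 <= c.
    by rewrite !mulr_ge0 ?powR_ge0 ?exprn_ge0 ?exprz_ge0 ?divr_ge0 // ltW.
  (* Boundedness at 1/2 lets [beta Q] at m-p grow at most like 2^p, so the sum over p needs 2r <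
     1. *)
  have q1 : 0 <= r * 2 < 1 by apply/andP; split; lra.
  have m0' : m%:~R <= 0 :> R by rewrite lerz0.
  have := bounded_sumsZ c0 (bounded_sums_rbinom_le0 m0' q1).
  set C := (C in bounded_sums _ C) => hC.
  apply: (@bounded_has_sum _ _ _ C).
  pose T p := s + Q%:R - (m - p%:Z)%:~R.
  pose W p := normc (b Q p) * (1 + r) `^ (`|T p| - T p).
  have hW : bounded_sums W C.
    apply: bounded_sums_le hC => p.
    rewrite /W /b !normcM !normc_real normrM !(ger0_norm (exprn_ge0 _ (ltW r0))).
    have h1 : normc (beta Q (m - p%:Z)) <= M * (1 / 2) ^ m * 2 ^+ p.
      have := hM (m - p%:Z); rewrite opprB => h.
      have x0 : 0 < ((1 / 2) ^ (p%:Z - m) : R) by rewrite exprz_gt0 // divr_gt0.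
      rewrite -(ler_pM2r x0); apply: le_trans h _.
      rewrite expfzDr //; last by lra.
      have -> : M * (1 / 2) ^ m * 2 ^+ p * ((1 / 2) ^ p * (1 / 2) ^ (- m)) =
        M * ((1 / 2) ^ m * (1 / 2) ^ (- m)) * ((1 / 2) ^ p * 2 ^+ p) by ring.
      rewrite -expfzDr; last by lra.
      rewrite subrr expr0z -exprnP -exprMn.
      by rewrite (_ : 1 / 2 * 2 = 1 :> R) ?expr1n ?mulr1 //; lra.
    have h2 : (1 + r) `^ (`|T p| - T p) <= (1 + r) `^ (2 * `|s + Q%:R - m%:~R|).
      apply: ler_powR; first lra.
      have -> : T p = s + Q%:R - m%:~R + p%:R by rewrite /T rmorphB /=; ring.
      set x := s + _ - _; have p0 : 0 <= p%:R :> R by [].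
      have := ler_normD x p%:R; rewrite (ger0_norm p0).
      have : - x <= `|x| by rewrite -normrN ler_norm.
      lra.
    rewrite exprMn /c.
    have -> : `|rbinom m%:~R p| * r ^+ p * (r ^+ Q * normc (beta Q (m - p%:Z))) *
      (1 + r) `^ (`|T p| - T p) = `|rbinom m%:~R p| * r ^+ p * r ^+ Q *
      (normc (beta Q (m - p%:Z)) * (1 + r) `^ (`|T p| - T p)) by ring.
    have -> : r ^+ Q * M * (1 / 2) ^ m * (1 + r) `^ (2 * `|s + Q%:R - m%:~R|) *
      (`|rbinom m%:~R p| * (r ^+ p * 2 ^+ p)) = `|rbinom m%:~R p| * r ^+ p * r ^+ Q *
      (M * (1 / 2) ^ m * 2 ^+ p * (1 + r) `^ (2 * `|s + Q%:R - m%:~R|)) by ring.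
    apply: ler_wpM2l; first by rewrite !mulr_ge0 ?exprn_ge0 // ltW.
    by apply: ler_pM; rewrite ?normc_ge0 ?powR_ge0.
  apply: (bounded_sums_pair _ _ hW) => [x|p]; first exact: normc_ge0.
  have nb : 0 <= normc (b Q p) by exact: normc_ge0.
  have := bounded_sumsZ nb (bounded_sums_translate (T p) r10 r11).
  rewrite gtr0_norm // /W.
  (* Since T_p is a constant plus p, the difference |T_p| - T_p is bounded above uniformly in p, and
     so is this row bound. *)
  have -> : (1 + r) `^ (- T p - 1) * (1 - r / (1 + r)) `^ (- `|T p| - 1) =
    (1 + r) `^ (`|T p| - T p).
    have -> : 1 - r / (1 + r) = (1 + r)^-1 by field; lra.
    rewrite -powR_inv1 ?ltW // -powRrM -powRD; last by rewrite (gt_eqF r10) implybT.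
    by congr (_ `^ _); ring.
  apply: bounded_sums_le => l.
  rewrite /H /translate_term /b /= !normcM !normc_real !normrM.
  by rewrite le_eqVlt; apply/orP; left; apply/eqP; ring.
have [S hS] := boolp.choice hH.
have hb Q : has_sum (b Q) (S Q) by apply: (@has_sum_rows _ _ _ (H Q) _ _ (hS Q)) => p; exact: row.
have -> : B = \sum_(Q < k) S Q.
  apply: (has_sum_unique hL).
  have h := @has_sum_bigsum _ _ _ (index_enum 'I_k) _ _
    (fun Q : 'I_k => @has_sum_antidiagonal (H Q) (S Q) Q (hS Q)).
  apply: eq_has_sum h => j; rewrite exchange_big LE /=; apply: eq_bigr => p _.
  have pj : (p <= j)%N by rewrite -ltnS.
  pose f Q := H Q (p : nat, (j - p - Q)%N).
  transitivity (\sum_(Q < k) if (Q <= j - p)%N then f Q else 0).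
    by apply: eq_bigr => Q _; rewrite (_ : (p + Q <= j)%N = (Q <= j - p)%N) //; lia.
  rewrite sum_cutoff => [|Q kQ]; last by rewrite /f /H /translate_term b0 // mulr0.
  rewrite (reindex_inj rev_ord_inj) /=; apply: eq_bigr => t _.
  by rewrite /f /H subSS subKn // -ltnS.
have h := @has_sum_bigsum _ _ _ (index_enum 'I_k) _ _ (fun Q : 'I_k => hb Q).
by apply: eq_has_sum h => p; rewrite mulr_sumr.
Qed.

End TranslateResummation.

(** * The expansion of the opposite product about -1/4 *)

Section TaylorExtension.
Variables (R : realType) (V : open_string_vertex_algebra R).
Variable Yf : V -> R -> V -> V.
Hypothesis gr : grading_restricted V.
Hypothesis fv : formal_vertex_operators Yf.
Local Notation K := R[i].
Local Notation C0 := (meromorphic_center Yf).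
Local Notation D := (os_D V).
Local Notation vac := (os_one V).

HB.instance Definition _ j := GRing.isLinear.Build K V V *:%R (@divD R V j) (@divD_linear R V j).

(** The coefficient of r^Q in e^(rD') applied to the functional. *)
Definition dual_divD (phi : {scalar V}) (Q : nat) : {scalar V} := phi \o @divD R V Q.

Variables (u w1 w2 : V) (pu q1 q2 s : R) (phi : {scalar V}).
Hypotheses (hu : homog pu u) (h1 : homog q1 w1) (h2 : homog q2 w2) (cu : C0 u).
Let p := pu + q1 + q2 - 2 - s.

Let coef (r : R) (m : int) (j : nat) : K :=
  (r ^+ j * (1 + r) `^ (- (s + j%:R - m%:~R) - 1))%:C *
  phi (Yf w1 (s + j%:R - m%:~R) (Yf u m%:~R (divD j w2))).

(** The intermediate weights are chosen so that the inner operator gives r^j D^j w2 / j! and the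
    middle one the mode m of u; thus [coef] is the part of degree j in Y(w2,r)1 of the coefficient
    of y^(-m-1). *)
Let three_term (m : int) (j : nat) (r y : R) : 0 < r -> 0 < y ->
  pairing (comp_functional phi p) (product_term (os_Y (o:=V)) w1 (1 + r)
    [:: (u, y); (w2, r)] [:: pu + q2 + j%:R - m%:~R - 1; q2 + j%:R] vac) =
  (y ^ (- m - 1))%:C * coef r m j.
Proof.
move=> r0 y0; have r10 : 0 < 1 + r by lra.
rewrite (pairing_comp phi p (@os_Y_completion R V _ _ _ r10)) /product_term /=.
rewrite (os_Y_mode gr fv _ h2 (homog_vacuum gr) r0).
have -> : q2 + 0 - (q2 + j%:R) - 1 = - j%:R - 1 by ring.
have -> : q2 + j%:R - q2 - 0 = j%:R by ring.
rewrite (mode_on_vacuum_neg gr fv) powR_mulrn ?ltW //.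
have hj : homog (q2 + j%:R) (divD j w2) by exact: homog_divD.
rewrite (os_Y_mode gr fv _ hu (homogZ _ hj) y0) (modeZr fv).
have -> : pu + q2 + j%:R - m%:~R - 1 - pu - (q2 + j%:R) = (- m - 1)%:~R.
  by rewrite rmorphB rmorphN /=; ring.
rewrite powR_intmul ?ltW //.
have -> : pu + (q2 + j%:R) - (pu + q2 + j%:R - m%:~R - 1) - 1 = m%:~R by ring.
have hm : homog (pu + q2 + j%:R - m%:~R - 1) (Yf u m%:~R (divD j w2)).
  have := mode_homog fv m%:~R hu hj.
  by rewrite (_ : pu + (q2 + _) - _ - 1 = pu + q2 + j%:R - m%:~R - 1) //; ring.
rewrite (os_Y_mode gr fv _ h1 (homogZ _ (homogZ _ hm)) r10) 2!(modeZr fv) !linearZ /=.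
have -> : p - q1 - (pu + q2 + j%:R - m%:~R - 1) = - (s + j%:R - m%:~R) - 1.
  by rewrite /p; ring.
have -> : q1 + (pu + q2 + j%:R - m%:~R - 1) - p - 1 = s + j%:R - m%:~R.
  by rewrite /p; ring.
rewrite /coef; move: (y ^ _) (_ `^ _) (r ^+ j) (phi _) => a b c x.
by rewrite rmorphM /=; ring.
Qed.

(** The triple product bounds all pairs of intermediate weights at once, so a single M serves every
    m. This uniformity is what yields the radius of convergence. *)
Let coef_bounded (r y : R) : 0 < r -> r < y < 1 + r ->
  exists M, forall m, bounded_sums (fun j => normc (coef r m j)) (M * y ^ (m + 1)).
Proof.
move=> r0 /andP[ry y1]; have y0 : 0 < y by lra.
have r10 : 0 < 1 + r by lra.
have [||M hM] := abs_convergent_bounded (@os_products_cvg R V _ w1 (1 + r)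
  [:: (u, y); (w2, r)] vac (graded_dual_comp phi p) _ _).
- by rewrite /= y1 ry.
- by rewrite /= r10 y0 r0.
exists M => m.
pose e (j : nat) := [tuple pu + q2 + j%:R - m%:~R - 1; q2 + j%:R].
have einj : injective e.
  by move=> i j [] _ /addrI/eqP; rewrite eqr_nat => /eqP.
have ym : 0 <= y ^ (m + 1) by rewrite exprz_ge0 // ltW.
rewrite mulrC; have := bounded_sumsZ ym (bounded_sums_inj einj hM).
apply: bounded_sums_le => j; rewrite [tval _]/= three_term //; move: (coef r m j) => c.
rewrite normcM normc_real (ger0_norm (exprz_ge0 _ (ltW y0))).
rewrite mulrA -expfzDr ?gt_eqF // (_ : m + 1 + (- m - 1) = 0) ?expr0z ?mul1r //.
by rewrite -opprD subrr.
Qed.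

Let beta Q := coef_opposite Yf u w1 w2 (s + Q%:R) (dual_divD phi Q).

Let coef_resum (r : R) (m : int) (j : nat) :
  coef r m j = \sum_(i < j.+1) \sum_(t < (j - i).+1)
    translate_term beta s r m (j - i - t) i t.
Proof.
rewrite /coef (mode_of_divD gr fv) (mode_sumr fv) linear_sum mulr_sumr.
apply: eq_bigr => i _; have ij : (i <= j)%N by rewrite -ltnS.
rewrite (modeZr fv) linearZ /= (mode_of_divD gr fv) linear_sum !mulr_sumr.
apply: eq_bigr => t _; have tj : (t <= j - i)%N by rewrite -ltnS.
rewrite linearZ /= /translate_term /translate_coef /beta /coef_opposite /dual_divD /=.
have jE : j%:R = (j - i - t)%:R + i%:R + t%:R :> R.
  by rewrite -!natrD; congr _%:R; lia.
have -> : s + (j - i - t)%:R - (m - i%:Z)%:~R + t%:R = s + j%:R - m%:~R.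
  by rewrite jE rmorphB /=; ring.
have -> : s + j%:R - m%:~R - t%:R = s + (j - i - t)%:R - (m - i%:Z)%:~R.
  by rewrite jE rmorphB /=; ring.
move: (rbinom m%:~R i) (rbinom (s + j%:R - m%:~R) t) => b1 b2.
rewrite rmorphB /= !mulrA -!rmorphM /=; congr (_%:C * _).
have -> : r ^+ j = r ^+ i * r ^+ (j - i - t) * r ^+ t.
  by rewrite -!exprD; congr (_ ^+ _); lia.
by move: (_ `^ _) => *; ring.
Qed.

Variable k : nat.
Hypothesis nil : forall v, phi (gproj V p (iter k D v)) = 0.

Let beta_eq0 Q n : (k <= Q)%N -> beta Q n = 0.
Proof.
move=> kQ; rewrite /beta /coef_opposite /dual_divD /=.
set X := Yf w1 _ _.
have hX : homog (p - Q%:R) X.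
  have := mode_homog fv (s + Q%:R - n%:~R) h1 (mode_homog fv n%:~R hu h2).
  by rewrite (_ : q1 + _ - _ - 1 = p - Q%:R) //; rewrite /p; ring.
have := homog_divD Q hX; rewrite subrK => <-.
by rewrite /divD !linearZ /= -(subnKC kQ) iterD nil mulr0.
Qed.

(** Summing [coef] over j gives the coefficients of the triple product in powers of y. Moving
    e^(D/4) to the left identifies them with the Taylor coefficients of the opposite product at
    -1/4, and the triple product converges for y below 5/4. *)
Lemma opposite_taylor_extends :
  taylor_extends (fun m => \sum_(Q < k) ((1 / 4) ^+ Q)%:C *
    coef_opposite Yf u w1 w2 (s + Q%:R) (dual_divD phi Q) m).
Proof.
pose r : R := 1 / 4.
have r0 : 0 < r by rewrite /r; lra.
have cv m : exists B, has_sum (coef r m) B.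
  have y1 : r < 1 < 1 + r by rewrite /r; apply/andP; split; lra.
  have [M hM] := coef_bounded r0 y1.
  exact: bounded_has_sum (hM m).
have [B hB] := boolp.choice cv.
exists (fun n => B (- n%:Z - 1)); split.
  move=> n.
  have tb Q : term_bounded (beta Q) (1 / 2).
    have hw : homog q1 w1 := h1.
    apply: (exp_b (center_expansions gr fv (s + Q%:R) (dual_divD phi Q) hu h1 h2 cu)).
    by apply/andP; split; lra.
  have r2 : 0 < r < 1 / 2 by rewrite /r; apply/andP; split; lra.
  have m0 : - n%:Z - 1 <= 0 by lia.
  have h := translate_resummation r2 m0 tb beta_eq0 (coef_resum r _) (hB (- n%:Z - 1)).
  apply: (@has_sum_reindex _ _ _ (fun i => (n + i)%N) _ _ _ _).2.
  - by move=> i j; lia.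
  - move=> j hj; rewrite bin_small ?mul0r ?mulr0 //.
    by rewrite ltnNge; apply/negP => nj; apply: (hj (j - n)%N); lia.
  apply: eq_has_sum h => i.
  have -> : - n%:Z - 1 - i%:Z = - (n + i)%:Z - 1 by lia.
  rewrite mulrC; congr (_ * _).
  have -> : (- n%:Z - 1)%:~R = - n%:R - 1 :> R by rewrite rmorphB rmorphN /=.
  (* The sign turns powers of r = 1/4 into powers of the centre -1/4. *)
  have e : 'C(n + i, i)%:R = ((-1) ^+ i * rbinom (- n%:R - 1) i)%:C :> K.
    by rewrite -rbinom_reflect -natrD -cbinom_nat cbinomE.
  rewrite -bin_sub ?leq_addr // addKn e -rmorphXn -rmorphM /=.
  congr (_%:C); move: (rbinom _ i) => b; rewrite [RHS]mulrAC -exprMn mulrNN mul1r mulrC; congr (_ * _).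
move=> x /andP[x0 x1].
(* The triple product requires y > 1/4 as well; for smaller x the bound at 1/2 is more than
   enough. *)
pose y := Num.max x (1 / 2).
have y01 : r < y < 1 + r.
  by rewrite /y lt_max gt_max /r; lra.
have y0 : 0 < y by case/andP: y01 => h _; exact: lt_trans r0 h.
have [M hM] := coef_bounded r0 y01.
exists M => n; have := has_sum_normc_le (hB (- n%:Z - 1)) (hM (- n%:Z - 1)).
rewrite subrK => h.
have yn : 0 < y ^+ n by rewrite exprn_gt0.
apply: le_trans (_ : normc (B (- n%:Z - 1)) * y ^+ n <= _).
  apply: ler_wpM2l; first exact: normc_ge0.
  by rewrite lerXn2r ?nnegrE ?(ltW y0) // /y le_max lexx.
by apply: le_trans (ler_wpM2r (ltW yn) h) _; rewrite -mulrA exprnP -expfzDr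
  ?gt_eqF // addNr expr0z mulr1.
Qed.

End TaylorExtension.

Section JacobiLinear.
Variable R : realType.
Local Notation K := R[i].
Implicit Types (a b c : int -> K) (l m : int).

Lemma jacD N a b c a' b' c' l m :
  jac N (fun k => a k + a' k) (fun k => b k + b' k) (fun k => c k + c' k) l m =
  jac N a b c l m + jac N a' b' c' l m.
Proof.
rewrite /jac /jac_product /jac_opposite /jac_iterate.
under eq_bigr do rewrite !mulrDr.
under [X in _ - X - _]eq_bigr do rewrite !mulrDr.
under [X in _ - _ - X]eq_bigr do rewrite !mulrDr.
rewrite !big_split /=; ring.
Qed.

Lemma jacZ N a b c (y : K) l m :
  jac N (fun k => y * a k) (fun k => y * b k) (fun k => y * c k) l m = y * jac N a b c l m.
Proof.
rewrite /jac /jac_product /jac_opposite /jac_iterate !mulrBr !mulr_sumr.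
congr (_ - _ - _); apply: eq_bigr => i _; rewrite [in RHS]mulrCA; congr (_ * _);
  by rewrite [RHS]mulrCA.
Qed.

Lemma jac_zero_sum k (y : nat -> K) (a b c : nat -> int -> K) l m :
  (forall i, (i < k)%N -> jac_zero (a i) (b i) (c i) l m) ->
  jac_zero (fun n => \sum_(i < k) y i * a i n) (fun n => \sum_(i < k) y i * b i n)
    (fun n => \sum_(i < k) y i * c i n) l m.
Proof.
elim: k => [|k IH] h.
  exists 0%N => N _; rewrite /jac /jac_product /jac_opposite /jac_iterate.
  by rewrite !big1 ?subrr // => i _; rewrite big_ord0 ?mulr0.
have [N1 h1] := IH (fun i ik => h i (ltnW ik)).
have [N2 h2] := h k (ltnSn k).
exists (maxn N1 N2) => N; rewrite geq_max => /andP[n1 n2].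
have E (d : nat -> int -> K) : (fun n => \sum_(i < k.+1) y i * d i n) =
    (fun n => \sum_(i < k) y i * d i n + y k * d k n).
  by apply/funext => n; rewrite big_ord_recr.
by rewrite !E jacD jacZ h1 // h2 // mulr0 addr0.
Qed.

Lemma expansions_sum k (y : nat -> K) (a b c : nat -> int -> K) :
  (forall i, expansions (a i) (b i) (c i)) ->
  expansions (fun n => \sum_(i < k.+1) y i * a i n) (fun n => \sum_(i < k.+1) y i * b i n)
    (fun n => \sum_(i < k.+1) y i * c i n).
Proof.
move=> h; elim: k => [|k IH].
  have E (d : nat -> int -> K) : (fun n => \sum_(i < 1) y i * d i n) = (fun n => y 0%N * d 0%N n).
    by apply/funext => n; rewrite big_ord_recl big_ord0 addr0.
  by rewrite !E; exact: expansionsZ (h 0%N).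
have E (d : nat -> int -> K) : (fun n => \sum_(i < k.+2) y i * d i n) =
    (fun n => \sum_(i < k.+1) y i * d i n + y k.+1 * d k.+1 n).
  by apply/funext => n; rewrite big_ord_recr.
by rewrite !E; exact: expansionsD IH (expansionsZ (y k.+1) (h k.+1)).
Qed.

End JacobiLinear.

(** * The Jacobi identity for matrix coefficients *)

Section MatrixJacobi.
Variables (R : realType) (V : open_string_vertex_algebra R).
Variable Yf : V -> R -> V -> V.
Hypothesis gr : grading_restricted V.
Hypothesis fv : formal_vertex_operators Yf.
Local Notation K := R[i].
Local Notation C0 := (meromorphic_center Yf).
Local Notation D := (os_D V).

Variables (u w1 w2 : V) (pu q1 q2 : R).
Hypotheses (hu : homog pu u) (h1 : homog q1 w1) (h2 : homog q2 w2) (cu : C0 u).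

Let jacobi_of (s : R) (phi : {scalar V}) l m :=
  jac_zero (coef_product Yf u w1 w2 s phi) (coef_opposite Yf u w1 w2 s phi)
    (coef_iterate Yf u w1 w2 s phi) l m.

(** The combination of the functionals v'D^Q/Q!, Q <= k, with weights (1/4)^Q satisfies the
    identity. For Q >= 1 the functional is killed by D^(k+1-Q), so the induction covers it with k-Q.
    By linearity the term Q = 0 remains. *)
Let jac_zero_nil k s (phi : {scalar V}) :
  (forall v, phi (gproj V (pu + q1 + q2 - 2 - s) (iter k.+1 D v)) = 0) ->
  forall l m, jacobi_of s phi l m.
Proof.
elim/ltn_ind: k s phi => k IH s phi nil l m.
pose y (Q : nat) : K := ((1 / 4) ^+ Q)%:C.
pose a Q := coef_product Yf u w1 w2 (s + Q%:R) (dual_divD phi Q).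
pose b Q := coef_opposite Yf u w1 w2 (s + Q%:R) (dual_divD phi Q).
pose c Q := coef_iterate Yf u w1 w2 (s + Q%:R) (dual_divD phi Q).
have ex Q : expansions (a Q) (b Q) (c Q) 
  by exact: (center_expansions gr fv (s + Q%:R) (dual_divD phi Q) hu h1 h2 cu).
have te : taylor_extends (fun n => \sum_(Q < k.+1) y Q * b Q n).
  exact: (opposite_taylor_extends gr fv hu h1 h2 cu nil).
have [N1 H1] := expansions_jacobi (@expansions_sum R k y a b c ex) te l m.
have [N2 H2] : jac_zero (fun n => \sum_(i < k) y i.+1 * a i.+1 n)
    (fun n => \sum_(i < k) y i.+1 * b i.+1 n) (fun n => \sum_(i < k) y i.+1 * c i.+1 n) l m.
  apply: (@jac_zero_sum R k (fun i => y i.+1) (fun i => a i.+1)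
    (fun i => b i.+1) (fun i => c i.+1)) => i ik.
  apply: (IH (k - i.+1)%N); first by lia.
  move=> v; set x := gproj _ _ _.
  have -> : dual_divD phi i.+1 x = phi (divD i.+1 x) by [].
  rewrite /x.
  have -> : pu + q1 + q2 - 2 - (s + i.+1%:R) = pu + q1 + q2 - 2 - s - i.+1%:R by ring.
  rewrite -gproj_divD /divD !linearZ -iterD addnS subnKC //.
  by apply/eqP; rewrite mulf_eq0 nil eqxx orbT.
exists (maxn N1 N2) => N; rewrite geq_max => /andP[n1 n2].
have E (d : nat -> int -> K) : (fun n => \sum_(i < k.+1) y i * d i n) =
    (fun n => d 0%N n + \sum_(i < k) y i.+1 * d i.+1 n).
  apply/funext => n; rewrite big_ord_recl; congr (_ + _).
  by rewrite /y expr0 rmorph1 mul1r.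
have := H1 N n1; rewrite !E jacD H2 // addr0 => <-.
congr jac; apply/funext => n.
- by rewrite /a /coef_product /dual_divD /= divD0 addr0.
- by rewrite /b /coef_opposite /dual_divD /= divD0 addr0.
- by rewrite /c /coef_iterate /dual_divD /= divD0 addr0.
Qed.

Lemma center_jac_zero s (phi : {scalar V}) l m :
  jac_zero (coef_product Yf u w1 w2 s phi) (coef_opposite Yf u w1 w2 s phi)
    (coef_iterate Yf u w1 w2 s phi) l m.
Proof.
have [[//|k] _ hk] := os_D_locally_nilpotent
  (graded_dual_comp phi (pu + q1 + q2 - 2 - s)).
exact: (jac_zero_nil (k := k)).
Qed.

End MatrixJacobi.

Lemma sum_widen (W : zmodType) (F : nat -> W) N N' :
  (forall i, (N <= i)%N -> F i = 0) -> (N <= N')%N -> \sum_(i < N') F i = \sum_(i < N) F i.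
Proof.
move=> F0 /subnKC <-; rewrite big_split_ord /= [X in _ + X]big1 ?addr0 // => i _.
by rewrite F0 // leq_addr.
Qed.

(** * From matrix coefficients to vectors *)

Section CenterJacobi.
Variables (R : realType) (V : open_string_vertex_algebra R).
Variable Yf : V -> R -> V -> V.
Hypothesis gr : grading_restricted V.
Hypothesis fv : formal_vertex_operators Yf.
Local Notation K := R[i].
Local Notation C0 := (meromorphic_center Yf).
Implicit Types (u w : V) (l m : int) (n : R).

Definition jacobi_sum N u w1 w2 l m n : V :=
  \sum_(i < N) ((-1) ^+ i * cbinom K l i) *: Yf u (m + l - i%:Z)%:~R (Yf w1 (n + i%:R) w2) -
  \sum_(i < N) ((-1) ^ l * (-1) ^+ i * cbinom K l i) *:
    Yf w1 (n + l%:~R - i%:R) (Yf u (m + i%:Z)%:~R w2) -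
  \sum_(i < N) cbinom K m i *: Yf (Yf u (l + i%:Z)%:~R w1) (m%:~R + n - i%:R) w2.

Lemma jacobi_sumDu N u u' w1 w2 l m n :
  jacobi_sum N (u + u') w1 w2 l m n = jacobi_sum N u w1 w2 l m n + jacobi_sum N u' w1 w2 l m n.
Proof.
rewrite /jacobi_sum addrACA -opprD; congr (_ - _); last first.
  by rewrite -big_split; apply: eq_bigr => i _; rewrite !(modeDl fv) [LHS]scalerDr.
rewrite addrACA -opprD; congr (_ - _); rewrite -big_split; apply: eq_bigr => i _.
  by rewrite (modeDl fv) [LHS]scalerDr.
by rewrite (modeDl fv) (modeDr fv) [LHS]scalerDr.
Qed.

Lemma jacobi_sumDl N u w1 w1' w2 l m n :
  jacobi_sum N u (w1 + w1') w2 l m n = jacobi_sum N u w1 w2 l m n + jacobi_sum N u w1' w2 l m n.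
Proof.
rewrite /jacobi_sum addrACA -opprD; congr (_ - _); last first.
  by rewrite -big_split; apply: eq_bigr => i _; rewrite (modeDr fv) (modeDl fv) [LHS]scalerDr.
rewrite addrACA -opprD; congr (_ - _); rewrite -big_split; apply: eq_bigr => i _.
  by rewrite (modeDl fv) (modeDr fv) [LHS]scalerDr.
by rewrite (modeDl fv) [LHS]scalerDr.
Qed.

Lemma jacobi_sumDr N u w1 w2 w2' l m n :
  jacobi_sum N u w1 (w2 + w2') l m n = jacobi_sum N u w1 w2 l m n + jacobi_sum N u w1 w2' l m n.
Proof.
rewrite /jacobi_sum addrACA -opprD; congr (_ - _); last first.
  by rewrite -big_split; apply: eq_bigr => i _; rewrite (modeDr fv) [LHS]scalerDr.
by rewrite addrACA -opprD; congr (_ - _); rewrite -big_split; apply: eq_bigr => i _;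
  rewrite !(modeDr fv) [LHS]scalerDr.
Qed.

Lemma jacobi_terms_truncated u w1 w2 l m n : exists N0, forall i, (N0 <= i)%N ->
  [/\ Yf w1 (n + i%:R) w2 = 0, Yf u (m + i%:Z)%:~R w2 = 0 & Yf u (l + i%:Z)%:~R w1 = 0].
Proof.
have tr (a b : V) (x : R) : exists N0, forall i, (N0 <= i)%N -> Yf a (x + i%:R) b = 0.
  have [B hB] := mode_truncated gr fv a b.
  exists (Num.bound `|B - x|) => i hi; apply: hB; rewrite -lerBlDl.
  apply: le_trans (ler_norm _) (le_trans (ltW (archi_boundP (normr_ge0 _))) _).
  by rewrite ler_nat.
have [N1 h1] := tr w1 w2 n; have [N2 h2] := tr u w2 m%:~R; have [N3 h3] := tr u w1 l%:~R.
exists (maxn N1 (maxn N2 N3)) => i; rewrite !geq_max => /and3P[i1 i2 i3].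
by rewrite !rmorphD /= h1 // h2 // h3.
Qed.

Lemma jacobi_sum_stable u w1 w2 l m n N N' :
  (forall i, (N <= i)%N -> [/\ Yf w1 (n + i%:R) w2 = 0, Yf u (m + i%:Z)%:~R w2 = 0 &
     Yf u (l + i%:Z)%:~R w1 = 0]) ->
  (N <= N')%N -> jacobi_sum N' u w1 w2 l m n = jacobi_sum N u w1 w2 l m n.
Proof.
move=> h hN; rewrite /jacobi_sum.
pose F1 i := ((-1) ^+ i * cbinom K l i) *: Yf u (m + l - i%:Z)%:~R (Yf w1 (n + i%:R) w2).
pose F2 i := ((-1) ^ l * (-1) ^+ i * cbinom K l i) *:
  Yf w1 (n + l%:~R - i%:R) (Yf u (m + i%:Z)%:~R w2).
pose F3 i := cbinom K m i *: Yf (Yf u (l + i%:Z)%:~R w1) (m%:~R + n - i%:R) w2.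
rewrite (sum_widen (F := F1) _ hN) => [|i /h[h1 _ _]]; last by rewrite /F1 h1 (mode0r fv) scaler0.
rewrite (sum_widen (F := F2) _ hN) => [|i /h[_ h2 _]]; last by rewrite /F2 h2 (mode0r fv) scaler0.
by rewrite (sum_widen (F := F3) _ hN) // => i /h[_ _ h3]; rewrite /F3 h3 (mode0l fv) scaler0.
Qed.

Lemma jacobi_identity_of_sum u w1 w2 l m n N :
  (forall i, (N <= i)%N -> [/\ Yf w1 (n + i%:R) w2 = 0, Yf u (m + i%:Z)%:~R w2 = 0 &
     Yf u (l + i%:Z)%:~R w1 = 0]) ->
  jacobi_sum N u w1 w2 l m n = 0 ->
  jacobi_product (fun u k w => Yf u k%:~R w) Yf u w1 w2 l m n -
  jacobi_opposite (fun u k w => Yf u k%:~R w) Yf u w1 w2 l m n =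
  jacobi_iterate (fun u k w => Yf u k%:~R w) Yf u w1 w2 l m n.
Proof.
move=> h /eqP; rewrite subr_eq0 => /eqP e.
rewrite /jacobi_product (fsum_nat (N := N)) => [|i /h[h1 _ _]]; last first.
  by rewrite h1 (mode0r fv) scaler0.
rewrite /jacobi_opposite (fsum_nat (N := N)) => [|i /h[_ h2 _]]; last first.
  by rewrite h2 (mode0r fv) scaler0.
rewrite /jacobi_iterate (fsum_nat (N := N)) => [|i /h[_ _ h3]]; last first.
  by rewrite h3 (mode0l fv) scaler0.
exact: e.
Qed.

(** All terms have mode indices adding up to l+m+n, so the sum is homogeneous and functionals on one
    component detect it. Stability in N removes the dependence of the truncation on the
    functional. *)
Let jacobi_sum_homog pu q1 q2 u w1 w2 l m n : C0 u -> homog pu u -> homog q1 w1 ->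
  homog q2 w2 -> exists N0, forall N, (N0 <= N)%N -> jacobi_sum N u w1 w2 l m n = 0.
Proof.
move=> cu hu h1 h2; have [N0 tr] := jacobi_terms_truncated u w1 w2 l m n.
exists N0 => N hN.
pose p := pu + q1 + q2 - 2 - (m%:~R + l%:~R + n).
have hp : homog p (jacobi_sum N u w1 w2 l m n).
  have homogB x y : homog p x -> homog p y -> homog p (x - y).
    by move=> hx hy; rewrite -scaleN1r; apply: homogD hx (homogZ _ hy).
  apply: (homogB); first apply: (homogB); apply: homog_sum => i; apply: homogZ.
  - have := mode_homog fv (m + l - i%:Z)%:~R hu (mode_homog fv (n + i%:R) h1 h2).
    by congr homog; rewrite /p rmorphB rmorphD /=; ring.
  - have := mode_homog fv (n + l%:~R - i%:R) h1 (mode_homog fv (m + i%:Z)%:~R hu h2).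
    by congr homog; rewrite /p rmorphD /=; ring.
  - have := mode_homog fv (m%:~R + n - i%:R) (mode_homog fv (l + i%:Z)%:~R hu h1) h2.
    by congr homog; rewrite /p rmorphD /=; ring.
apply: (homog_functional_eq0 gr hp) => phi.
have [N1 hN1] := center_jac_zero gr fv hu h1 h2 cu (m%:~R + l%:~R + n) phi l m.
rewrite (jacobi_sum_stable tr hN) -(jacobi_sum_stable tr (leq_maxl N0 N1)).
rewrite -(hN1 (maxn N0 N1) (leq_maxr _ _)) /jacobi_sum !linearB !linear_sum /jac /= -!sumrN.
congr (_ + _ + _); apply: eq_bigr => i _; rewrite linearZ /=; try congr (- _).
- rewrite /jac_product /coef_product [RHS]mulrCA -[LHS]mulrA.
  congr (_ * (_ * phi (Yf _ _ (Yf _ _ _)))); rewrite rmorphB rmorphD /=; ring.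
- rewrite /jac_opposite /coef_opposite [RHS]mulrCA -[LHS]mulrA.
  congr (_ * (_ * phi (Yf _ _ (Yf _ _ _)))); rewrite rmorphD /=; ring.
- rewrite /jac_iterate /coef_iterate.
  congr (_ * phi (Yf (Yf _ _ _) _ _)); rewrite rmorphD /=; ring.
Qed.

Let center_jacobi_ex u w1 w2 l m n : C0 u ->
  exists N0, forall N, (N0 <= N)%N -> jacobi_sum N u w1 w2 l m n = 0.
Proof.
have zero (F G H : nat -> V) : (forall N, F N = G N + H N) ->
    (exists N0, forall N, (N0 <= N)%N -> G N = 0) ->
    (exists N0, forall N, (N0 <= N)%N -> H N = 0) ->
    exists N0, forall N, (N0 <= N)%N -> F N = 0.
  move=> E [N1 g] [N2 h]; exists (maxn N1 N2) => N; rewrite geq_max => /andP[n1 n2].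
  by rewrite E g // h // addr0.
(* Handles a zero argument: additivity at 0 + 0. *)
have scal0 (F : nat -> V) : (forall N, F N = F N + F N) ->
    exists N0 : nat, forall N, (N0 <= N)%N -> F N = 0.
  by move=> E; exists 0%N => N _; apply: (addrI (F N)); rewrite addr0 -E.
move=> cu; have [s us] := gproj_decomp u; rewrite us.
elim: s {us} => [|p s IH].
  by rewrite big_nil; apply: scal0 => N; rewrite -jacobi_sumDu addr0.
rewrite big_cons; apply: (zero _ _ _ (fun N => jacobi_sumDu N _ _ _ _ _ _ _) _ IH) => {IH}.
have cp := center_gproj gr fv p cu.
elim/graded_ind: w1 => [|w w' hw hw'|q1 w1 h1].
- by apply: (scal0) => N; rewrite -jacobi_sumDl addr0.
- exact: (zero _ _ _ (fun N => jacobi_sumDl N _ _ _ _ _ _ _) hw hw').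
elim/graded_ind: w2 => [|w w' hw hw'|q2 w2 h2].
- by apply: (scal0) => N; rewrite -jacobi_sumDr addr0.
- exact: (zero _ _ _ (fun N => jacobi_sumDr N _ _ _ _ _ _ _) hw hw').
exact: jacobi_sum_homog cp (homog_gproj p u) h1 h2.
Qed.

Lemma center_jacobi_sum u w1 w2 l m n N : C0 u ->
  (forall i, (N <= i)%N -> [/\ Yf w1 (n + i%:R) w2 = 0, Yf u (m + i%:Z)%:~R w2 = 0 &
     Yf u (l + i%:Z)%:~R w1 = 0]) ->
  jacobi_sum N u w1 w2 l m n = 0.
Proof.
move=> cu tr; have [N1 h1] := center_jacobi_ex w1 w2 l m n cu.
by rewrite -(jacobi_sum_stable tr (leq_maxl N N1)) h1 // leq_maxr.
Qed.

Lemma center_jacobi u w1 w2 l m n : C0 u ->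
  jacobi_product (fun u k w => Yf u k%:~R w) Yf u w1 w2 l m n -
  jacobi_opposite (fun u k w => Yf u k%:~R w) Yf u w1 w2 l m n =
  jacobi_iterate (fun u k w => Yf u k%:~R w) Yf u w1 w2 l m n.
Proof.
move=> cu; have [N tr] := jacobi_terms_truncated u w1 w2 l m n.
exact: jacobi_identity_of_sum tr (center_jacobi_sum cu tr).
Qed.

End CenterJacobi.

Lemma sum_triangle (W : nmodType) (G : nat -> nat -> W) N :
  \sum_(j < N) \sum_(a < j.+1) G (j - a)%N a = \sum_(b < N) \sum_(a < N - b) G b a.
Proof.
elim: N => [|N IH]; first by rewrite !big_ord0.
rewrite big_ord_recr IH /= [RHS]big_ord_recr /= subSnn big_ord1.
under [in RHS]eq_bigr => b _ do rewrite subSn ?(ltnW (ltn_ord b)) // big_ord_recr /=.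
rewrite big_split /= -addrA; congr (_ + _).
rewrite [LHS](reindex_inj rev_ord_inj) /= big_ord_recr /= subnn.
by congr (_ + _); [apply: eq_bigr => b _|]; rewrite ?subSS ?subn0 // subKn // ltnW.
Qed.

(** * The center is closed under its modes *)

Section CenterClosed.
Variables (R : realType) (V : open_string_vertex_algebra R).
Variable Yf : V -> R -> V -> V.
Hypothesis gr : grading_restricted V.
Hypothesis fv : formal_vertex_operators Yf.
Local Notation K := R[i].
Local Notation C0 := (meromorphic_center Yf).
Implicit Types (u v w : V) (k l m : int) (n : R).

Let sum_cbinom0 (F : nat -> V) (c : nat -> K) N : c 0%N = 1 ->
  \sum_(i < N.+1) (c i * cbinom K 0 i) *: F i = F 0%N.
Proof.
move=> c0; rewrite big_ord_recl c0 (cbinom_nat R 0 0) bin0 mulr1 scale1r.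
by rewrite big1 ?addr0 // => i _; rewrite (cbinom_nat R 0) bin0n mulr0 scale0r.
Qed.

(** The Jacobi identity with l = k and m = 0: on the iterate side only i = 0 survives. *)
Lemma center_associator u v w k n N : C0 u ->
  (forall i, (N < i)%N -> [/\ Yf v (n + i%:R) w = 0, Yf u i%:R w = 0 &
     Yf u (k + i%:Z)%:~R v = 0]) ->
  Yf (Yf u k%:~R v) n w =
  \sum_(i < N.+1) ((-1) ^+ i * cbinom K k i) *: Yf u (k - i%:Z)%:~R (Yf v (n + i%:R) w) -
  \sum_(i < N.+1) ((-1) ^ k * (-1) ^+ i * cbinom K k i) *:
    Yf v (n + k%:~R - i%:R) (Yf u i%:R w).
Proof.
move=> cu tr.
have J : jacobi_sum Yf N.+1 u v w k 0 n = 0.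
  apply: (center_jacobi_sum gr fv cu) => i /tr[t1 t2 t3].
  by rewrite add0r t1 t3 -[(i%:Z)%:~R]/(i%:R) t2.
move/eqP: J; rewrite /jacobi_sum subr_eq0 => /eqP E; rewrite -[LHS]addr0.
have -> : Yf (Yf u k%:~R v) n w + 0 = \sum_(i < N.+1)
    cbinom K 0 i *: Yf (Yf u (k + i%:Z)%:~R v) (0%:~R + n - i%:R) w.
  under eq_bigr do rewrite -[cbinom _ _ _]mul1r.
  rewrite (sum_cbinom0 (fun i => Yf (Yf u (k + i%:Z)%:~R v) (0%:~R + n - i%:R) w)
    (c := fun=> 1)) //.
  by rewrite addr0 add0r addr0 subr0.
rewrite -E; congr (_ - _); by apply: eq_bigr => i _; rewrite add0r.
Qed.

(** The Jacobi identity for (u; w, v) with l = 0 and m = k: each of the two product sides reduces to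
    i = 0. *)
Lemma center_commutator u v w k n N : C0 u ->
  (forall i, (N < i)%N -> [/\ Yf w (n + i%:R) v = 0, Yf u (k + i%:Z)%:~R v = 0 &
     Yf u i%:R w = 0]) ->
  Yf w n (Yf u k%:~R v) = Yf u k%:~R (Yf w n v) -
  \sum_(i < N.+1) cbinom K k i *: Yf (Yf u i%:R w) (k%:~R + n - i%:R) v.
Proof.
move=> cu tr.
have J : jacobi_sum Yf N.+1 u w v 0 k n = 0.
  apply: (center_jacobi_sum gr fv cu) => i /tr[t1 t2 t3].
  by rewrite add0r t1 t2 -[(i%:Z)%:~R]/(i%:R) t3.
move/eqP: J; rewrite /jacobi_sum.
rewrite (sum_cbinom0 (fun i => Yf u (k + 0 - i%:Z)%:~R (Yf w (n + i%:R) v))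
  (c := fun i => (-1) ^+ i)) ?expr0 //.
rewrite (sum_cbinom0 (fun i => Yf w (n + 0%:~R - i%:R) (Yf u (k + i%:Z)%:~R v))
  (c := fun i => (-1) ^ 0 * (-1) ^+ i)) ?expr0z ?expr0 ?mulr1 // !addr0 ?subr0.
by rewrite addrAC subr_eq0 => /eqP <-; congr (_ - _).
Qed.

Let mode_nonint u v k n w : C0 u -> C0 v -> n \isn't a Num.int ->
  Yf (Yf u k%:~R v) n w = 0.
Proof.
move=> cu cv nn; have [N tr] := jacobi_terms_truncated gr fv u v w k 0 n.
rewrite (@center_associator u v w k n N) // => [|i /ltnW/tr]; last by rewrite add0r.
have nz (z : int) : n + z%:~R \isn't a Num.int.
  by apply: contra nn => h; rewrite -(addrK z%:~R n) rpredB // intr_int.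
rewrite !big1 ?subr0 // => i _.
  rewrite (_ : n + k%:~R - i%:R = n + (k - i%:Z)%:~R); last by rewrite rmorphB /= addrA.
  by rewrite (center_nonint _ cv) ?scaler0.
by rewrite (center_nonint (n := n + i%:R) _ cv) ?(mode0r fv) ?scaler0 //; exact: (nz i).
Qed.

Let nonint_mode u v k n w : C0 u -> C0 v -> n \isn't a Num.int ->
  Yf w n (Yf u k%:~R v) = 0.
Proof.
move=> cu cv nn; have [N tr] := jacobi_terms_truncated gr fv u w v 0 k n.
rewrite (@center_commutator u v w k n N) // => [|i /ltnW/tr]; last by rewrite add0r.
rewrite (center_skew_nonint gr fv _ cv nn) (mode0r fv) big1 ?subr0 // => i _.
rewrite (center_skew_nonint gr fv) ?scaler0 //.
apply: contra nn => h; rewrite (_ : n = k%:~R + n - i%:R - (k - i%:Z)%:~R).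
  by rewrite rpredB // intr_int.
by rewrite rmorphB /=; ring.
Qed.

Let gproj_nonint u v k n : C0 u -> C0 v -> n \isn't a Num.int ->
  gproj V n (Yf u k%:~R v) = 0.
Proof.
move=> [hu _ _] [hv _ _] nn.
have [s us] := gproj_decomp u; have [t vt] := gproj_decomp v.
rewrite us vt (mode_suml fv) linear_sum big1 // => p _.
rewrite (mode_sumr fv) linear_sum big1 // => q _.
have [pi|/hu ->] := boolP (p \is a Num.int); last by rewrite (mode0l fv) linear0.
have [qi|/hv ->] := boolP (q \is a Num.int); last by rewrite (mode0r fv) linear0.
rewrite -(mode_homog fv k%:~R (homog_gproj p u) (homog_gproj q v)) gprojE.
case: eqP => // e; case/negP: nn; rewrite e !rpredB ?rpredD ?intr_int ?rpred1 //.
Qed.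

Let sign_opp (i : nat) : (-1) ^ (- i%:Z) = (-1) ^+ i :> K.
Proof. by rewrite -invr_expz -exprnP -exprVn invrN1. Qed.

(** The commutator formula expresses w_m (u_k v) by w_m v and by the modes of u_i w on v. The
    skew-symmetry of v rewrites both, and the powers of D are moved to the left of u_k. The terms
    with D^b / b! then form the associator formula for (u_k v)_(m+b) w. *)
Let skew_mode u v k w m : C0 u -> C0 v -> exists N0, forall N, (N0 <= N)%N ->
  Yf w m%:~R (Yf u k%:~R v) = skew_sum Yf N (Yf u k%:~R v) w m.
Proof.
move=> cu cv.
have shift (a b : nat) : m%:~R + a%:R + b%:R = m%:~R + (a + b)%:R :> R by rewrite natrD addrA.
have [P1 tr1] := jacobi_terms_truncated gr fv u v w k 0 m%:~R.
have [P2 tr2] := jacobi_terms_truncated gr fv u w v 0 k m%:~R.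
pose P := maxn P1 P2.
have [N3 skv] := center_skew gr fv w m cv.
have [N4 sku] := boolp.choice (fun i : nat =>
  center_skew gr fv (Yf u i%:R w) (k + m - i%:Z) cv).
exists (maxn P.+1 (maxn N3 (\max_(i < P.+1) N4 i))) => N.
rewrite !geq_max => /and3P[PN N3N /bigmax_leqP N4N].
rewrite (@center_commutator u v w k m%:~R P) // => [|i Pi]; last first.
  have /tr2[t1 t2 t3] : (P2 <= i)%N by rewrite (leq_trans (leq_maxr P1 P2)) // ltnW.
  by rewrite add0r in t3.
pose A b := \sum_(i < P.+1) ((-1) ^+ i * cbinom K k i) *:
  Yf u (k - i%:Z)%:~R (Yf v (m%:~R + b%:R + i%:R) w).
pose B b := \sum_(i < P.+1) ((-1) ^ k * (-1) ^+ i * cbinom K k i) *: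
  Yf v (m%:~R + b%:R + k%:~R - i%:R) (Yf u i%:R w).
have -> : Yf u k%:~R (Yf w m%:~R v) =
    \sum_(b < N) ((-1) ^ (m + b%:Z + 1) : K) *: divD b (A b).
  pose G b a := ((-1) ^ (m + b%:Z + 1) : K) *: divD b (((-1) ^+ a * cbinom K k a) *:
    Yf u (k - a%:Z)%:~R (Yf v (m%:~R + b%:R + a%:R) w)).
  (* The power j of D splits into a absorbed by u_k and b left in front. As G vanishes beyond P,
     cutting a at N - b or at P+1 gives the same sum. *)
  have G0 b a : (P < b + a)%N -> G b a = 0.
    move=> h; have /tr1[t _ _] : (P1 <= b + a)%N by rewrite (leq_trans (leq_maxl P1 P2)) // ltnW.
    by rewrite /G shift t (mode0r fv) scaler0 divDr0 scaler0.
  transitivity (\sum_(j < N) \sum_(a < j.+1) G (j - a)%N a).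
    rewrite (skv N N3N) /skew_sum (mode_sumr fv); apply: eq_bigr => j _.
    rewrite (modeZr fv) (mode_of_divD gr fv) scaler_sumr; apply: eq_bigr => a _.
    have aj : (a <= j)%N by rewrite -ltnS.
    rewrite /G divDZ [LHS]scalerA [RHS]scalerA; congr (_ *: divD _ (Yf _ _ (Yf _ _ _))).
    - rewrite mulrA -cbinomE; congr (_ * _).
      rewrite exprnP -expfzDr ?oppr_eq0 ?oner_eq0 //; congr (_ ^ _); lia.
    - by rewrite rmorphB.
    - by rewrite shift subnK.
  rewrite sum_triangle; apply: eq_bigr => b _; rewrite /A divD_sum scaler_sumr.
  transitivity (\sum_(a < P.+1 - b) G b a); last symmetry;
    apply: (sum_widen (F := G b)) => [a ha|]; rewrite ?leq_sub2r ?leq_subr //;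
    by apply: G0; lia.
have -> : \sum_(i < P.+1) cbinom K k i *: Yf (Yf u i%:R w) (k%:~R + m%:~R - i%:R) v =
    \sum_(b < N) ((-1) ^ (m + b%:Z + 1) : K) *: divD b (B b).
  under [RHS]eq_bigr do rewrite /B divD_sum scaler_sumr.
  rewrite exchange_big; apply: eq_bigr => i _.
  have -> : k%:~R + m%:~R - i%:R = (k + m - i%:Z)%:~R :> R by rewrite rmorphB rmorphD.
  rewrite (sku i N); last exact: N4N.
  rewrite /skew_sum scaler_sumr; apply: eq_bigr => b _.
  rewrite divDZ [LHS]scalerA [RHS]scalerA; congr (_ *: divD _ (Yf _ _ _)); last first.
    by rewrite rmorphB rmorphD /=; ring.
  rewrite mulrA mulrC; congr (_ * _).
  rewrite -sign_opp -!expfzDr ?oppr_eq0 ?oner_eq0 //; congr (_ ^ _); lia.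
rewrite -sumrB /skew_sum; apply: eq_bigr => b _.
rewrite (@center_associator u v w k (m%:~R + b%:R) P) // => [|i Pi]; last first.
  have [|_ t2 t3] := tr1 i; first by rewrite (leq_trans (leq_maxl P1 P2)) // ltnW.
  have [|t1 _ _] := tr1 (b + i)%N.
    by rewrite (leq_trans (leq_maxl P1 P2)) // (leq_trans (ltnW Pi)) ?leq_addl.
  rewrite add0r in t2; split=> //; by rewrite shift.
by rewrite -scalerBr -linearB.
Qed.

Lemma center_mode u v k : C0 u -> C0 v -> C0 (Yf u k%:~R v).
Proof.
move=> cu cv; apply: (center_intro gr fv) => [n nn|n w nn|w n nn|w m].
- exact: gproj_nonint.
- exact: mode_nonint.
- exact: nonint_mode.
- exact: skew_mode.
Qed.

(** Du is the mode u_(-2) applied to the vacuum, so closure under modes applies. *)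
Lemma center_D u : C0 u -> C0 (os_D V u).
Proof.
move=> cu; have <- : Yf u (- 2)%:~R (os_one V) = os_D V u.
  have := mode_on_vacuum_neg gr fv 1 u; rewrite /divD (_ : 1`! = 1%N) // invr1 scale1r /= => <-.
  by congr (Yf _ _ _); rewrite rmorphN /= -opprD.
exact: center_mode (center_vacuum gr fv).
Qed.

End CenterClosed.

(** * The vertex algebra structure of the center *)

Section SubmoduleType.
Variables (K : fieldType) (V : lmodType K) (S : submodClosed V).

(** The vertex algebra needs a type of its own; this subtype inherits the linear structure of V, and
    its inclusion is the map [iota] of the theorem. *)
Record submodule_type := SubmoduleType { submodule_val : V; submodule_valP : submodule_val \in S }.

HB.instance Definition _ := [isSub for submodule_val].
HB.instance Definition _ := [Choice of submodule_type by <:].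
HB.instance Definition _ := [SubChoice_isSubLmodule of submodule_type by <:].
End SubmoduleType.

Section InjectiveSums.
Variables (U V : zmodType) (f : {additive U -> V}).
Hypothesis finj : injective f.

(** A sum with infinite support is 0 by convention. Injectivity makes the supports of F and of f
    applied to F equal, so the convention acts alike on both sides. *)
Lemma raddf_fsbig (I : choiceType) (F : I -> U) :
  f (\sum_(i \in [set: I]) F i) = \sum_(i \in [set: I]) f (F i).
Proof.
rewrite raddf_sum; congr (\sum_(i <- _) _); rewrite /finite_support !unlock.
congr (enum_fset (fset_set (_ `&` _))).
apply/seteqP; split=> i /= Fi; apply: contra_not Fi => h; last by rewrite h raddf0.
by apply: finj; rewrite h raddf0.
Qed.

End InjectiveSums.

Definition in_span (K : fieldType) (V : lmodType K) (s : seq V) (v : V) :=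
  exists c : nat -> K, v = \sum_(i < size s) c i *: s`_i.

Lemma in_span_cons (K : fieldType) (V : lmodType K) (x : V) s v :
  in_span (x :: s) v <-> exists a w, in_span s w /\ v = a *: x + w.
Proof.
split=> [[c ->]|[a [_ [[c ->] ->]]]].
  rewrite big_ord_recl; exists (c 0%N), (\sum_(i < size s) c i.+1 *: s`_i); split=> //.
  by exists (fun i => c i.+1).
by exists (fun i => if i is j.+1 then c j else a); rewrite big_ord_recl.
Qed.

Lemma in_span_lin (K : fieldType) (V : lmodType K) (s : seq V) a v w :
  in_span s v -> in_span s w -> in_span s (a *: v + w).
Proof.
move=> [c ->] [d ->]; exists (fun i => a * c i + d i).
rewrite scaler_sumr -big_split; apply: eq_bigr => i _.
by rewrite scalerDl scalerA.
Qed.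

(** Exchange argument, for the homogeneous subspaces of the center: if some x0 of X involves the
    generator x with a nonzero coefficient, then x0 replaces x, and subtracting a multiple of it
    brings any element of X into the span of the other generators. *)
Lemma subspace_span (K : fieldType) (V : lmodType K) (s : seq V) (X : set V) :
  (forall a v w, X v -> X w -> X (a *: v + w)) ->
  (forall v, X v -> in_span s v) ->
  exists t : seq V, (forall i, (i < size t)%N -> X t`_i) /\ forall v, X v -> in_span t v.
Proof.
elim: s X => [|x s IH] X lin sp; first by exists [::].
have [||t [tX tsp]] := IH [set v | X v /\ in_span s v].
- move=> a v w [Xv sv] [Xw sw]; split; [exact: lin | exact: in_span_lin].
- by move=> v [_ sv].
have [h|/existsNP[x0 /not_implyP[Xx0 x0s]]] := pselect (forall v, X v -> in_span s v).
  exists t; split=> [i it|v Xv]; first by have [] := tX i it.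
  by apply: tsp; split=> //; exact: h.
exists (x0 :: t); split=> [[|i] it|v Xv] //=; first by have [] := tX i it.
have /in_span_cons[a [w [sw x0E]]] := sp _ Xx0.
have /in_span_cons[b [y [sy vE]]] := sp _ Xv.
have a0 : a != 0.
  by apply/eqP => a0; apply: x0s; rewrite x0E a0 scale0r add0r.
apply/in_span_cons; exists (b / a), (- (b / a) *: x0 + v); split; last first.
  by rewrite addrA -scalerDl addrN scale0r add0r.
apply: tsp; split; first exact: lin.
rewrite x0E vE scalerDr scalerA mulNr divfK // addrACA -scalerDl addNr scale0r add0r.
exact: in_span_lin.
Qed.

Section GradedSubmodule.
Variables (R : realType) (V : graded_space R[i] R) (S : submodClosed V).
Hypothesis Sproj : forall p x, x \in S -> gproj V p x \in S.
Hypothesis Sint : forall p x, x \in S -> p \isn't a Num.int -> gproj V p x = 0.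
Local Notation K := R[i].
Local Notation U := (submodule_type S).

Definition sub_proj (n : int) (x : U) : U := SubmoduleType (Sproj n%:~R (valP x)).

Lemma sub_proj_linear n : linear (sub_proj n).
Proof. by move=> a x y; apply: val_inj; rewrite /= !linearP. Qed.

HB.instance Definition _ n := GRing.isLinear.Build K U U *:%R (sub_proj n) (sub_proj_linear n).

Let sub_projE m n x : sub_proj m (sub_proj n x) = if m == n then sub_proj n x else 0.
Proof.
by apply: val_inj; rewrite /= gprojE eqr_int; case: ifP.
Qed.

Let val_eq0 (x : U) : (x == 0) = (val x == 0).
Proof. by rewrite -(inj_eq val_inj) raddf0. Qed.

Let sub_proj_fin x : finite_set [set n | sub_proj n x != 0].
Proof.
have inj : {in (fun n : int => n%:~R) @^-1` [set p : R | gproj V p (val x) != 0] &,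
    injective (fun n : int => n%:~R : R)} by move=> m n _ _ /intr_inj.
apply: sub_finite_set (finite_preimage inj (gproj_fin (val x))) => n /=.
by rewrite val_eq0.
Qed.

Let sub_proj_sum x : x = \sum_(n \in [set: int]) sub_proj n x.
Proof.
apply: val_inj; rewrite (raddf_fsbig (f := val) val_inj) {1}[val x]gproj_sum.
have bij : set_bij [set: int] (range (fun n : int => n%:~R : R)) (fun n : int => n%:~R).
  by split=> // m n _ _ /intr_inj.
rewrite -(reindex_fsbig (fun n : int => n%:~R) _ _ (fun p : R => gproj V p (val x)) bij).
(* Projections at non-integral weights vanish on S, so the sum over the reals is one over the
   integers. *)
apply/esym/fsbig_widen => // p [_ np]; apply: Sint; first exact: valP.
by apply/negP => /intrP[m e]; apply: np; exists m.
Qed.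

Definition graded_submodule : graded_space K int :=
  GradedSpace sub_projE sub_proj_fin sub_proj_sum.

Lemma graded_submodule_homog n (x : U) :
  homog (V := graded_submodule) n x <-> homog n%:~R (val x).
Proof. by split=> [/(congr1 val)|h]; last exact: val_inj. Qed.

End GradedSubmodule.

Section CenterAlgebra.
Variables (R : realType) (V : open_string_vertex_algebra R).
Variable Yf : V -> R -> V -> V.
Hypothesis gr : grading_restricted V.
Hypothesis fv : formal_vertex_operators Yf.
Local Notation K := R[i].
Local Notation C0 := (meromorphic_center Yf).
Local Notation D := (os_D V).
Local Notation vac := (os_one V).

Definition center_pred : V -> bool := fun x => `[< C0 x >].

Lemma center_pred_closed : GRing.subsemimod_closed center_pred.
Proof.
split; first split.
- by apply/asboolP; exact: center0 gr fv.
- move=> x y /asboolP cx /asboolP cy; apply/asboolP.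
  by rewrite -[x]scale1r; exact: (centerP gr fv 1 cx cy).
- move=> a x /asboolP cx; apply/asboolP; rewrite -[_ *: _]addr0.
  by apply: (centerP gr fv a cx); exact: center0 gr fv.
Qed.

Definition center_submod : submodClosed V :=
  HB.pack center_pred (GRing.isSubmodClosed.Build K V center_pred center_pred_closed).

Local Notation U := (submodule_type center_submod).

Lemma center_mem (x : V) : reflect (C0 x) (x \in center_submod).
Proof. exact: asboolP. Qed.

Lemma center_val (x : U) : C0 (val x).
Proof. exact/center_mem/valP. Qed.

Definition center_sub (x : V) (cx : C0 x) : U := SubmoduleType (introT (center_mem x) cx).

Let proj_mem p x : x \in center_submod -> gproj V p x \in center_submod.
Proof. by move=> /center_mem cx; apply/center_mem; exact: center_gproj. Qed.

Let nonint_proj p x : x \in center_submod -> p \isn't a Num.int -> gproj V p x = 0.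
Proof. by move=> /center_mem[h _ _]; exact: h. Qed.

Definition center_space : graded_space K int := graded_submodule proj_mem nonint_proj.

Definition center_Y (u : U) (n : int) (v : U) : U :=
  center_sub (center_mode gr fv n (center_val u) (center_val v)).

Definition center_Dop (u : U) : U := center_sub (center_D gr fv (center_val u)).

Lemma center_Dop_linear : linear center_Dop.
Proof. by move=> a x y; apply: val_inj; rewrite /= !linearP. Qed.

HB.instance Definition _ := GRing.isLinear.Build K U U *:%R center_Dop center_Dop_linear.

Let intK (n : int) : (n%:~R : R)%:C = n%:~R :> K.
Proof. by rewrite rmorph_int. Qed.

Let trunc_int (u v : V) : exists N : int, forall n, N <= n -> Yf u n%:~R v = 0.
Proof.
have [N h] := mode_truncated gr fv u v; exists (Num.bound `|N|)%:Z => n hn; apply: h.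
apply: le_trans (ler_norm N) (le_trans (ltW (archi_boundP (normr_ge0 N))) _).
by rewrite -(ler_int R) in hn.
Qed.

Let center_bilinear : bilinear_modes center_Y.
Proof.
split=> [n v a x y|u n a x y]; apply: val_inj; rewrite /=.
  by rewrite (fv_linearl fv).
by rewrite (fv_linearr fv).
Qed.

Let center_truncated : lower_truncated center_Y.
Proof.
move=> u v; have [N h] := trunc_int (val u) (val v).
by exists N => n hn; apply: val_inj; rewrite /= h.
Qed.

Let homog_val n (x : U) : homog (V := center_space) n x <-> homog n%:~R (val x).
Proof. exact: graded_submodule_homog. Qed.

Let center_weight p (u : U) n : homog (V := center_space) p u ->
  has_weight (V := center_space) (center_Y u n) (p - n - 1).
Proof.
move=> /homog_val hu q v /homog_val hv; apply/homog_val => /=.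
have := mode_homog fv n%:~R hu hv; congr homog.
by rewrite !(rmorphD, rmorphN) /=; ring.
Qed.

Let center_one : U := center_sub (center_vacuum gr fv).

Let center_one_weight : homog (V := center_space) 0 center_one.
Proof. by apply/homog_val; exact: homog_vacuum. Qed.

Let center_D_weight : has_weight (V := center_space) center_Dop 1.
Proof.
move=> n v /homog_val hv; apply/homog_val; rewrite rmorphD /=.
exact: os_D_weight.
Qed.

Let vacuum_int (n : int) (v : V) : Yf vac n%:~R v = if n == -1 then v else 0.
Proof. by rewrite (mode_vacuum gr fv) -(eqr_int R) rmorphN. Qed.

Let center_identity n (v : U) : center_Y center_one n v = if n == -1 then v else 0.
Proof. by apply: val_inj; rewrite /= vacuum_int; case: ifP. Qed.

Let center_creation (u : U) : center_Y u (-1) center_one = u /\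
  (forall n, 0 <= n -> center_Y u n center_one = 0).
Proof.
split=> [|n n0]; apply: val_inj; rewrite /=.
  by rewrite rmorphN /= (mode_on_vacuum_N1 gr fv).
rewrite (mode_on_vacuum_ge0 gr fv) //; apply: lt_le_trans (_ : 0 <= _).
  by rewrite ltrN10.
by rewrite ler0z.
Qed.

Let center_D_derivative : D_derivative intr center_Dop center_Y.
Proof.
move=> u n v; apply: val_inj; rewrite /=.
by rewrite (mode_D gr fv) intK rmorphB.
Qed.

Let center_D_bracket : D_bracket intr center_Dop center_Y.
Proof.
move=> u n v; apply: val_inj; rewrite /=.
by rewrite (mode_D_bracket gr fv) (mode_D gr fv) intK rmorphB.
Qed.

Let val_fsbig (F : nat -> U) : submodule_val (\sum_(i \in [set: nat]) F i) =
  \sum_(i \in [set: nat]) submodule_val (F i).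
Proof. exact: (raddf_fsbig (f := val) val_inj). Qed.

Let center_jacobi_identity : jacobi_identity center_Y center_Y center_Y center_Y.
Proof.
move=> u w1 w2 l m n; apply: val_inj.
have := center_jacobi gr fv (val w1) (val w2) l m n%:~R (center_val u).
rewrite [val (_ - _)]linearB /= /jacobi_product /jacobi_opposite /jacobi_iterate.
rewrite !val_fsbig => E; apply: etrans (etrans E _).
  congr (_ - _); apply: eq_fsbigr => i _ /=.
    by rewrite [in RHS]/=; congr (_ *: Yf _ _ (Yf _ _ _)); rewrite rmorphD /= rmorph_nat.
  congr (_ *: Yf _ _ (Yf _ _ _)).
  by rewrite rmorphB rmorphD /= rmorph_nat rmorph_int.
apply: eq_fsbigr => i _ /=; congr (_ *: Yf (Yf _ _ _) _ _).
by rewrite rmorphB rmorphD /= rmorph_nat rmorph_int.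
Qed.

Definition center_algebra : vertex_algebra R := @VertexAlgebra R center_space center_Y
  center_one center_Dop center_bilinear center_truncated center_weight center_one_weight
  center_D_weight center_identity center_creation center_D_derivative center_D_bracket
  center_jacobi_identity.

End CenterAlgebra.

Section CenterModule.
Variables (R : realType) (V : open_string_vertex_algebra R).
Variable Yf : V -> R -> V -> V.
Hypothesis gr : grading_restricted V.
Hypothesis fv : formal_vertex_operators Yf.
Local Notation K := R[i].
Local Notation C0 := (meromorphic_center Yf).
Local Notation U := (center_algebra gr fv).
Local Notation iota := (@submodule_val K V (center_submod gr fv)).

Lemma center_grading_restricted : grading_restricted U.
Proof.
split=> [n|].
  have [sp _] := gr; have [s hs] := sp n%:~R.
  have [||t [tC tsp]] := @subspace_span K V s [set v | C0 v /\ homog n%:~R v].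
  - move=> a v w [cv hv] [cw hw]; split; first exact: (centerP gr fv a cv cw).
    exact: homogD (homogZ a hv) hw.
  - by move=> v [_ hv]; exact: hs.
  pose x0 : submodule_type (center_submod gr fv) := 0.
  pose t' : seq (submodule_type (center_submod gr fv)) := map (insubd x0) t.
  have tv i : (i < size t)%N -> val t'`_i = t`_i.
    move=> it; rewrite /t' (nth_map 0) // val_insubd ifT //.
    by apply/center_mem; have [] := tC i it.
  exists t' => x /graded_submodule_homog hx.
  have [c cE] := tsp (val x) (conj (center_val x) hx).
  exists c; apply: val_inj; rewrite cE linear_sum size_map; apply: eq_bigr => i _.
  by rewrite [RHS]linearZ; congr (_ *: _); exact/esym/tv.
have [N hN] := homog_bounded_below gr.
exists (- (Num.bound `|N|)%:Z) => n hn x /graded_submodule_homog hx.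
apply: val_inj; apply: hN hx; rewrite -(ltr_int R) rmorphN /= in hn.
apply: lt_le_trans hn _; rewrite lerNl; apply: le_trans (ler_norm _) _.
by rewrite normrN; exact: ltW (archi_boundP (normr_ge0 N)).
Qed.

Lemma center_module : is_va_module (U := U)
  (fun u n (w : V) => Yf (iota u) n%:~R w) (os_D V).
Proof.
have intK (n : int) : (n%:~R : R)%:C = n%:~R :> K by rewrite rmorph_int.
split=> //.
- split=> [n v a x y|u n a x y]; first by rewrite /= (fv_linearl fv).
  by rewrite (fv_linearr fv).
- move=> u v; have [N h] := mode_truncated gr fv (iota u) v.
  exists (Num.bound `|N|)%:Z => n hn; apply: h.
  apply: le_trans (ler_norm N) (le_trans (ltW (archi_boundP (normr_ge0 N))) _).
  by rewrite -(ler_int R) in hn.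
- move=> p u n /graded_submodule_homog hu; rewrite !(rmorphD, rmorphN) /=.
  exact: fv_weight.
- exact: os_D_weight.
- move=> n w; rewrite (_ : iota (va_one U) = os_one V) // (mode_vacuum gr fv).
  by rewrite -(eqr_int R) rmorphN.
- by move=> u n v; rewrite (mode_D gr fv) intK rmorphB.
- by move=> u n v; rewrite (mode_D_bracket gr fv) (mode_D gr fv) intK rmorphB.
- move=> u w1 w2 l m n.
  have := center_jacobi gr fv (val w1) w2 l m n%:~R (center_val u).
  rewrite /jacobi_product /jacobi_opposite /jacobi_iterate.
  move=> E; apply: etrans (etrans E _).
    congr (_ - _); apply: eq_fsbigr => i _.
      by congr (_ *: Yf _ _ (Yf _ _ _)); rewrite rmorphD /= rmorph_nat.
    congr (_ *: Yf _ _ (Yf _ _ _)).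
    by rewrite rmorphB rmorphD /= rmorph_nat rmorph_int.
  apply: eq_fsbigr => i _; congr (_ *: Yf (Yf _ _ _) _ _).
  by rewrite rmorphB rmorphD /= rmorph_nat rmorph_int.
Qed.

End CenterModule.

Theorem theorem2p3 (R : realType) (V : open_string_vertex_algebra R)
    (Yf : V -> R -> V -> V) :
  grading_restricted V ->
  formal_vertex_operators Yf ->
  let C0 := meromorphic_center Yf in
  (forall u v, C0 u -> C0 v ->
     (forall n, C0 (Yf u n v)) /\
     (forall n, n \isn't a Num.int -> Yf u n v = 0)) /\
  (forall u, C0 u -> C0 (os_D V u)) /\
  exists (U : vertex_algebra R) (iota : {linear U -> V}),
    (* U is (C0, Yf|C0, 1, D), through iota : U ~ C0 *)
    [/\ injective iota, range iota = C0,
        forall n u, iota (gproj U n u) = gproj V n%:~R (iota u) &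
        forall u n v, iota (va_Y u n v) = Yf (iota u) n%:~R (iota v)] /\
    iota (va_one U) = os_one V /\
    (forall u, iota (va_D U u) = os_D V (iota u)) /\
    grading_restricted U /\
    exists VM : is_va_module (fun (u : U) (n : int) (w : V) =>
                  Yf (iota u) n%:~R w) (os_D V),
      let W := VAModule VM in
      @intertwining_operator R U W W W Yf.
Proof.
move=> gr fv C0; split.
  move=> u v cu cv; have nz n : n \isn't a Num.int -> Yf u n v = 0 by exact: center_nonint.
  split=> // n; have [/intrP[k ->]|/nz ->] := boolP (n \is a Num.int).
    exact: center_mode.
  exact: center0 gr fv.
split; first by move=> u; exact: center_D.
exists (center_algebra gr fv).
exists (val : {linear submodule_type (center_submod gr fv) -> V}).
split.
  split=> //.
  apply/seteqP; split=> [_ [x _ <-]|x cx]; first exact: center_val.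
  by exists (center_sub gr fv cx).
do 3!split=> //; first exact: center_grading_restricted.
exists (center_module gr fv) => /=; split.
- by split; [exact: fv_linearl | exact: fv_linearr].
- exact: mode_truncated.
- by move=> u w1 w2 l m n; exact: (center_jacobi gr fv _ _ _ _ _ (center_val u)).
- by move=> u n v; rewrite (mode_D gr fv).
Qed.
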